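(* Let $k\in\mathbb{C}\setminus\{0\}$. For $n\in\mathbb{C}$ and $\ell\in\mathbb{Z}$, the module $\widehat{P}^k_{n-\ell+\varepsilon(\ell),\ell k}$ is a projective cover in $\mathcal{O}_k^{fin}$ of the atypical irreducible module $\widehat{A}^k_{n-\ell+\varepsilon(\ell),\ell k}$, where $\varepsilon(\ell)=\frac12,0,-\frac12$ for $\ell>0$, $\ell=0$, $\ell<0$ respectively.
   Context: **Algebra.** $\mathfrak{gl}(1|1)$ has even basis $N,E$ and odd basis $\psi^+,\psi^-$; nonzero brackets $[N,\psi^\pm]=\pm\psi^\pm$, $\{\psi^+,\psi^-\}=E$; invariant form $\kappa(N,E)=\kappa(E,N)=1$, $\kappa(\psi^+,\psi^-)=-\kappa(\psi^-,\psi^+)=1$, zero on other pairs of basis elements. $\widehat{\mathfrak{gl}(1|1)}=\mathfrak{gl}(1|1)\otimes\mathbb{C}[t,t^{-1}]\oplus\mathbb{C}\mathbf{k}$ with $\mathbf k$ central, $[a_r,b_s]=[a,b]_{r+s}+r\kappa(a,b)\delta_{r+s,0}\mathbf{k}$, $a_r=a\otimes t^r$. For a $\mathfrak{gl}(1|1)$-module $M$, $\widehat{M}^k$ is the level-$k$ $\widehat{\mathfrak{gl}(1|1)}$-module induced from $M$ (with $a_r$, $r>0$, acting by $0$, $a_0$ acting as $a$, $\mathbf k$ acting by $k$). $V_k(\mathfrak{gl}(1|1))$ is induced from the trivial module, a vertex operator superalgebra with conformal vector $\omega=\frac{1}{2k}(N_{-1}E_{-1}+E_{-1}N_{-1}-\psi^+_{-1}\psi^-_{-1}+\psi^-_{-1}\psi^+_{-1})\mathbf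 1+\frac{1}{2k^2}E_{-1}^2\mathbf 1$; $L_n$ are the Virasoro modes. **Category.** $\mathcal{O}_k^{fin}$ is the supercategory of finite-length grading-restricted generalized $V_k(\mathfrak{gl}(1|1))$-modules (direct sums of finite-dimensional generalized $L_0$-eigenspaces, lower-bounded in each coset of $\mathbb Z$) on which $N_0,E_0$ act semisimply. Modules are $\mathbb Z_2$-graded; morphisms may be even or odd. **Modules.** $V_{n,e}$ is the 2-dimensional Verma $\mathfrak{gl}(1|1)$-module with highest-weight vector $v$: $Nv=(n+\frac12)v$, $Ev=ev$, $\psi^+v=0$. $A_n$ is the 1-dimensional module with $N=n$, $E=\psi^\pm=0$. $P_n=U(\mathfrak{gl}(1|1))\otimes_{U(\mathrm{span}\{N,E\})}\mathbb{C}v_n$ with $Nv_n=nv_n$, $Ev_n=0$. $\widehat V^k_{n,e}$ is induced from $V_{n,e}$; $\widehat A^k_{n,0}$ is induced from $A_n$ (irreducible); for $\ell\in\mathbb{Z}\setminus\{0\}$, $\widehat A^k_{n,\ell k}$ is the unique irreducible quotient of $\widehat V^k_{n,\ell k}$. $\widehat P^k_{n,0}=\widehat P^k_n$ is induced from $P_n$. For $\ell\neq0$: let $\sigma^\ell$ be the automorphism of $\widehat{\mathfrak{gl}(1|1)}$ with $\sigma^\ell(N_r)=N_r$, $\sigma^\ell(E_r)=E_r-\ell\mathbf{k}\delta_{r,0}$, $\sigma^\ell(\psi^\pm_r)=\psi^\pm_{r\mp\ell}$, $\sigma^\ell(\mathbf k)=\mathbf k$, and $w$ the automorphism $w(N_r)=-N_r$,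 $w(E_r)=-E_r$, $w(\psi^+_r)=\psi^-_r$, $w(\psi^-_r)=-\psi^+_r$, $w(\mathbf k)=\mathbf k$. For an automorphism $\tau$ and a module $W$, $\tau(W)$ is $W$ with $a$ acting as $\tau^{-1}(a)$. For $\ell<0$: $\widehat P^k_{n-\ell-\frac12,\ell k}:=\sigma^\ell(\widehat P^k_n)$. For $\ell>0$: $\widehat P^k_{-n-\ell+\frac12,\ell k}:=\sigma^\ell(w(\widehat P^k_n))$ ($n\in\mathbb{C}$). **Projective cover.** A projective cover of $S$ is a projective object $P$ with a surjection $\pi:P\to S$ such that for every surjection $q:Q\to S$ with $Q$ projective there is a surjection $\widetilde q:Q\to P$ with $q=\pi\circ\widetilde q$. *)

(* Defs.v *)
(* The field of complex numbers is [R[i]] for [R : realType]; the definitions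
   are given over an arbitrary field F. *)
From HB Require Import structures.
From mathcomp Require Import all_boot all_order all_algebra.
From mathcomp Require Import generic_quotient ring_quotient.
From mathcomp Require Import complex boolp classical_sets reals.
From mathcomp Require Import freeg ring.

Set Implicit Arguments.
Unset Strict Implicit.
Unset Printing Implicit Defensive.

Import GRing.Theory Num.Theory Order.TTheory.
Local Open Scope ring_scope.

Section QuotientLmodule.
Variables (F : pzRingType) (V : lmodType F).

Definition subspace (S : V -> Prop) : Prop :=
  S 0 /\ forall a u v, S u -> S v -> S (a *: u + v).

Variables (S : V -> Prop) (hS : subspace S).
Local Open Scope quotient_scope.

Definition subspace_pred of subspace S : {pred V} := fun x => `[< S x >].

Fact subspace_pred_zmod : zmod_closed (subspace_pred hS).
Proof.
case: (hS) => S0 Sl; split=> [|x y /asboolP Sx /asboolP Sy]; apply/asboolP => //.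
by rewrite addrC -scaleN1r; apply: Sl.
Qed.
HB.instance Definition _ :=
  GRing.isZmodClosed.Build V (subspace_pred hS) subspace_pred_zmod.

Let I : zmodClosed V := subspace_pred hS.

Definition lquot : Type := Quotient.quot I.
HB.instance Definition _ := GRing.Zmodule.on lquot.

Definition lpi (x : V) : lquot := \pi_(Quotient.quot I) x.
Definition lrepr (q : lquot) : V := repr (q : Quotient.quot I).

Lemma lreprK : cancel lrepr lpi. Proof. exact: reprK. Qed.

Lemma lpi_eq x y : lpi x = lpi y <-> S (x - y).
Proof.
split=> [xy|/asboolP xy]; last by apply/eqP; rewrite -Quotient.idealrBE.
by apply/asboolP; have /eqP := xy; rewrite -Quotient.idealrBE.
Qed.

Lemma lpiB x y : lpi (x - y) = lpi x - lpi y.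
Proof. by rewrite /lpi raddfB. Qed.
Lemma lpiD x y : lpi (x + y) = lpi x + lpi y.
Proof. by rewrite /lpi raddfD. Qed.

Definition qscale (a : F) (q : lquot) : lquot := lpi (a *: lrepr q).

Lemma qscale_pi a x : qscale a (lpi x) = lpi (a *: x).
Proof.
apply/lpi_eq; rewrite -scalerBr -[_ *: _]addr0.
by case: (hS) => S0 Sl; apply: Sl => //; apply/lpi_eq; rewrite lreprK.
Qed.

Fact qscaleA a b v : qscale a (qscale b v) = qscale (a * b) v.
Proof. by rewrite -[v]lreprK !qscale_pi scalerA. Qed.
Fact qscale1 : left_id 1 qscale.
Proof. by move=> v; rewrite -[v]lreprK qscale_pi scale1r. Qed.
Fact qscaleDr : right_distributive qscale +%R.
Proof.
by move=> a u v; rewrite -[u]lreprK -[v]lreprK -lpiD !qscale_pi scalerDr lpiD.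
Qed.
Fact qscaleDl v : {morph qscale^~ v : a b / a + b}.
Proof. by move=> a b; rewrite -[v]lreprK !qscale_pi scalerDl lpiD. Qed.

HB.instance Definition _ :=
  GRing.Zmodule_isLmodule.Build F lquot qscaleA qscale1 qscaleDr qscaleDl.

Lemma lpi_linear : linear lpi.
Proof. by move=> a u v; rewrite lpiD -qscale_pi. Qed.

Definition lquot_map (f : V -> V) (q : lquot) : lquot := lpi (f (lrepr q)).

Lemma lquot_mapE (f : V -> V) : linear f -> (forall x, S x -> S (f x)) ->
  forall x, lquot_map f (lpi x) = lpi (f x).
Proof.
move=> lf fS x; apply/lpi_eq.
have -> : f (lrepr (lpi x)) - f x = f (lrepr (lpi x) - x).
  by rewrite addrC -scaleN1r -lf scaleN1r addrC.
by apply: fS; apply/lpi_eq; rewrite lreprK.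
Qed.

Lemma lquot_map_linear (f : V -> V) :
  linear f -> (forall x, S x -> S (f x)) -> linear (lquot_map f).
Proof.
move=> lf fS a u v; rewrite -[u]lreprK -[v]lreprK -lpi_linear.
by rewrite !lquot_mapE // lf lpi_linear.
Qed.
End QuotientLmodule.

Section LinearFacts.
Variables (F : pzRingType) (U V : lmodType F) (f : U -> V).
Hypothesis lf : linear f.

Lemma lin0 : f 0 = 0.
Proof. by have := lf (-1) 0 0; rewrite scaler0 addr0 scaleN1r addNr. Qed.
Lemma linZ c u : f (c *: u) = c *: f u.
Proof. by have := lf c u 0; rewrite !addr0 lin0 addr0. Qed.
Lemma linD u v : f (u + v) = f u + f v.
Proof. by have := lf 1 u v; rewrite !scale1r. Qed.
Lemma linB u v : f (u - v) = f u - f v.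
Proof. by rewrite linD -scaleN1r linZ scaleN1r. Qed.
Lemma lin_sum (I : Type) (r : seq I) (h : I -> U) :
  f (\sum_(i <- r) h i) = \sum_(i <- r) f (h i).
Proof.
by elim: r => [|i r IHr]; rewrite ?big_nil ?lin0 // !big_cons linD IHr.
Qed.
End LinearFacts.

Section Super.
Variable F : fieldType.

Definition sgn (b : bool) : F := (-1) ^+ b.

(* The Z_2-grading is encoded by the parity involution: its eigenspaces for
   1 and -1 are the even and the odd part (the characteristic is not 2). *)
Record superspace := Superspace {
  ss_sort :> lmodType F;
  par : ss_sort -> ss_sort;
  par_linear : linear par;
  parK : involutive par }.

Definition homog (W : superspace) (b : bool) (w : W) : Prop :=
  par w = sgn b *: w.

(* A Lie superalgebra presented by the structure constants of a homogeneous
   basis; a finite linear combination of basis vectors is a list of pairs. *)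
Record liesuper := Liesuper {
  lbasis :> choiceType;
  lpar : lbasis -> bool;
  lbr : lbasis -> lbasis -> seq (F * lbasis);
  lbr_par : forall a b p, p \in lbr a b -> lpar p.2 = lpar a (+) lpar b }.

Record smod (g : liesuper) := Smod {
  sm_space :> superspace;
  act : g -> sm_space -> sm_space;
  act_linear : forall a, linear (act a);
  act_par : forall a w, par (act a w) = sgn (lpar a) *: act a (par w);
  act_br : forall a b w,
    act a (act b w) - sgn (lpar a && lpar b) *: act b (act a w) =
    \sum_(p <- lbr a b) p.1 *: act p.2 w }.

Definition lact (g : liesuper) (W : smod g) (s : seq (F * g)) (w : W) : W :=
  \sum_(p <- s) p.1 *: act p.2 w.
Arguments lact {g} W s w.

(* Even homomorphisms. *)
Definition smod_hom (g : liesuper) (W X : smod g) (f : W -> X) : Prop :=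
  [/\ linear f, forall w, par (f w) = f (par w) &
      forall a w, f (act a w) = act a (f w)].

Definition smod_sub (g : liesuper) (W : smod g) (S : W -> Prop) : Prop :=
  [/\ subspace S, forall w, S w -> S (par w) &
      forall a w, S w -> S (act a w)].

Definition smod_irreducible (g : liesuper) (W : smod g) : Prop :=
  (exists w : W, w <> 0) /\
  forall S : W -> Prop, smod_sub S ->
    (forall w, S w -> w = 0) \/ (forall w, S w).

Definition surj (A B : Type) (f : A -> B) : Prop := forall y, exists x, f x = y.

Section Twist.
Variables (g : liesuper) (W : smod g) (t : g -> seq (F * g)).
Hypothesis t_par : forall a p, p \in t a -> lpar p.2 = lpar a.
Hypothesis t_br : forall a b (w : W),
  lact W (t a) (lact W (t b) w) - sgn (lpar a && lpar b) *: lact W (t b) (lact W (t a) w)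
  = \sum_(p <- lbr a b) p.1 *: lact W (t p.2) w.

Lemma lact_linear (s : seq (F * g)) : linear (lact W s).
Proof.
move=> c u v; rewrite /lact scaler_sumr -big_split /=.
apply: eq_bigr => p _; rewrite act_linear scalerDr !scalerA.
by rewrite [c * _]mulrC.
Qed.

Fact twist_par a w : par (lact W (t a) w) = sgn (lpar a) *: lact W (t a) (par w).
Proof.
rewrite /lact (lin_sum (@par_linear W)) scaler_sumr !big_seq.
apply: eq_bigr => p pa.
by rewrite (linZ (@par_linear W)) act_par (t_par pa) !scalerA mulrC.
Qed.

(* [W] with [a] acting as the combination [t a]. *)
Definition twist : smod g :=
  @Smod g W (fun a => lact W (t a)) (fun a => lact_linear (t a)) twist_par t_br.
End Twist.

(* The module U(g) (x)_{U(s)} M for the subalgebra [s] spanned by the basis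
   vectors satisfying [S], where [b] in [S] acts on M by [rho b]: the quotient
   of T(g) (x) M, spanned by the words in the basis of g followed by an element
   of M, by the relations of U(g) and the balancing relation over U(s). *)
Section Induced.
Variables (g : liesuper) (S : pred g) (M : superspace) (rho : g -> M -> M).
Hypothesis rho_par : forall b m, S b ->
  par (rho b m) = sgn (lpar b) *: rho b (par m).

Local Notation word := (seq g * M)%type.
Local Notation T := {freeg word / F}.

Definition mon (u : seq g) (m : M) : T := << ((u, m) : word) >>.
Definition wpar (u : seq g) : bool := odd (count (@lpar g) u).
Definition lmul (b : g) : T -> T := fglift (fun p : word => mon (b :: p.1) p.2).
Definition tpar : T -> T :=
  fglift (fun p : word => sgn (wpar p.1) *: mon p.1 (par p.2)).

Inductive ind_rel : T -> Prop :=
| ind_rel0 : ind_rel 0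
| ind_relD c x y : ind_rel x -> ind_rel y -> ind_rel (c *: x + y)
| ind_relM b x : ind_rel x -> ind_rel (lmul b x)
| ind_rel_lin c m m' :
    ind_rel (mon [::] (c *: m + m') - (c *: mon [::] m + mon [::] m'))
| ind_rel_br a b u m :
    ind_rel (mon (a :: b :: u) m
             - sgn (lpar a && lpar b) *: mon (b :: a :: u) m
             - \sum_(p <- lbr a b) p.1 *: mon (p.2 :: u) m)
| ind_rel_sub b m : S b -> ind_rel (mon [:: b] m - mon [::] (rho b m)).

Lemma fglift_linear (K : choiceType) (N : lmodType F) (f : K -> N) :
  linear (fglift f : {freeg K / F} -> N).
Proof.
have fB := @lift_is_additive F K N f.
have f0 : fglift f 0 = 0 by have := fB 0 0; rewrite !subrr.
have fD x y : fglift f (x + y) = fglift f x + fglift f y.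
  by have := fB x (- y); have := fB 0 y; rewrite opprK f0 !sub0r => -> ->; rewrite opprK.
move=> c x y; rewrite fD; congr (_ + _).
elim/freeg_ind_dom0: x => [|z k x _ _ IH]; first by rewrite scaler0 f0 scaler0.
rewrite scalerDr !fD scalerDr -IH; congr (_ + _).
suff -> : c *: (<< z *g k >> : {freeg K / F}) = << (c * z) *g k >>.
  by rewrite !liftU scalerA.
by apply/eqP/freeg_eqP => q; rewrite coeffZ !coeffU mulrA.
Qed.

Lemma lmul_linear b : linear (lmul b). Proof. exact: fglift_linear. Qed.
Lemma tpar_linear : linear tpar. Proof. exact: fglift_linear. Qed.
Lemma lmul_mon b u m : lmul b (mon u m) = mon (b :: u) m.
Proof. by rewrite /lmul /mon liftU scale1r. Qed.
Lemma tpar_mon u m : tpar (mon u m) = sgn (wpar u) *: mon u (par m).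
Proof. by rewrite /tpar /mon liftU scale1r. Qed.

Lemma mon_ind (P : T -> Prop) : P 0 ->
  (forall c u m x, P x -> P (c *: mon u m + x)) -> forall x, P x.
Proof.
move=> P0 PD; elim/freeg_ind_dom0 => [//|c [u m] x _ _ Px].
suff -> : << c *g ((u, m) : word) >> = c *: mon u m by exact: PD.
by apply/eqP/freeg_eqP => q; rewrite coeffZ !coeffU mul1r.
Qed.

Lemma sgn_add a b : sgn (a (+) b) = sgn a * sgn b.
Proof. by rewrite /sgn signr_addb. Qed.

Lemma tpar_lmul b x : tpar (lmul b x) = sgn (lpar b) *: lmul b (tpar x).
Proof.
elim/mon_ind: x => [|c u m x IH].
  by rewrite (lin0 (lmul_linear b)) (lin0 tpar_linear) (lin0 (lmul_linear b)) scaler0.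
rewrite (lmul_linear b) !tpar_linear IH lmul_mon !tpar_mon (lmul_linear b).
rewrite (linZ (lmul_linear b)) lmul_mon scalerDr !scalerA.
by congr (_ *: _ + _); rewrite /wpar /= oddD oddb sgn_add mulrCA mulrA.
Qed.

Lemma tparK : involutive tpar.
Proof.
elim/mon_ind => [|c u m x IH]; first by rewrite !(lin0 tpar_linear).
rewrite !tpar_linear IH tpar_mon (linZ tpar_linear) tpar_mon parK !scalerA.
by rewrite -?mulrA -sgn_add addbb ?mulr1 ?scale1r.
Qed.

Lemma ind_relZ c x : ind_rel x -> ind_rel (c *: x).
Proof.
by move=> hx; rewrite -[_ *: _]addr0; apply: ind_relD => //; apply: ind_rel0.
Qed.

Lemma ind_rel_subspace : subspace ind_rel.
Proof. by split=> [|c x y]; [exact: ind_rel0|exact: ind_relD]. Qed.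

Lemma ind_rel_par x : ind_rel x -> ind_rel (tpar x).
Proof.
have tZ := linZ tpar_linear; have tB := linB tpar_linear.
have tD := linD tpar_linear.
elim=> {x} [|c x y _ IHx _ IHy|b x _ IH|c m m'|a b u m|b m Sb].
- by rewrite (lin0 tpar_linear); apply: ind_rel0.
- by rewrite tpar_linear; apply: ind_relD.
- by rewrite tpar_lmul; apply/ind_relZ/ind_relM.
- rewrite tB tD tZ !tpar_mon /= !scale1r par_linear; exact: ind_rel_lin.
- rewrite !tB tZ !tpar_mon (lin_sum tpar_linear).
  set s := sgn (wpar [:: a, b & u]).
  have -> : wpar [:: b, a & u] = wpar [:: a, b & u].
    by rewrite /wpar /= addnCA.
  have -> : \sum_(p <- lbr a b) tpar (p.1 *: mon (p.2 :: u) m)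
          = s *: \sum_(p <- lbr a b) p.1 *: mon (p.2 :: u) (par m).
    rewrite scaler_sumr !big_seq; apply: eq_bigr => p pab.
    rewrite tZ tpar_mon !scalerA mulrC; congr (sgn _ * _ *: _).
    by rewrite /wpar /= (lbr_par pab) !oddD !oddb addbA.
  rewrite scalerA [_ * s]mulrC -scalerA -!scalerBr.
  by apply: ind_relZ; apply: ind_rel_br.
- rewrite tB !tpar_mon (rho_par _ Sb) /= scale1r.
  have -> : wpar [:: b] = lpar b by rewrite /wpar /= addn0 oddb.
  have r0 : ind_rel (mon [::] 0).
    by have := ind_rel_lin (-1) 0 0; rewrite scaler0 addr0 scaleN1r addNr subr0.
  have := ind_rel_lin (sgn (lpar b)) (rho b (par m)) 0; rewrite addr0 => rl.
  have := ind_relZ (sgn (lpar b)) (ind_rel_sub (par m) Sb).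
  set y := mon [::] 0 in r0 rl; set z := mon [::] (sgn _ *: _) in rl *.
  rewrite scalerBr; set p := sgn _ *: _; set q := sgn _ *: _ in rl * => rs.
  suff -> : p - z = (-1) *: (z - (q + y)) + ((-1) *: y + (p - q)).
    by apply/ind_relD => //; apply/ind_relD.
  rewrite !scaleN1r opprB [q + y]addrC -(addrA y) addrACA subrr add0r addrC.
  by rewrite addrA subrK.
Qed.


Fact ind_par_linear :
  linear (lquot_map tpar : lquot ind_rel_subspace -> lquot ind_rel_subspace).
Proof. exact: lquot_map_linear tpar_linear ind_rel_par. Qed.

Fact ind_parK : involutive (@lquot_map _ _ _ ind_rel_subspace tpar).
Proof.
move=> q; rewrite -[q]lreprK !(lquot_mapE _ tpar_linear ind_rel_par).
by rewrite tparK.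
Qed.

Definition ind_space : superspace := Superspace ind_par_linear ind_parK.

Definition ind_act (b : g) : ind_space -> ind_space :=
  @lquot_map _ _ _ ind_rel_subspace (lmul b).

Let actE b x : @lquot_map _ _ _ ind_rel_subspace (lmul b) (lpi _ x)
  = lpi ind_rel_subspace (lmul b x).
Proof. exact: lquot_mapE (lmul_linear b) (@ind_relM b) x. Qed.

Fact ind_act_linear b : linear (ind_act b).
Proof. exact: lquot_map_linear (lmul_linear b) (@ind_relM b). Qed.

Fact ind_act_par b w :
  par (ind_act b w) = sgn (lpar b) *: ind_act b (par w).
Proof.
rewrite /ind_act /= -[w]lreprK.
rewrite actE !(lquot_mapE _ tpar_linear ind_rel_par) actE tpar_lmul.
by rewrite (linZ (lpi_linear _)).
Qed.

Fact ind_act_br a b w :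
  ind_act a (ind_act b w) - sgn (lpar a && lpar b) *: ind_act b (ind_act a w) =
  \sum_(p <- lbr a b) p.1 *: ind_act p.2 w.
Proof.
have lp := lpi_linear ind_rel_subspace.
rewrite /ind_act /= -[w]lreprK; move: (lrepr w) => {w} x.
rewrite (actE b x) (actE a x) (actE a) (actE b) -(linZ lp) -(linB lp).
under eq_bigr do rewrite actE -(linZ lp).
rewrite -(lin_sum lp); apply/lpi_eq; move: x.
have l0 d : lmul d 0 = 0 by exact: lin0 (lmul_linear d).
elim/mon_ind => [|c u m x IH].
  rewrite !l0 scaler0 subrr big1 => [|p _]; last by rewrite l0 scaler0.
  by rewrite subrr; apply: ind_rel0.
have := ind_relD c (ind_rel_br a b u m) IH; congr ind_rel.
rewrite !lmul_linear !lmul_mon.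
under [in RHS]eq_bigr do rewrite lmul_linear lmul_mon scalerDr scalerA mulrC -scalerA.
rewrite big_split /= -scaler_sumr !scalerBr [sgn _ *: (_ + _)]scalerDr.
rewrite !opprD !scalerA [c * sgn _]mulrC !addrA.
congr (_ - _); rewrite [RHS]addrAC; congr (_ - _).
by rewrite addrAC [X in X - _]addrAC.
Qed.

Definition ind_mod : smod g := Smod ind_act_linear ind_act_par ind_act_br.

Definition ind_in (m : M) : ind_mod := lpi ind_rel_subspace (mon [::] m).
End Induced.

Lemma lact_br (g : liesuper) (W : smod g) (s t : seq (F * g)) (p q : bool) w :
  (forall x, x \in s -> lpar x.2 = p) -> (forall x, x \in t -> lpar x.2 = q) ->
  lact W s (lact W t w) - sgn (p && q) *: lact W t (lact W s w) =
  \sum_(x <- s) \sum_(y <- t) (x.1 * y.1) *: lact W (lbr x.2 y.2) w.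
Proof.
move=> sp tq.
have E s' t' : lact W s' (lact W t' w) =
    \sum_(x <- s') \sum_(y <- t') (x.1 * y.1) *: act x.2 (act y.2 w).
  rewrite {1}/lact; apply: eq_bigr => x _.
  rewrite /lact (lin_sum (act_linear _)) scaler_sumr; apply: eq_bigr => y _.
  by rewrite (linZ (act_linear _)) scalerA.
rewrite !E [X in _ - _ *: X]exchange_big /= scaler_sumr -sumrB !big_seq.
apply: eq_bigr => x xs; rewrite scaler_sumr -sumrB !big_seq.
apply: eq_bigr => y yt; rewrite /lact -act_br (sp _ xs) (tq _ yt) scalerBr !scalerA.
by rewrite [y.1 * _]mulrC [sgn _ * _]mulrC.
Qed.

Definition even_line : superspace :=
  @Superspace F^o id (fun _ _ _ => erefl) (fun _ => erefl).

Inductive gl11_basis := gN | gE | gpsip | gpsim.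

Definition gl11_code (x : gl11_basis) : bool * bool :=
  match x with
  | gN => (false, false) | gE => (false, true)
  | gpsip => (true, false) | gpsim => (true, true)
  end.
Definition gl11_decode (c : bool * bool) : gl11_basis :=
  match c with
  | (false, false) => gN | (false, true) => gE
  | (true, false) => gpsip | (true, true) => gpsim
  end.
Lemma gl11_codeK : cancel gl11_code gl11_decode. Proof. by case. Qed.
HB.instance Definition _ := Choice.copy gl11_basis (can_type gl11_codeK).

Definition gl11_par (x : gl11_basis) : bool :=
  match x with gN | gE => false | gpsip | gpsim => true end.

Definition gl11_br (x y : gl11_basis) : seq (F * gl11_basis) :=
  match x, y with
  | gN, gpsip => [:: (1, gpsip)]
  | gpsip, gN => [:: (-1, gpsip)]
  | gN, gpsim => [:: (-1, gpsim)]
  | gpsim, gN => [:: (1, gpsim)]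
  | gpsip, gpsim | gpsim, gpsip => [:: (1, gE)]
  | _, _ => [::]
  end.

Fact gl11_br_par x y p : p \in gl11_br x y ->
  gl11_par p.2 = gl11_par x (+) gl11_par y.
Proof. by case: x; case: y => //=; rewrite inE => /eqP ->. Qed.

Definition gl11 : liesuper := Liesuper gl11_br_par.

Definition kappa (x y : gl11_basis) : F :=
  match x, y with
  | gN, gE | gE, gN => 1
  | gpsip, gpsim => 1
  | gpsim, gpsip => -1
  | _, _ => 0
  end.

(* [Some (a, r)] is a_r = a (x) t^r and [None] is the central element. *)
Definition agl11_basis : choiceType := option (gl11_basis * int).

Definition agl11_par (x : agl11_basis) : bool :=
  if x is Some (a, _) then gl11_par a else false.

Definition agl11_br (x y : agl11_basis) : seq (F * agl11_basis) :=
  match x, y with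
  | Some (a, r), Some (b, s) =>
      [seq (p.1, Some (p.2, r + s)) | p <- gl11_br a b] ++
      (if (r + s == 0) && (kappa a b != 0)
       then [:: (r%:~R * kappa a b, None)] else [::])
  | _, _ => [::]
  end.

Fact agl11_br_par x y p : p \in agl11_br x y ->
  agl11_par p.2 = agl11_par x (+) agl11_par y.
Proof.
case: x => [[a r]|//]; case: y => [[b s]|//]; rewrite mem_cat => /orP[].
  by case/mapP => q /gl11_br_par + ->.
case: ifP => // /andP[_]; rewrite inE => + /eqP -> /=.
by case: a; case: b; rewrite //= eqxx.
Qed.

Definition agl11 : liesuper := Liesuper agl11_br_par.

Definition mode (a : gl11_basis) (r : int) : agl11 := Some (a, r).

(* The 1-dimensional module on which N acts by n and E, psi^+, psi^- by 0. *)
Definition gl11_char (n : F) (x : gl11) : even_line -> even_line :=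
  fun w => if x is gN then n *: w else 0.
Fact gl11_char_linear n x : linear (gl11_char n x).
Proof.
by move=> c u v; case: x; rewrite /= ?scaler0 ?addr0 // scalerDr !scalerA mulrC.
Qed.
Fact gl11_char_par n x (w : even_line) :
  par (gl11_char n x w) = sgn (gl11_par x) *: gl11_char n x (par w).
Proof. by case: x; rewrite /= ?scaler0 // scale1r. Qed.
Fact gl11_char_br n x y (w : even_line) :
  gl11_char n x (gl11_char n y w)
  - sgn (gl11_par x && gl11_par y) *: gl11_char n y (gl11_char n x w) =
  \sum_(p <- gl11_br x y) p.1 *: gl11_char n p.2 w.
Proof.
by case: x; case: y; rewrite /= ?big_cons ?big_nil /= ?scaler0 ?scale1r
  ?scaler0 ?addr0 ?subrr.
Qed.

Definition A_mod (n : F) : smod gl11 :=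
  @Smod gl11 even_line (gl11_char n) (gl11_char_linear n) (gl11_char_par n)
    (gl11_char_br n).

Definition borel (x : gl11) : bool := if x is gpsim then false else true.
Definition verma_char (n e : F) (x : gl11) : even_line -> even_line := fun v =>
  match x with gN => (n + 2%:R^-1) *: v | gE => e *: v | _ => 0 end.
Fact verma_char_par n e x (v : even_line) : borel x ->
  par (verma_char n e x v) = sgn (gl11_par x) *: verma_char n e x (par v).
Proof. by case: x => //= _; rewrite ?scale1r ?scaler0. Qed.

Definition verma (n e : F) : smod gl11 :=
  @ind_mod gl11 borel even_line (verma_char n e) (verma_char_par n e).

Definition cartan (x : gl11) : bool := ~~ gl11_par x.
Fact cartan_par n x (v : even_line) : cartan x ->
  par (gl11_char n x v) = sgn (gl11_par x) *: gl11_char n x (par v).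
Proof. by move=> _; apply: gl11_char_par. Qed.

Definition P_mod (n : F) : smod gl11 :=
  @ind_mod gl11 cartan even_line (gl11_char n) (@cartan_par n).

Section Hat.
Variables (k : F) (M : smod gl11).

Definition agl11_nonneg (x : agl11) : bool :=
  if x is Some (_, r) then 0 <= r else true.
Definition hat_char (x : agl11) (m : M) : M :=
  match x with
  | Some (a, r) => if r == 0 then @act gl11 M a m else 0
  | None => k *: m
  end.
Fact hat_char_par x (m : M) : agl11_nonneg x ->
  par (hat_char x m) = sgn (agl11_par x) *: hat_char x (par m).
Proof.
case: x => [[a r]|] /= _; last by rewrite scale1r (linZ (@par_linear M)).
by case: ifP => _; rewrite ?scaler0 ?(lin0 (@par_linear M)) // act_par.
Qed.

Definition hat : smod agl11 :=
  @ind_mod agl11 agl11_nonneg M hat_char hat_char_par.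
Definition hat_in (m : M) : hat := ind_in hat_char_par m.
End Hat.

Definition sigma (l : int) (x : agl11) : seq (F * agl11) :=
  match x with
  | Some (gN, r) => [:: (1, mode gN r)]
  | Some (gE, r) => [:: (1, mode gE r); (- l%:~R * (r == 0)%:R, None)]
  | Some (gpsip, r) => [:: (1, mode gpsip (r - l))]
  | Some (gpsim, r) => [:: (1, mode gpsim (r + l))]
  | None => [:: (1, None)]
  end.

Definition weyl (x : agl11) : seq (F * agl11) :=
  match x with
  | Some (gN, r) => [:: (-1, mode gN r)]
  | Some (gE, r) => [:: (-1, mode gE r)]
  | Some (gpsip, r) => [:: (1, mode gpsim r)]
  | Some (gpsim, r) => [:: (-1, mode gpsip r)]
  | None => [:: (1, None)]
  end.
Definition weyl_inv (x : agl11) : seq (F * agl11) :=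
  match x with
  | Some (gpsip, r) => [:: (-1, mode gpsim r)]
  | Some (gpsim, r) => [:: (1, mode gpsip r)]
  | _ => weyl x
  end.

Fact sigma_par l x p : p \in sigma l x -> agl11_par p.2 = agl11_par x.
Proof.
by case: x => [[[] r]|]; rewrite !inE; try (case/orP); move=> /eqP ->.
Qed.
Fact weyl_inv_par x p : p \in weyl_inv x -> agl11_par p.2 = agl11_par x.
Proof. by case: x => [[[] r]|]; rewrite !inE => /eqP ->. Qed.

Fact sigma_br l (W : smod agl11) a b (w : W) :
  lact W (sigma l a) (lact W (sigma l b) w)
  - sgn (agl11_par a && agl11_par b) *: lact W (sigma l b) (lact W (sigma l a) w)
  = \sum_(p <- agl11_br a b) p.1 *: lact W (sigma l p.2) w.
Proof.
rewrite (lact_br _ (@sigma_par l a) (@sigma_par l b)).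
case: a => [[[] r]|]; case: b => [[[] s]|];
  rewrite /lact ?big_cons ?big_nil /= ?big_cat ?big_cons ?big_nil /=;
  rewrite ?oner_eq0 ?oppr_eq0 ?oner_eq0 ?eqxx ?andbF ?andbT
    ?big_cons ?big_nil ?scaler0 ?addr0 //=.
- by case: eqP => _; rewrite ?big_nil ?scaler0 // ?big_cons ?big_nil /=
    ?big_cons ?big_nil /= ?addr0 ?mul1r ?scale1r //.
- by rewrite addrA mul1r.
- by rewrite addrA mul1r !scale1r.
- by case: eqP => _; rewrite ?big_nil ?scaler0 // ?big_cons ?big_nil /=
    ?big_cons ?big_nil /= ?addr0 ?mul1r ?scale1r //.
- by rewrite addrAC mul1r !scale1r.
- rewrite (_ : r - l + (s + l) = r + s); last by ring.
  case: eqP => _; rewrite ?big_cons ?big_nil /= ?big_cons ?big_nil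
    ?mulr0 ?scale0r ?addr0 /= ?mul1r !scale1r //.
  rewrite ?mul1r ?scale1r ?mulr1 -?addrA -?scalerDl rmorphB /=.
  by rewrite [- _ + _]addrC.
- by rewrite addrAC mul1r !scale1r.
- rewrite (_ : r + l + (s - l) = r + s); last by ring.
  case: eqP => _; rewrite ?big_cons ?big_nil /= ?big_cons ?big_nil
    ?mulr0 ?scale0r ?addr0 /= ?mul1r !scale1r //.
  rewrite ?mul1r ?scale1r ?mulr1 ?mulrN1 -?addrA -?scalerDl rmorphD /= opprD.
  by rewrite [- _ - _]addrC.
Qed.
Fact weyl_inv_br (W : smod agl11) a b (w : W) :
  lact W (weyl_inv a) (lact W (weyl_inv b) w)
  - sgn (agl11_par a && agl11_par b) *: lact W (weyl_inv b) (lact W (weyl_inv a) w)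
  = \sum_(p <- agl11_br a b) p.1 *: lact W (weyl_inv p.2) w.
Proof.
rewrite (lact_br _ (@weyl_inv_par a) (@weyl_inv_par b)).
case: a => [[[] r]|]; case: b => [[[] s]|];
  rewrite /lact ?big_cons ?big_nil /= ?big_cat ?big_cons ?big_nil /=;
  rewrite ?oner_eq0 ?oppr_eq0 ?oner_eq0 ?eqxx ?andbF ?andbT
    ?big_cons ?big_nil ?scaler0 ?addr0 //=.
all: rewrite ?mulN1r ?opprK ?mul1r ?mulr1 ?scalerA ?mulN1r ?mulr1 ?opprK //.
all: case: eqP => _; rewrite ?big_cons ?big_nil /= ?big_cons ?big_nil /=.
all: by rewrite ?addr0 ?scaler0 ?scalerDr ?scalerA
  ?(mulN1r, mulrN1, mul1r, mulr1, opprK, scale1r).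
Qed.

(* tau(W) is W with a acting as tau^{-1}(a); sigma^l is inverted by
   sigma^{-l}, and w by [weyl_inv]. *)
Definition spectral_flow (l : int) (W : smod agl11) : smod agl11 :=
  twist (@sigma_par (- l)) (@sigma_br (- l) W).
Definition weyl_twist (W : smod agl11) : smod agl11 :=
  twist weyl_inv_par (@weyl_inv_br W).

Lemma spectral_flowE l (W : smod agl11) a (w : W) :
  lact (spectral_flow l W) (sigma l a) w = act a w.
Proof.
case: a => [[[] r]|]; rewrite /lact /= ?big_cons ?big_nil /= /lact /=
  ?big_cons ?big_nil /= ?addr0 ?scale1r ?opprK ?addrK ?subrK //.
by rewrite mulrNz opprK -addrA -scalerDl -mulrDl subrr mul0r scale0r addr0.
Qed.

Lemma weyl_twistE (W : smod agl11) a (w : W) :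
  lact (weyl_twist W) (weyl a) w = act a w.
Proof.
by case: a => [[[] r]|]; rewrite /lact /= ?big_cons ?big_nil /= /lact /=
  ?big_cons ?big_nil /= ?addr0 ?scalerA ?mulN1r ?opprK ?mul1r ?scale1r.
Qed.

(* The label m is the subscript of P_{m, lk}: m = n - l - 1/2 for l < 0 and
   m = - n - l + 1/2 for l > 0, where P_n is the module being twisted. *)
Definition P_hat (k m : F) (l : int) : smod agl11 :=
  if l == 0 then hat k (P_mod m)
  else if l < 0 then spectral_flow l (hat k (P_mod (m + l%:~R + 2%:R^-1)))
  else spectral_flow l (weyl_twist (hat k (P_mod (- m - l%:~R + 2%:R^-1)))).

(* For l <> 0, A is an irreducible quotient of the level-k module induced from
   V_{m, lk}; such a quotient is unique up to isomorphism. *)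
Inductive is_A_hat (k m : F) : int -> smod agl11 -> Prop :=
| A_hat_0 : is_A_hat k m 0 (hat k (A_mod m))
| A_hat_neq0 (l : int) (A : smod agl11) (q : hat k (verma m (l%:~R * k)) -> A) :
    l != 0 -> smod_irreducible A -> smod_hom q -> surj q -> is_A_hat k m l A.

Definition epsilon (l : int) : F :=
  if l == 0 then 0 else if 0 < l then 2%:R^-1 else - 2%:R^-1.

Definition binz (m : int) (j : nat) : F :=
  (\prod_(i < j) (m%:~R - i%:R)) / j`!%:R.

(* [Y v n] is the mode v_(n), the coefficient of z^(-n-1) in Y(v, z). The last
   field is the Jacobi identity, written in coefficients (Borcherds identity):
   by truncation all terms vanish for large j, so that the partial sums
   are eventually equal to the full sums. *)
Record field_axioms (V W : superspace) (vac : V) (YV : V -> int -> V -> V)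
    (Y : V -> int -> W -> W) : Prop := FieldAxioms {
  Y_linear_l : forall n w, linear (fun v => Y v n w);
  Y_linear_r : forall v n, linear (Y v n);
  Y_par : forall v n w, par (Y v n w) = Y (par v) n (par w);
  Y_trunc : forall v w, exists N : int, forall n, N <= n -> Y v n w = 0;
  Y_vac : forall n w, Y vac n w = if n == -1 then w else 0;
  Y_jacobi : forall (p q : bool) (u v : V) (w : W) (l m n : int),
    homog p u -> homog q v ->
    exists N0 : nat, forall N : nat, (N0 <= N)%N ->
      \sum_(j < N) binz m j *: Y (YV u (l + j%:Z) v) (m + n - j%:Z) w =
      \sum_(j < N) ((-1) ^+ j * binz l j) *:
        (Y u (m + l - j%:Z) (Y v (n + j%:Z) w)
         - ((-1) ^ l * sgn (p && q)) *:
             Y v (n + l - j%:Z) (Y u (m + j%:Z) w)) }.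

Record vsa_axioms (V : superspace) (vac : V) (Y : V -> int -> V -> V) : Prop :=
  VsaAxioms {
  vsa_field : field_axioms vac Y Y;
  vsa_vac_even : homog false vac;
  vsa_creation : forall v, Y v (-1) vac = v /\ forall n : nat, Y v n%:Z vac = 0 }.

(* A vertex superalgebra with a distinguished vector, whose modes are
   L_n = om_(n+1). *)
Record vsalg := Vsalg {
  va_space :> superspace;
  va_vac : va_space;
  va_om : va_space;
  va_Y : va_space -> int -> va_space -> va_space;
  va_axioms : vsa_axioms va_vac va_Y }.

Section VertexModules.
Variable V : vsalg.

(* The second clause is the L_{-1}-derivative property. *)
Definition vmod_axioms (W : superspace) (Y : V -> int -> W -> W) : Prop :=
  field_axioms (va_vac V) (@va_Y V) Y /\
  forall v n w, Y (va_Y (va_om V) 0 v) n w = - n%:~R *: Y v (n - 1) w.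

Record vmod := Vmod {
  vm_space :> superspace;
  vm_Y : V -> int -> vm_space -> vm_space;
  vm_axioms : vmod_axioms vm_Y }.

Definition vhom (b : bool) (W X : vmod) (f : W -> X) : Prop :=
  [/\ linear f, forall w, par (f w) = sgn b *: f (par w) &
      forall p v n w, homog p v -> f (vm_Y v n w) = sgn (b && p) *: vm_Y v n (f w)].

(* Morphisms are even or odd; the superspace Hom(W, X) is spanned by them. *)
Definition morphism (W X : vmod) (f : W -> X) : Prop := exists b, vhom b f.

Definition vsub (W : vmod) (S : W -> Prop) : Prop :=
  [/\ subspace S, forall w, S w -> S (par w) &
      forall v n w, S w -> S (vm_Y v n w)].

(* [S] is a composition series: S i.+1 / S i is irreducible for i < d. *)
Definition finite_length (W : vmod) : Prop :=
  exists (d : nat) (S : nat -> W -> Prop),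
  [/\ forall w, S 0%N w <-> w = 0, forall w, S d w,
      forall i, (i <= d)%N -> vsub (S i) &
      forall i, (i < d)%N ->
        [/\ forall w, S i w -> S i.+1 w, exists w, S i.+1 w /\ ~ S i w &
            forall T : W -> Prop, vsub T ->
              (forall w, S i w -> T w) -> (forall w, T w -> S i.+1 w) ->
              (forall w, T w -> S i w) \/ (forall w, S i.+1 w -> T w)]].

Definition L0 (W : vmod) : W -> W := vm_Y (va_om V) 1.

Definition gen_L0 (W : vmod) (h : F) (w : W) : Prop :=
  exists p : nat, iter p (fun x : W => L0 x - h *: x) w = 0.

(* Generalized eigenspaces for distinct eigenvalues are independent, so that
   the first clause says that W is their direct sum. *)
Definition grading_restricted (W : vmod) : Prop :=
  [/\ forall w : W, exists (d : nat) (h : 'I_d -> F) (x : 'I_d -> W),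
        w = \sum_i x i /\ forall i, gen_L0 (h i) (x i),
      forall h, exists (d : nat) (b : 'I_d -> W), forall w : W, gen_L0 h w ->
        exists c : 'I_d -> F, w = \sum_i c i *: b i &
      forall h, exists N : nat, forall n : nat, (N <= n)%N ->
        forall w : W, gen_L0 (h - n%:R) w -> w = 0].

Definition semisimple (W : superspace) (f : W -> W) : Prop :=
  forall w, exists (d : nat) (c : 'I_d -> F) (x : 'I_d -> W),
    w = \sum_i x i /\ forall i, f (x i) = c i *: x i.

Section Projective.
Variable O : vmod -> Prop.

Definition projective (P : vmod) : Prop :=
  O P /\ forall (X Z : vmod) (p : X -> Z) (f : P -> Z), O X -> O Z ->
    morphism p -> surj p -> morphism f ->
    exists g : P -> X, morphism g /\ forall w, p (g w) = f w.

Definition projective_cover (P S : vmod) : Prop :=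
  [/\ O S, projective P & exists pi : P -> S,
    [/\ morphism pi, surj pi &
      forall (Q : vmod) (q : Q -> S), projective Q -> morphism q -> surj q ->
        exists qt : Q -> P,
          [/\ morphism qt, surj qt & forall w, q w = pi (qt w)]]].
End Projective.
End VertexModules.

Section AffineVertex.
Variable k : F.

Definition Vk : smod agl11 := hat k (A_mod 0).
Definition vacuum : Vk := @hat_in k (A_mod 0) (1 : F).

Definition gen (a : gl11_basis) : Vk := act (mode a (-1)) vacuum.

Definition omega : Vk :=
  (2%:R * k)^-1 *:
    (act (mode gN (-1)) (gen gE) + act (mode gE (-1)) (gen gN)
     - act (mode gpsip (-1)) (gen gpsim) + act (mode gpsim (-1)) (gen gpsip))
  + (2%:R * k ^+ 2)^-1 *: act (mode gE (-1)) (gen gE).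

(* Y is the vertex superalgebra structure on V_k(gl(1|1)) in which
   Y(a_{-1} vacuum, z) = sum_n a_n z^(-n-1); it is unique. *)
Definition affine_vsa (Y : Vk -> int -> Vk -> Vk) : Prop :=
  vsa_axioms vacuum Y /\ forall a n v, Y (gen a) n v = act (mode a n) v.

Variables (Y : Vk -> int -> Vk -> Vk) (hY : affine_vsa Y).

Definition Vk_vsalg : vsalg := Vsalg omega (proj1 hY).

Definition Ofin (W : vmod Vk_vsalg) : Prop :=
  [/\ finite_length W, grading_restricted W,
      semisimple (@vm_Y _ W (gen gN) 0) & semisimple (@vm_Y _ W (gen gE) 0)].

(* YW is the V_k(gl(1|1))-module structure on W for which
   Y_W(a_{-1} vacuum, z) = sum_n a_n z^(-n-1) with the given action of the a_n. *)
Definition vertex_structure (W : smod agl11) (YW : Vk -> int -> W -> W) : Prop :=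
  @vmod_axioms Vk_vsalg W YW /\ forall a n w, YW (gen a) n w = act (mode a n) w.

Definition to_vmod (W : smod agl11) YW (hW : @vertex_structure W YW) :
  vmod Vk_vsalg := @Vmod Vk_vsalg W YW (proj1 hW).
End AffineVertex.
End Super.

Arguments Ofin {F k Y} hY W.
Arguments epsilon {F} l.

(* Main.v *)
(* Call a vector x of a level-k module of type (n, l) when N_0 x = n x,
   E_0 x = l k x and x is killed by N_r, E_r (r > 0), psi^-_r (r > l) and
   psi^+_r (r > -l), the positive modes of the spectral flow sigma^l. The module
   P is generated by an even vector v of type (n, l) and is universal with this
   property, since the twists by sigma^l and w preserve universality.

   A smooth module of level k is a V_k-module: the universal property of V_k
   extends the currents to all of V_k, with normally ordered products given by
   the Borcherds identity; Dong's lemma and skew symmetry give the Jacobi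
   identity.

   The operator D = L_0 - l N_0 grades modules by the degree twisted by sigma^l.
   By the Sugawara formula D x = k^-1 psi^-_l psi^+_(-l) x for x of type (n, l),
   so that D is nilpotent there. Hence, when the L_0-weights are bounded below,
   the generalized D-weights of vectors with E_0 = l k are natural numbers. This
   makes P projective: a preimage of the image of v, projected to the right
   eigenvalues of N_0, E_0, L_0 and to the right parity, has D-weight 0, so it is
   killed by the modes of positive twisted degree and has type (n, l). It also
   gives finite length: the submodules generated by the first vectors of
   psi^-_l psi^+_(-l) v, psi^+_(-l) v, psi^-_l v, v have simple or zero quotients.

   A contains a nonzero generator a of type (n, l), so P maps onto A. If a
   projective Q maps onto A, the image of Q -> P contains a vector of type (n, l)
   over a; it has D-weight 0, hence lies in the span of the four vectors above,
   with coefficient 1 at v, and so the image contains v. *)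
From HB Require Import structures.
From mathcomp Require Import all_boot all_order all_algebra.
From mathcomp Require Import complex boolp classical_sets functions reals.
From mathcomp Require Import freeg ring zify.
Require Import Defs.

Set Implicit Arguments.
Unset Strict Implicit.
Unset Printing Implicit Defensive.

Import Order.TTheory GRing.Theory Num.Theory.
Local Open Scope ring_scope.

(** * Linear algebra and binomial coefficients *)

(** No basis of an induced module is used: [P] enters only through its generator and its universal
    property, and independence of the four vectors made from [v] by the zero modes is never at
    issue. Nonvanishing of an induced module matters once, for [A] with [l = 0]; there a functional
    on words that respects the relations takes the place of a PBW theorem.

    The field map from [Vk] is built by applying currents from the left, so at first it respects
    products only when the left factor is a generator. For a general left factor [u] the Jacobi
    identity is proved by induction on the right factor; the input is the commutator of the field of
    [u] with a current, and this is what skew symmetry in [Vk] provides.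

    The category bounds [L_0], not [D], and for [l <> 0] a mode may be positive for one degree and
    not for the other. Modes positive for both are exhausted first, since each lowers the
    [L_0]-weight; after that only finitely many odd modes of positive [D]-degree can act
    nontrivially, and the nilpotency of [D] on vectors of type [(n, l)] fixes the weight. *)

Section LinearCombinations.
Variables (F : comPzRingType) (V : lmodType F).

(** Syntax of linear combinations over a list of atoms, for proof by reflection: [mcoef] reads off
    the coefficient of an atom, and [mgoal] is the resulting list of scalar equations. *)
Inductive mexp := MZ | MV of nat | MA of mexp & mexp | MO of mexp | MS of F & mexp.

Fixpoint mden (env : seq V) e : V :=
  match e with
  | MZ => 0 | MV i => nth 0 env i | MA a b => mden env a + mden env b
  | MO a => - mden env a | MS c a => c *: mden env a
  end.

Fixpoint mcoef e (i : nat) : F :=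
  match e with
  | MZ => 0 | MV j => if Nat.eqb j i then 1 else 0 | MA a b => mcoef a i + mcoef b i
  | MO a => - mcoef a i | MS c a => c * mcoef a i
  end.

Fixpoint mgoal n e1 e2 : Prop :=
  if n is m.+1 then mcoef e1 m = mcoef e2 m /\ mgoal m e1 e2 else True.

Lemma mdenE env e : mden env e = \sum_(i < size env) mcoef e i *: nth 0 env i.
Proof.
elim: e => [|j|a IHa b IHb|a IHa|c a IHa] /=.
- by rewrite big1 // => i _; rewrite scale0r.
- have [lt_j|ge_j] := ltnP j (size env); last first.
    rewrite nth_default // big1 // => i _; rewrite -[Nat.eqb _ _]/(j == i).
    by rewrite gtn_eqF ?scale0r // (leq_trans (ltn_ord i)).
  rewrite (bigD1 (Ordinal lt_j)) //= big1 => [|i ij].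
    by rewrite -[Nat.eqb _ _]/(j == j) eqxx scale1r addr0.
  by rewrite -[Nat.eqb _ _]/(j == i) eq_sym ifN ?scale0r.
- by rewrite IHa IHb -big_split; apply: eq_bigr => i _; rewrite scalerDl.
- by rewrite IHa -sumrN; apply: eq_bigr => i _; rewrite scaleNr.
- by rewrite IHa scaler_sumr; apply: eq_bigr => i _; rewrite scalerA.
Qed.

Lemma mexpP env e1 e2 : mgoal (size env) e1 e2 -> mden env e1 = mden env e2.
Proof.
move=> h; rewrite !mdenE; apply: eq_bigr => -[i lt_i] _ /=; congr (_ *: _).
elim: (size env) h lt_i => // n IH /= [e12 /IH{}IH].
by rewrite ltnS leq_eqVlt => /orP[/eqP ->|].
Qed.
End LinearCombinations.

Ltac madd_atom x env :=
  let rec mem l := lazymatch l with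
    | nil => constr:(false)
    | cons ?y ?t => match x with y => constr:(true) | _ => mem t end end in
  lazymatch mem env with true => env | false => constr:(cons x env) end.

Ltac matoms t env :=
  lazymatch t with
  | (?a + ?b)%R => let env := matoms a env in matoms b env
  | (- ?a)%R => matoms a env
  | (_ *: ?a)%R => matoms a env
  | 0%R => env
  | _ => madd_atom t env
  end.

Ltac mindex x env :=
  lazymatch env with
  | cons ?y ?t => match x with y => constr:(O) | _ => let n := mindex x t in constr:(S n) end
  end.

Ltac mreify R t env :=
  lazymatch t with
  | (?a + ?b)%R => let a := mreify R a env in let b := mreify R b env in constr:(@MA R a b)
  | (- ?a)%R => let a := mreify R a env in constr:(@MO R a)
  | (?c *: ?a)%R => let a := mreify R a env in constr:(@MS R c a)
  | 0%R => constr:(@MZ R)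
  | _ => let n := mindex t env in constr:(@MV R n)
  end.

(* [lmod R] reduces an equation in a module over R to the equations between
   the coefficients of its atoms. *)
Ltac lmod_core R :=
  lazymatch goal with
  | |- @eq ?T ?x ?y =>
    let env := matoms x (@nil T) in let env := matoms y env in
    let e1 := mreify R x env in let e2 := mreify R y env in
    apply: (@mexpP R _ env e1 e2);
    cbn [mgoal mcoef size Nat.eqb]; do ?split
  end.
Tactic Notation "lmod" constr(R) := lmod_core R; try ring.

(** * Sums of eventually zero families *)

Section FiniteSums.
Variables (F : pzRingType) (V : lmodType F).
Implicit Types f g : nat -> V.

Definition efin f : Prop := exists N, forall j, (N <= j)%N -> f j = 0.

(* Junk value 0 for a family that does not vanish eventually. *)
Definition fs f : V :=
  if pselect (efin f) is left h then \sum_(j < projT1 (cid h)) f j else 0.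

Lemma sum_trunc f N M : (forall j, (N <= j)%N -> f j = 0) -> (N <= M)%N ->
  \sum_(j < M) f j = \sum_(j < N) f j.
Proof.
move=> fN NM; rewrite -(subnKC NM) big_split_ord /= [X in _ + X]big1 ?addr0 // => i _.
by apply: fN; rewrite leq_addr.
Qed.

Lemma fsE N f : (forall j, (N <= j)%N -> f j = 0) -> fs f = \sum_(j < N) f j.
Proof.
move=> fN; rewrite /fs; case: pselect => [h|[]]; last by exists N.
case: (cid h) => M fM /=.
by have [NM|/ltnW NM] := leqP N M; rewrite ?(sum_trunc fN NM) ?(sum_trunc fM NM).
Qed.

Lemma fs0 : fs (fun=> 0) = 0.
Proof. by rewrite (@fsE 0%N) ?big_ord0. Qed.

Lemma fs_eq f g : f =1 g -> fs f = fs g.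
Proof. by move=> /funext ->. Qed.

Lemma fs_eq0 f : (forall j, f j = 0) -> fs f = 0.
Proof. by move=> f0; rewrite (fs_eq f0) fs0. Qed.

Lemma efin0 : efin (fun=> 0). Proof. by exists 0%N. Qed.

Lemma efinD f g : efin f -> efin g -> efin (fun j => f j + g j).
Proof.
move=> [N fN] [M gM]; exists (maxn N M) => j; rewrite geq_max => /andP[Nj Mj].
by rewrite fN // gM // addr0.
Qed.

Lemma efinZ (c : nat -> F) f : efin f -> efin (fun j => c j *: f j).
Proof. by move=> [N fN]; exists N => j Nj; rewrite fN // scaler0. Qed.

Lemma efinZc (c : F) f : efin f -> efin (fun j => c *: f j).
Proof. exact: (efinZ (fun=> c)). Qed.

Lemma efinN f : efin f -> efin (fun j => - f j).
Proof. by move=> [N fN]; exists N => j Nj; rewrite fN // oppr0. Qed.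

Lemma efinB f g : efin f -> efin g -> efin (fun j => f j - g j).
Proof. by move=> hf /efinN; apply: efinD. Qed.

Lemma efinS f : efin f -> efin (fun j => f j.+1).
Proof. by move=> [N fN]; exists N => j Nj; apply: fN; rewrite leqW. Qed.

Lemma fsD f g : efin f -> efin g -> fs (fun j => f j + g j) = fs f + fs g.
Proof.
move=> [N fN] [M gM].
rewrite !(@fsE (maxn N M)) ?big_split // => j; rewrite geq_max => /andP[Nj Mj].
- by rewrite gM.
- by rewrite fN.
- by rewrite fN // gM // addr0.
Qed.

Lemma fsZ (c : F) f : efin f -> fs (fun j => c *: f j) = c *: fs f.
Proof.
move=> [N fN]; rewrite !(@fsE N) // ?scaler_sumr // => j Nj.
by rewrite fN // scaler0.
Qed.

Lemma fsN f : efin f -> fs (fun j => - f j) = - fs f.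
Proof. by move=> hf; rewrite -scaleN1r -fsZ //; apply: fs_eq => j; rewrite scaleN1r. Qed.

Lemma fsB f g : efin f -> efin g -> fs (fun j => f j - g j) = fs f - fs g.
Proof. by move=> hf hg; rewrite fsD ?fsN //; apply: efinN. Qed.

Lemma fsS f : efin f -> fs f = f 0%N + fs (fun j => f j.+1).
Proof.
move=> [N fN]; rewrite (@fsE N.+1) => [|j Nj]; last by rewrite fN // ltnW.
rewrite (@fsE N) => [|j Nj]; first by rewrite big_ord_recl.
by rewrite fN // ltnW.
Qed.

Lemma fs1 i f : (forall j, j != i -> f j = 0) -> fs f = f i.
Proof.
move=> f0; rewrite (@fsE i.+1) => [|j ij].
  by rewrite big_ord_recr /= big1 ?add0r // => j _; rewrite f0 // ltn_eqF.
by rewrite f0 // gtn_eqF.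
Qed.

Lemma fs_shift i f : (forall j, (j < i)%N -> f j = 0) -> efin f ->
  fs f = fs (fun j => f (i + j)%N).
Proof.
elim: i f => [|i IH] f f0 hf; first by apply: fs_eq.
rewrite fsS // f0 // add0r IH; first by apply: fs_eq.
  by move=> j ji; rewrite f0.
exact: efinS.
Qed.

Lemma efin_sum n (f : nat -> nat -> V) : (forall s, efin (f s)) ->
  efin (fun j => \sum_(s < n) f s j).
Proof.
move=> hf; elim: n => [|n IH].
  by exists 0%N => j _; rewrite big_ord0.
have [N fN] := efinD IH (hf n).
by exists N => j Nj; rewrite big_ord_recr /= fN.
Qed.

Lemma fs_sum n (f : nat -> nat -> V) : (forall s, efin (f s)) ->
  fs (fun j => \sum_(s < n) f s j) = \sum_(s < n) fs (f s).
Proof.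
move=> hf; elim: n => [|n IH].
  by rewrite big_ord0; apply: fs_eq0 => j; rewrite big_ord0.
rewrite big_ord_recr /= -IH -fsD //; last exact: efin_sum.
by apply: fs_eq => j; rewrite big_ord_recr.
Qed.

(** Vanishing for large [i + j] makes the whole family finite, so that double sums may be exchanged
    or taken along diagonals. *)
Definition efin2 (f : nat -> nat -> V) : Prop :=
  exists N, forall i j, (N <= i + j)%N -> f i j = 0.

Lemma efin2_row (f : nat -> nat -> V) i : efin2 f -> efin (f i).
Proof. by move=> [N fN]; exists N => j Nj; apply: fN; rewrite (leq_trans Nj) ?leq_addl. Qed.

Lemma efin2_fs (f : nat -> nat -> V) : efin2 f -> efin (fun i => fs (f i)).
Proof.
move=> [N fN]; exists N => i Ni; apply: fs_eq0 => j.
by apply: fN; rewrite (leq_trans Ni) ?leq_addr.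
Qed.

Lemma efin2C (f : nat -> nat -> V) : efin2 f -> efin2 (fun i j => f j i).
Proof. by move=> [N fN]; exists N => i j; rewrite addnC; apply: fN. Qed.

Lemma efin2D (f g : nat -> nat -> V) : efin2 f -> efin2 g -> efin2 (fun i j => f i j + g i j).
Proof.
move=> [N fN] [M gM]; exists (maxn N M) => i j; rewrite geq_max => /andP[Nj Mj].
by rewrite fN // gM // addr0.
Qed.

Lemma efin2N (f : nat -> nat -> V) : efin2 f -> efin2 (fun i j => - f i j).
Proof. by move=> [N fN]; exists N => i j Nij; rewrite fN // oppr0. Qed.

Lemma efin2Z (c : nat -> nat -> F) (f : nat -> nat -> V) : efin2 f -> efin2 (fun i j => c i j *: f i j).
Proof. by move=> [N fN]; exists N => i j Nij; rewrite fN // scaler0. Qed.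

Lemma efin2Zc (c : F) (f : nat -> nat -> V) : efin2 f -> efin2 (fun i j => c *: f i j).
Proof. exact: (efin2Z (fun _ _ => c)). Qed.

Lemma efin2B (f g : nat -> nat -> V) : efin2 f -> efin2 g -> efin2 (fun i j => f i j - g i j).
Proof. by move=> hf /efin2N; apply: efin2D. Qed.

Lemma fs2_eq (f g : nat -> nat -> V) : (forall i j, f i j = g i j) ->
  fs (fun i => fs (f i)) = fs (fun i => fs (g i)).
Proof. by move=> fg; apply: fs_eq => i; apply: fs_eq => j. Qed.

Lemma fs2D (f g : nat -> nat -> V) : efin2 f -> efin2 g ->
  fs (fun i => fs (fun j => f i j + g i j)) = fs (fun i => fs (f i)) + fs (fun i => fs (g i)).
Proof.
move=> hf hg; rewrite -fsD; [|exact: efin2_fs..].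
by apply: fs_eq => i; rewrite fsD //; apply: efin2_row.
Qed.

Lemma fs2N (f : nat -> nat -> V) : efin2 f -> fs (fun i => fs (fun j => - f i j)) = - fs (fun i => fs (f i)).
Proof.
move=> hf; rewrite -fsN; last exact: efin2_fs.
by apply: fs_eq => i; rewrite fsN //; apply: efin2_row.
Qed.

Lemma fs2B (f g : nat -> nat -> V) : efin2 f -> efin2 g ->
  fs (fun i => fs (fun j => f i j - g i j)) = fs (fun i => fs (f i)) - fs (fun i => fs (g i)).
Proof. by move=> hf hg; rewrite fs2D ?fs2N //; apply: efin2N. Qed.

Lemma fs2Z c (f : nat -> nat -> V) : efin2 f -> fs (fun i => fs (fun j => c *: f i j)) = c *: fs (fun i => fs (f i)).
Proof.
move=> hf; rewrite -fsZ; last exact: efin2_fs.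
by apply: fs_eq => i; rewrite fsZ //; apply: efin2_row.
Qed.

Lemma fs2_square N (f : nat -> nat -> V) : (forall i j, (N <= i + j)%N -> f i j = 0) ->
  fs (fun i => fs (f i)) = \sum_(i < N) \sum_(j < N) f i j.
Proof.
move=> fN; rewrite (@fsE N) => [|i Ni]; last first.
  by apply: fs_eq0 => j; apply: fN; rewrite (leq_trans Ni) ?leq_addr.
apply: eq_bigr => i _; apply: fsE => j Nj.
by apply: fN; rewrite (leq_trans Nj) ?leq_addl.
Qed.

Lemma fs2_exchange (f : nat -> nat -> V) : efin2 f ->
  fs (fun i => fs (f i)) = fs (fun j => fs (fun i => f i j)).
Proof.
move=> [N fN]; rewrite (fs2_square fN) (@fs2_square N (fun j i => f i j)).
  by rewrite exchange_big.
by move=> i j; rewrite addnC; apply: fN.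
Qed.

Lemma fs2_diag (f : nat -> nat -> V) : efin2 f ->
  fs (fun i => fs (f i)) = fs (fun t => \sum_(i < t.+1) f i (t - i)%N).
Proof.
move=> [N fN]; rewrite (fs2_square fN) (@fsE N) => [|t Nt]; last first.
  by apply: big1 => i _; apply: fN; rewrite subnKC // -ltnS.
have E (t : 'I_N) : \sum_(i < t.+1) f i (t - i)%N =
    \sum_(i < N) if (i <= t)%N then f i (t - i)%N else 0.
  by rewrite -big_mkcond (big_ord_widen N (fun i => f i (t - i)%N)) ?ltn_ord.
rewrite (eq_bigr _ (fun t _ => E t)) [RHS]exchange_big; apply: eq_bigr => i _ /=.
rewrite -(big_mkord xpredT (f i)) -(big_mkord xpredT
  (fun t => if (i <= t)%N then f i (t - i)%N else 0)).
rewrite (@big_cat_nat _ _ _ (N - i) 0%N N) ?leq_subr //=.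
rewrite [X in _ + X]big_nat_cond [X in _ + X]big1 ?addr0 => [|j /andP[/andP[? ?] _]].
  rewrite [RHS](@big_cat_nat _ _ _ i) //=; last by rewrite ltnW.
  rewrite [X in _ = X + _]big_nat_cond [X in _ = X + _]big1 ?add0r.
    rewrite -{3}[nat_of_ord i]add0n big_addn; apply: eq_bigr => j _.
    by rewrite leq_addl addnK.
  by move=> j /andP[/andP[_ ji] _]; rewrite leqNgt ji.
by apply: fN; rewrite -leq_subLR.
Qed.
End FiniteSums.

Lemma fs_lin (F : pzRingType) (V W : lmodType F) (h : V -> W) (f : nat -> V) : linear h -> efin f ->
  h (fs f) = fs (fun j => h (f j)).
Proof.
move=> lh [N fN]; have h0 := lin0 lh.
rewrite (fsE fN) (@fsE _ _ N); last by move=> j Nj; rewrite fN.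
by rewrite (lin_sum lh).
Qed.

(** * Binomial coefficients with integer upper index *)

Section Binomials.
Variable F : fieldType.
Hypothesis F0 : forall n, (n%:R == 0 :> F) = (n == 0)%N.
Local Notation binz := (@binz F).

Lemma fact_neq0 n : n`!%:R != 0 :> F.
Proof. by rewrite F0 -lt0n fact_gt0. Qed.

(** The falling factorial. Identities between the [binz] are checked on it after multiplication by
    factorials. *)
Definition ffz (m : int) (j : nat) : F := \prod_(i < j) (m%:~R - i%:R).

Lemma binzE m j : binz m j * j`!%:R = ffz m j.
Proof. by rewrite /Defs.binz divfK ?fact_neq0. Qed.

Lemma ffzD m i j : ffz m (i + j) = ffz m i * ffz (m - i%:Z) j.
Proof.
rewrite /ffz big_split_ord /=; congr (_ * _); apply: eq_bigr => s _ /=.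
by rewrite intrB natrD opprD addrA.
Qed.

Lemma ffz_nat (i s : nat) : ffz i%:Z s = (i ^_ s)%:R.
Proof.
elim: s i => [|s IH] i; first by rewrite /ffz big_ord0.
rewrite -add1n ffzD; case: i => [|i].
  by rewrite /ffz big_ord_recl /= subrr !mul0r ffactnS mul0n.
rewrite ffactnS natrM /= -IH; congr (_ * _).
  by rewrite /ffz big_ord1 subr0.
by congr (ffz _ _); lia.
Qed.

Lemma binz0 m : binz m 0 = 1.
Proof. by rewrite /Defs.binz big_ord0 divr1. Qed.

Lemma binz_nat (i s : nat) : binz i%:Z s = 'C(i, s)%:R.
Proof.
by apply: (mulIf (fact_neq0 s)); rewrite binzE ffz_nat -natrM bin_ffact.
Qed.

Lemma binz_small (i s : nat) : (i < s)%N -> binz i%:Z s = 0.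
Proof. by move=> lt_is; rewrite binz_nat bin_small. Qed.

Lemma binz0S j : binz 0 j.+1 = 0.
Proof. exact: (@binz_small 0 j.+1). Qed.

Lemma ffzSl m j : ffz (m + 1) j.+1 = (m%:~R + 1) * ffz m j.
Proof. by rewrite -add1n ffzD addrK /ffz big_ord1 subr0 intrD. Qed.

Lemma ffzSr m j : ffz m j.+1 = ffz m j * (m%:~R - j%:R).
Proof. by rewrite /ffz big_ord_recr. Qed.

Lemma binzS m j : binz (m + 1) j.+1 = binz m j.+1 + binz m j.
Proof.
apply: (mulIf (fact_neq0 j.+1)); rewrite mulrDl !binzE ffzSl ffzSr.
by rewrite factS natrM mulrCA binzE -natr1; ring.
Qed.

Lemma binz_sub m j : binz m j.+1 = binz (m + 1) j.+1 - binz m j.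
Proof. by rewrite binzS addrK. Qed.

Lemma binz_trans m i s : binz m i * binz (m - i%:Z) s = binz m s * binz (m - s%:Z) i.
Proof.
apply: (mulIf (fact_neq0 i)); apply: (mulIf (fact_neq0 s)).
transitivity (ffz m (i + s)); first by rewrite ffzD -!binzE; ring.
by rewrite addnC ffzD -!binzE; ring.
Qed.

Lemma binz_nat_trans m s t :
  binz m (s + t) * binz (s + t)%N%:Z s = binz m s * binz (m - s%:Z) t.
Proof.
have := ffzD m s t; rewrite -!binzE => E; apply: (mulIf (fact_neq0 s)).
apply: (mulIf (fact_neq0 t)); rewrite -[RHS](_ : binz m s * s`!%:R * (binz (m - s%:Z) t * t`!%:R) = _); last by ring.
rewrite -E binz_nat; move: (binz m (s + t)) => b.
rewrite -!mulrA -!natrM; congr (_ * _%:R).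
by have := bin_fact (leq_addr t s); rewrite addKn.
Qed.

(** Pascal's rule in [l], in both directions. For negative [l] the rule is solved for the lower
    value, which needs an inner induction on [t]. *)
Lemma Vandermonde_binz l m t :
  \sum_(i < t.+1) binz l i * binz m (t - i)%N = binz (l + m) t.
Proof.
have S l' t' : \sum_(i < t'.+2) binz (l' + 1) i * binz m (t'.+1 - i)%N =
   \sum_(i < t'.+2) binz l' i * binz m (t'.+1 - i)%N
   + \sum_(i < t'.+1) binz l' i * binz m (t' - i)%N.
  rewrite big_ord_recl [X in _ = X + _]big_ord_recl !binz0 -addrA; congr (_ + _).
  rewrite -big_split /=; apply: eq_bigr => i _.
  by rewrite binzS mulrDl subSS.
elim/int_rect: l t => [|l IH|l IH] t.
- rewrite big_ord_recl binz0 mul1r subn0 big1 ?addr0 ?add0r // => i _.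
  by rewrite binz0S mul0r.
- case: t => [|t]; first by rewrite big_ord1 !binz0 mul1r.
  rewrite (_ : l.+1%:Z = l%:Z + 1); last by lia.
  by rewrite S !IH addrAC binzS.
- elim: t => [|t IHt]; first by rewrite big_ord1 !binz0 mul1r.
  have := S (- l.+1%:Z) t; rewrite IHt (_ : - l.+1%:Z + 1 = - l%:Z); last by lia.
  rewrite IH => /(canLR (addrK _)) <-; rewrite [RHS]binz_sub; congr (binz _ _ - _).
  by lia.
Qed.

(** Proved by Pascal's rule in [p] as before. It supplies the coefficients in [fm_comm_gen], where a
    commutator expanded in one order of the factors is rewritten in the other. *)
Lemma alt_Vandermonde q p j :
  \sum_(i < j.+1) (-1) ^+ i * binz p i * binz (q - i%:Z) (j - i)%N = binz (q - p) j.
Proof.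
have S q' p' t : \sum_(i < t.+2) (-1) ^+ i * binz (p' + 1) i * binz (q' - i%:Z) (t.+1 - i)%N =
   \sum_(i < t.+2) (-1) ^+ i * binz p' i * binz (q' - i%:Z) (t.+1 - i)%N
   - \sum_(i < t.+1) (-1) ^+ i * binz p' i * binz (q' - 1 - i%:Z) (t - i)%N.
  rewrite big_ord_recl [X in _ = X - _]big_ord_recl !binz0 -addrA; congr (_ + _).
  rewrite -sumrB /=; apply: eq_bigr => i _.
  rewrite binzS subSS exprS (_ : q' - (bump 0 i)%:Z = q' - 1 - i%:Z); last by rewrite /bump /=; lia.
  by ring.
elim/int_rect: p q j => [|p IH|p IH] q j.
- rewrite big_ord_recl binz0 expr0 !mul1r subn0 big1 ?addr0 ?subr0 // => i _.
  by rewrite binz0S mulr0 mul0r.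
- case: j => [|j]; first by rewrite big_ord1 !binz0 !mul1r.
  rewrite (_ : p.+1%:Z = p%:Z + 1); last by lia.
  rewrite S !IH (_ : q - (p%:Z + 1) = q - 1 - p%:Z); last by lia.
  rewrite [RHS]binz_sub; congr (binz _ _ - _); lia.
- elim: j q => [|j IHj] q; first by rewrite big_ord1 !binz0 !mul1r.
  have := S q (- p.+1%:Z) j; rewrite IHj (_ : - p.+1%:Z + 1 = - p%:Z); last by lia.
  rewrite IH => /(canLR (subrK _)) <-.
  rewrite (_ : q - - p.+1%:Z = (q - - p%:Z) + 1) ?binzS; last by lia.
  by congr (_ + binz _ _); lia.
Qed.

Lemma binzN (s a : nat) : (-1) ^+ a * binz (- s.+1%:Z) a = 'C(s + a, a)%:R.
Proof.
apply: (mulIf (fact_neq0 a)); rewrite -mulrA binzE -natrM bin_ffact.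
elim: a => [|a IH]; first by rewrite mul1r /ffz big_ord0.
rewrite addnS ffactSS natrM -IH exprS ffzSr.
rewrite rmorphN /= -!pmulrn -!natr1 natrD; ring.
Qed.

Lemma binzN1 a : (-1) ^+ a * binz (-1) a = 1.
Proof. by rewrite (binzN 0) add0n binn. Qed.

End Binomials.

(** * Fields and their products *)

Section Fields.
Variables (F : fieldType) (W : superspace F).
Hypothesis F0 : forall n, (n%:R == 0 :> F) = (n == 0)%N.
Local Notation binz := (@binz F).
Local Notation field := (int -> W -> W).
Local Notation sgn := (sgn F).
Implicit Types (U B G : field) (p q : bool) (l m n : int) (w : W).

Lemma scalerCA a b (w : W) : a *: (b *: w) = b *: (a *: w).
Proof. by rewrite !scalerA mulrC. Qed.

Lemma sgnM p q : sgn p * sgn q = sgn (p (+) q).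
Proof. by rewrite /Defs.sgn signr_addb. Qed.

Lemma sgnK p : sgn p * sgn p = 1.
Proof. by rewrite sgnM addbb. Qed.

Lemma par0 : par (0 : W) = 0. Proof. exact: lin0 (@par_linear _ W). Qed.
Lemma parD (u w : W) : par (u + w) = par u + par w. Proof. exact: linD (@par_linear _ W) _ _. Qed.
Lemma parB (u w : W) : par (u - w) = par u - par w. Proof. exact: linB (@par_linear _ W) _ _. Qed.
Lemma parZ c (w : W) : par (c *: w) = c *: par w. Proof. exact: linZ (@par_linear _ W) _ _. Qed.

Definition isfield G : Prop :=
  (forall n, linear (G n)) /\ forall w, exists N : int, forall n, N <= n -> G n w = 0.

Definition hpar p G : Prop := forall n w, par (G n w) = sgn p *: G n (par w).

(** Conjugation by the parity for odd [p]. On [G] of parity [q] it is the Koszul sign of [p] and [q]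
    ([cpar_hpar]), but it also makes sense for inhomogeneous [G], so that commutators and products
    need only the left factor to have a parity. *)
Definition cpar p G : field := fun n w => if p then par (G n (par w)) else G n w.

Lemma cpar_isfield p G : isfield G -> isfield (cpar p G).
Proof.
case: p => // -[lG tG]; split=> [n c u v|w].
  by rewrite /cpar parD parZ lG parD parZ.
by have [N GN] := tG (par w); exists N => n Nn; rewrite /cpar GN ?par0.
Qed.

Lemma cpar_cpar p q G : cpar p (cpar q G) = cpar (p (+) q) G.
Proof. by case: p; case: q => //=; apply/funext => n; apply/funext => w; rewrite /cpar !parK. Qed.

Lemma cpar_hpar p q U n w : hpar q U -> cpar p U n w = sgn (p && q) *: U n w.
Proof. by case: p => hU; rewrite /cpar ?scale1r // hU parK. Qed.

Lemma isfield_nat G n w : isfield G -> exists N : nat, forall j, (N <= j)%N -> G (n + j%:Z) w = 0.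
Proof.
case=> _ /(_ w)[N GN]; exists `|N - n|%N => j Nj; apply: GN; lia.
Qed.

Lemma isfield_fin G (x : nat -> W) J : isfield G ->
  exists N : int, forall n (j : nat), N <= n -> (j < J)%N -> G n (x j) = 0.
Proof.
move=> [_ tG]; elim: J => [|J [N IH]]; first by exists 0.
have [M GM] := tG (x J); exists (Num.max N M) => n j.
rewrite ge_max => /andP[Nn Mn]; rewrite ltnS leq_eqVlt => /orP[/eqP -> |]; last exact: IH.
exact: GM.
Qed.

Lemma linG0 G n : isfield G -> G n 0 = 0.
Proof. by move=> [lG _]; apply: lin0 (lG n). Qed.
Lemma linGZ G n c w : isfield G -> G n (c *: w) = c *: G n w.
Proof. by move=> [lG _]; apply: linZ (lG n) _ _. Qed.
Lemma linGB G n u w : isfield G -> G n (u - w) = G n u - G n w.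
Proof. by move=> [lG _]; apply: linB (lG n) _ _. Qed.
Lemma linGD G n u w : isfield G -> G n (u + w) = G n u + G n w.
Proof. by move=> [lG _]; apply: linD (lG n) _ _. Qed.

Lemma linG_sum G n J (f : 'I_J -> W) : isfield G ->
  G n (\sum_(s < J) f s) = \sum_(s < J) G n (f s).
Proof. by move=> [lG _]; apply: lin_sum (lG n) _ _ _. Qed.

Lemma efinUG U G (a : nat -> int) n w : isfield U -> isfield G ->
  efin (fun j : nat => U (a j) (G (n + j%:Z) w)).
Proof.
move=> hU hG; have [N GN] := isfield_nat n w hG.
by exists N => j Nj; rewrite GN ?linG0.
Qed.

(** The [l]-th product of the fields [U], of parity [p], and [G]: the case [m = 0] of the Borcherds
    identity, taken as a definition. *)
Definition fprod p U l G : field := fun n w =>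
  fs (fun j : nat => ((-1) ^+ j * binz l j) *:
    (U (l - j%:Z) (G (n + j%:Z) w) - (-1) ^ l *: cpar p G (n + l - j%:Z) (U j%:Z w))).

Lemma efinGU p U G (a : nat -> int) w : isfield U -> isfield G ->
  efin (fun j : nat => cpar p G (a j) (U j%:Z w)).
Proof.
move=> hU /(cpar_isfield p) hG; have := efinUG a 0 w hG hU.
by under eq_fun do rewrite add0r.
Qed.

Lemma fprod_efin p U l G n w : isfield U -> isfield G -> efin (fun j : nat =>
  (U (l - j%:Z) (G (n + j%:Z) w) - (-1) ^ l *: cpar p G (n + l - j%:Z) (U j%:Z w))).
Proof.
by move=> hU hG; apply: efinB; [exact: (efinUG (fun j => l - j%:Z) n w hU hG)|apply: efinZc; exact: (efinGU _ (fun j => n + l - j%:Z))].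
Qed.

Lemma fprod_isfield p U l G : isfield U -> isfield G -> isfield (fprod p U l G).
Proof.
move=> hU hG; have hG' := cpar_isfield p hG; split=> [n c u v|w].
  rewrite /fprod -fsZ; last by apply: efinZ; exact: fprod_efin.
  rewrite -fsD; first last.
  - by apply: efinZ; exact: fprod_efin.
  - by apply: efinZc; apply: efinZ; exact: fprod_efin.
  apply: fs_eq => j; rewrite (proj1 hG) (proj1 hU) (proj1 hU) (proj1 hG').
  rewrite [c *: (_ *: _)]scalerCA -scalerDr; congr (_ *: _).
  by rewrite scalerDr scalerBr [_ *: (c *: _)]scalerCA opprD addrACA.
have [N GN] := proj2 hG w; have [J UJ] := isfield_nat 0 w hU.
have [M GM] := isfield_fin (fun j => U j%:Z w) J hG'.
exists (Num.max N (M - l + J%:Z)) => n; rewrite ge_max => /andP[Nn Mn].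
apply: fs_eq0 => j; rewrite GN ?linG0 //; last by lia.
have [Jj|jJ] := leqP J j; first by rewrite -[j%:Z]add0r UJ // linG0 // scaler0 subr0 scaler0.
by rewrite GM // ?scaler0 ?subr0 ?scaler0 //; lia.
Qed.

Lemma cpar_fprod q p U l G : hpar p U -> isfield U -> isfield G ->
  forall n w, cpar q (fprod p U l G) n w = sgn (p && q) *: fprod p U l (cpar q G) n w.
Proof.
move=> pU hU hG n w; case: q; last by rewrite andbF scale1r.
have hG' := cpar_isfield true hG.
rewrite andbT {1}/cpar /fprod (fs_lin (@par_linear _ W)); last by apply: efinZ; apply: fprod_efin.
rewrite -fsZ; last by apply: efinZ; apply: fprod_efin.
apply: fs_eq => j; rewrite parZ [sgn p *: _]scalerCA; congr (_ *: _).
rewrite parB parZ pU scalerBr; congr (_ - _).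
rewrite [sgn p *: _]scalerCA; congr (_ *: _).
have -> : U j (par w) = sgn p *: par (U j w) by rewrite pU scalerA sgnK scale1r.
by rewrite linGZ ?parZ; [rewrite !cpar_cpar /cpar; case: p {pU}; rewrite /= ?parK|exact: cpar_isfield].
Qed.

Definition idf : field := fun n w => if n == -1 then w else 0.

Lemma idf_isfield : isfield idf.
Proof.
split=> [n c u v|w]; first by rewrite /idf; case: eqP; rewrite ?scaler0 ?addr0.
by exists 0 => n n0; rewrite /idf; case: eqP => // n1; lia.
Qed.

Lemma fprod_id l G n w : isfield G ->
  fprod false idf l G n w = if l == -1 then G n w else 0.
Proof.
move=> hG; have E (j : nat) : cpar false G (n + l - j%:Z) (idf j%:Z w) = 0.
  by rewrite /idf -[j%:Z == -1]/false; apply: linG0.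
rewrite /fprod; under eq_fun do rewrite E scaler0 subr0.
have [l0|l0] := leP 0 l; last have [-> {l l0 E}|l1] := eqVneq l (-1).
- have -> : (l == -1) = false by apply/eqP; lia.
  apply: fs_eq0 => j; rewrite /idf; case: eqP => lj; last by rewrite scaler0.
  have -> : binz l j = 0 by rewrite -(gez0_abs l0); apply: (binz_small F0); lia.
  by rewrite mulr0 scale0r.
- rewrite (@fs1 _ _ 0%N) => [|j j0]; first by rewrite /= /idf subr0 eqxx addr0 (binz0 F) mulr1 scale1r.
  by rewrite /idf (_ : (_ == -1) = false) ?scaler0 //; apply/eqP; lia.
- apply: fs_eq0 => j; rewrite /idf (_ : (_ == -1) = false) ?scaler0 //; apply/eqP; lia.
Qed.

(** The commutator formula with at most [J] terms. The fields [C s] play the part of the products of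
    [U] and [G], but are given independently of [fprod]. *)
Definition gcomm p U G (C : nat -> field) J : Prop := forall m n w,
  U m (G n w) - cpar p G n (U m w) = \sum_(s < J) binz m s *: C s (m + n - s%:Z) w.

(** This and [coef_binz2] are the coefficient sums along a diagonal [i + j = t] in [fprod_comm]:
    here [G] is applied first, there it is applied last. *)
Lemma coef_binz1 l m s t :
  \sum_(i < t.+1) binz l i * binz m (t - i)%N * binz (l - i%:Z) s
  = binz l s * binz (l - s%:Z + m) t.
Proof.
rewrite -(Vandermonde_binz F0) mulr_sumr; apply: eq_bigr => i _.
by rewrite mulrAC (binz_trans F0) mulrA.
Qed.

Lemma coef_binz2 l m s t :
  \sum_(i < (s + t).+1) binz l i * binz m (s + t - i)%N * binz i%:Z s
  = binz l s * binz (l - s%:Z + m) t.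
Proof.
rewrite -(Vandermonde_binz F0) mulr_sumr -addnS big_split_ord /= big1 ?add0r => [|i _].
  apply: eq_bigr => i _; rewrite mulrAC (binz_nat_trans F0) -mulrA.
  by rewrite subnDl.
by rewrite (binz_small F0) ?mulr0.
Qed.

Lemma coef_binz2_small l m s t : (t < s)%N ->
  \sum_(i < t.+1) binz l i * binz m (t - i)%N * binz i%:Z s = 0.
Proof.
move=> ts; apply: big1 => i _; rewrite (binz_small F0) ?mulr0 //.
by rewrite (leq_trans _ ts).
Qed.
End Fields.

(** * Commutators of product operators *)

Section ThreeFields.
Variables (F : fieldType) (W : superspace F).
Hypothesis F0 : forall n, (n%:R == 0 :> F) = (n == 0)%N.
Local Notation binz := (@binz F).
Local Notation field := (int -> W -> W).
Local Notation sgn := (sgn F).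
Implicit Types (U B G : field) (p q : bool) (l m n : int) (w : W).

Local Notation cz l i := ((-1) ^+ i * binz l i).

Lemma efin2_UBG U B G (a b : nat -> nat -> int) n w :
  isfield U -> isfield B -> isfield G ->
  efin2 (fun i j : nat => U (a i j) (B (b i j) (G (n + (i + j)%N%:Z) w))).
Proof.
move=> hU hB hG; have [N GN] := isfield_nat n w hG.
by exists N => i j Nij; rewrite GN // !linG0.
Qed.

Lemma efin2_UGB U B G (a : nat -> nat -> int) n w :
  isfield U -> isfield B -> isfield G ->
  efin2 (fun i j : nat => U (a i j) (G (n + i%:Z - j%:Z) (B j%:Z w))).
Proof.
move=> hU hB hG; have [J BJ] := isfield_nat 0 w hB.
have [M GM] := isfield_fin (fun j => B j%:Z w) J hG.
exists (J + `|(M - n + J%:Z)%R|)%N => i j Nij.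
have [Jj|jJ] := leqP J j; first by rewrite -[X in B X]add0r BJ // !linG0.
by rewrite GM ?linG0 //; lia.
Qed.

Lemma efin2_GBU U B G (a : nat -> nat -> int) w :
  isfield U -> isfield B -> isfield G ->
  efin2 (fun i j : nat => G (a i j) (B j%:Z (U i%:Z w))).
Proof.
move=> hU hB hG; have [I UI] := isfield_nat 0 w hU.
have [M BM] := isfield_fin (fun i => U i%:Z w) I hB.
exists (I + `|M|)%N => i j Nij.
have [Ii|iI] := leqP I i; first by rewrite -[X in U X]add0r UI // !linG0.
by rewrite BM ?linG0 //; lia.
Qed.

Lemma fprod2E p q U B G l m n w :
  hpar q B -> isfield U -> isfield B -> isfield G ->
  fprod p U l (fprod q B m G) n w =
  fs (fun i : nat => fs (fun j : nat => (cz l i * cz m j) *: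
    (U (l - i%:Z) (B (m - j%:Z) (G (n + (i + j)%N%:Z) w))
     - (-1) ^ m *: U (l - i%:Z) (cpar q G (n + m + i%:Z - j%:Z) (B j%:Z w))
     - ((-1) ^ l * sgn (p && q)) *:
         (B (m - j%:Z) (cpar p G (n + l + j%:Z - i%:Z) (U i%:Z w))
          - (-1) ^ m *: cpar (q (+) p) G (n + l + m - (i + j)%N%:Z) (B j%:Z (U i%:Z w)))))).
Proof.
move=> qB hU hB hG; apply: fs_eq => i.
have hG' := cpar_isfield p hG.
have fin1 := fprod_efin q m (n + i%:Z) w hB hG.
have fin2 := fprod_efin q m (n + l - i%:Z) (U i%:Z w) hB hG'.
rewrite cpar_fprod // /fprod (fs_lin (proj1 hU _)); last exact: efinZ.
rewrite scalerA -fsZ; last exact: efinZ.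
rewrite -fsB; first last.
- by apply: efinZc; apply: efinZ.
- have [N fN] := fin1; exists N => j Nj.
  by rewrite fN // scaler0 linG0.
rewrite -fsZ; first last.
  apply: efinB; last by apply: efinZc; apply: efinZ.
  by have [N fN] := fin1; exists N => j Nj; rewrite fN // scaler0 linG0.
apply: fs_eq => j; rewrite linGZ // -[in RHS]scalerA; congr (_ *: _).
rewrite [q && p]andbC scalerCA -scalerBr; congr (_ *: _).
rewrite linGB // linGZ //; congr (_ - _ *: _ - _ *: (_ - _ *: _)).
- by congr (U _ (B _ (G _ _))); lia.
- by congr (U _ (cpar _ _ _ _)); lia.
- by congr (B _ (cpar _ _ _ _)); lia.
- by rewrite cpar_cpar; congr (cpar _ _ _ _); lia.
Qed.

(** Twofold products expand into the six orders [t1], ..., [t6] of the operators [U], [B], [G]. The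
    orders [t2] and [t3], with [G] in the middle, cancel; in the pairs [t1], [t5] and [t6], [t4] the
    factors [U] and [B] are adjacent, and their commutator formula applies. The field [G] is
    arbitrary, and so the products with currents will act on the space of all fields. *)
Lemma fprod_comm p q U B G (C : nat -> field) J l m n w :
  hpar p U -> hpar q B -> isfield U -> isfield B -> isfield G ->
  (forall s, isfield (C s)) -> gcomm p U B C J ->
  fprod p U l (fprod q B m G) n w
    - sgn (p && q) *: fprod q B m (fprod p U l G) n w =
  \sum_(s < J) binz l s *: fprod (p (+) q) (C s) (l + m - s%:Z) G n w.
Proof.
move=> pU qB hU hB hG hC UBC.
have hGp r := cpar_isfield r hG.
pose t1 i j := U (l - i%:Z) (B (m - j%:Z) (G (n + (i + j)%N%:Z) w)).
pose t2 i j := U (l - i%:Z) (cpar q G (n + m + i%:Z - j%:Z) (B j%:Z w)).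
pose t3 i j := B (m - j%:Z) (cpar p G (n + l + j%:Z - i%:Z) (U i%:Z w)).
pose t4 i j := cpar (q (+) p) G (n + l + m - (i + j)%N%:Z) (B j%:Z (U i%:Z w)).
pose t5 i j := B (m - j%:Z) (U (l - i%:Z) (G (n + (i + j)%N%:Z) w)).
pose t6 i j := cpar (q (+) p) G (n + l + m - (i + j)%N%:Z) (U i%:Z (B j%:Z w)).
have f1 : efin2 t1 by exact: (efin2_UBG (fun i j => l - i%:Z) (fun i j => m - j%:Z) n w hU hB hG).
have f2 : efin2 t2 by exact: (efin2_UGB (fun i j => l - i%:Z) (n + m) w hU hB (hGp q)).
have f3 : efin2 t3.
  by apply: efin2C; apply: (efin2_UGB (fun j i => m - j%:Z) (n + l) w hB hU (hGp p)).
have f4 : efin2 t4 by exact: (efin2_GBU (fun i j => n + l + m - (i + j)%N%:Z) w hU hB (hGp _)).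
have f5 : efin2 t5.
  have := efin2C (efin2_UBG (fun j i => m - j%:Z) (fun j i => l - i%:Z) n w hB hU hG).
  by under eq_fun do under eq_fun do rewrite addnC.
have f6 : efin2 t6.
  by apply: efin2C; apply: (efin2_GBU (fun j i => n + l + m - (i + j)%N%:Z) w hB hU (hGp _)).
pose a := (-1) ^ l : F; pose b := (-1) ^ m : F; pose sg := sgn (p && q).
have E1 : fprod p U l (fprod q B m G) n w = fs (fun i : nat => fs (fun j : nat =>
    (cz l i * cz m j) *: (t1 i j - b *: t2 i j - (a * sg) *: (t3 i j - b *: t4 i j)))).
  by rewrite fprod2E.
have E2 : fprod q B m (fprod p U l G) n w = fs (fun i : nat => fs (fun j : nat =>
    (cz l i * cz m j) *: (t5 i j - a *: t3 i j - (b * sg) *: (t2 i j - a *: t6 i j)))).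
  rewrite fprod2E // [RHS]fs2_exchange; last first.
    apply: efin2Z; apply: efin2B; [apply: efin2B => //|]; apply: efin2Zc => //.
    by apply: efin2B => //; apply: efin2Zc.
  apply: fs2_eq => j i; rewrite [cz m j * _]mulrC [q && p]andbC [p (+) q]addbC.
  by rewrite /t5 /t3 /t2 /t6 addnC (addrAC n m l).
have f7 : efin2 (fun i j => t1 i j - sg *: t5 i j) by apply: efin2B => //; apply: efin2Zc.
have f8 : efin2 (fun i j => t6 i j - sg *: t4 i j) by apply: efin2B => //; apply: efin2Zc.
rewrite E1 E2 -fs2Z; last first.
  apply: efin2Z; apply: efin2B; [apply: efin2B => //|]; apply: efin2Zc => //.
  by apply: efin2B => //; apply: efin2Zc.
rewrite -fs2B; first last.
- apply: efin2Zc; apply: efin2Z; apply: efin2B; [apply: efin2B => //|]; apply: efin2Zc => //.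
  by apply: efin2B => //; apply: efin2Zc.
- apply: efin2Z; apply: efin2B; [apply: efin2B => //|]; apply: efin2Zc => //.
  by apply: efin2B => //; apply: efin2Zc.
transitivity (fs (fun i => fs (fun j => (cz l i * cz m j) *: (t1 i j - sg *: t5 i j)))
   - (a * b) *: fs (fun i => fs (fun j => (cz l i * cz m j) *: (t6 i j - sg *: t4 i j)))).
  rewrite -fs2Z; last exact: efin2Z.
  rewrite -fs2B; first last.
  - by apply: efin2Zc; apply: efin2Z.
  - exact: efin2Z.
  apply: fs2_eq => i j; move: (cz l i * cz m j) (t1 i j) (t2 i j) (t3 i j) (t4 i j) (t5 i j) (t6 i j).
  rewrite /sg; case: (p && q); rewrite /Defs.sgn ?expr0 ?expr1 => *; lmod F.
have -> : fs (fun i => fs (fun j => (cz l i * cz m j) *: (t1 i j - sg *: t5 i j))) =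
  \sum_(s < J) binz l s *: fs (fun t : nat => cz (l + m - s%:Z) t *:
     C s (l + m - s%:Z - t%:Z) (G (n + t%:Z) w)).
  rewrite fs2_diag; last exact: efin2Z.
  pose H s (t : nat) := binz l s *: (cz (l + m - s%:Z) t *:
     C s (l + m - s%:Z - t%:Z) (G (n + t%:Z) w)).
  have Hfin s : efin (H s) by apply: efinZc; apply: efinZ; exact: (efinUG (fun t : nat => l + m - s%:Z - t%:Z) n w (hC s) hG).
  transitivity (fs (fun t : nat => \sum_(s < J) H s t)).
    apply: fs_eq => t; transitivity (\sum_(i < t.+1) \sum_(s < J)
        ((-1) ^+ t * (binz l i * binz m (t - i)%N * binz (l - i%:Z) s)) *:
        C s (l + m - s%:Z - t%:Z) (G (n + t%:Z) w)).
      apply: eq_bigr => -[i /= it] _; rewrite /t1 /t5 subnKC // /sg -(cpar_hpar _ _ _ qB).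
      rewrite UBC scaler_sumr; apply: eq_bigr => s _; rewrite scalerA.
      have -> : (-1) ^+ t = (-1) ^+ i * (-1) ^+ (t - i) :> F by rewrite -exprD subnKC.
      congr (_ *: C _ _ _); first by ring.
      lia.
    rewrite exchange_big; apply: eq_bigr => s _; rewrite -scaler_suml -mulr_sumr.
    rewrite (coef_binz1 F0) /H scalerA (addrAC l); congr (_ *: _); ring.
  rewrite fs_sum //; apply: eq_bigr => s _.
  by rewrite /H fsZ //; apply: efinZ; exact: (efinUG (fun t : nat => l + m - s%:Z - t%:Z) n w (hC s) hG).
have -> : fs (fun i => fs (fun j => (cz l i * cz m j) *: (t6 i j - sg *: t4 i j))) =
  \sum_(s < J) (binz l s * (-1) ^+ s) *: fs (fun t : nat => cz (l + m - s%:Z) t *: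
     cpar (p (+) q) G (n + (l + m - s%:Z) - t%:Z) (C s t w)).
  rewrite fs2_diag; last exact: efin2Z.
  (* On the diagonal [t] the field [C s] has mode [t - s]; by [coef_binz2_small] the diagonals with
     [t < s] contribute nothing, so that the sum starts at [s] and can be shifted. *)
  pose H s t : W := if (s <= t)%N then ((-1) ^+ t * (binz l s * binz (l - s%:Z + m) (t - s)%N)) *:
      cpar (q (+) p) G (n + l + m - t%:Z) (C s (t%:Z - s%:Z) w) else 0.
  have HE s t : H s (s + t)%N = (binz l s * (-1) ^+ s) *: (cz (l + m - s%:Z) t *:
     cpar (p (+) q) G (n + (l + m - s%:Z) - t%:Z) (C s t w)).
    rewrite /H leq_addr addKn scalerA [p (+) q]addbC exprD.
    rewrite (_ : l - s%:Z + m = l + m - s%:Z); last by lia.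
    rewrite (_ : (s + t)%N%:Z - s%:Z = t%:Z); last by lia.
    congr (_ *: cpar _ _ _ _); first by ring.
    lia.
  have Hfin s : efin (H s).
    have [N fN] : efin (fun t => H s (s + t)%N).
      under eq_fun do rewrite HE.
      by apply: efinZc; apply: efinZ; exact: (efinGU _ (fun t : nat => n + (l + m - s%:Z) - t%:Z) w (hC s) hG).
    exists (s + N)%N => t Nt; rewrite -(subnKC (leq_trans (leq_addr N s) Nt)).
    by apply: fN; rewrite leq_subRL // (leq_trans _ Nt) ?leq_addr.
  transitivity (fs (fun t : nat => \sum_(s < J) H s t)).
    apply: fs_eq => t; transitivity (\sum_(i < t.+1) \sum_(s < J)
        ((-1) ^+ t * (binz l i * binz m (t - i)%N * binz i%:Z s)) *:
        cpar (q (+) p) G (n + l + m - t%:Z) (C s (t%:Z - s%:Z) w)).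
      apply: eq_bigr => -[i /= it] _; rewrite /t6 /t4 subnKC //.
      rewrite -linGZ // -linGB // /sg -(cpar_hpar _ _ _ qB) UBC.
      rewrite (lin_sum (proj1 (hGp _) _)) scaler_sumr; apply: eq_bigr => s _.
      rewrite linGZ // scalerA.
      have -> : (-1) ^+ t = (-1) ^+ i * (-1) ^+ (t - i) :> F by rewrite -exprD subnKC.
      congr (_ *: cpar _ _ _ (C _ _ _)); first by ring.
      lia.
    rewrite exchange_big; apply: eq_bigr => s _; rewrite -scaler_suml -mulr_sumr /H.
    case: leqP => [st|ts]; last by rewrite (coef_binz2_small F0) // mulr0 scale0r.
    by have := coef_binz2 F0 l m s (t - s); rewrite subnKC // => ->.
  rewrite fs_sum //; apply: eq_bigr => s _.
  rewrite (@fs_shift _ _ s) //; last by move=> j js; rewrite /H leqNgt js.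
  by under eq_fun do rewrite HE; rewrite fsZ //; apply: efinZ; exact: (efinGU _ (fun t : nat => n + (l + m - s%:Z) - t%:Z) w (hC s) hG).
rewrite scaler_sumr -sumrB; apply: eq_bigr => s _.
rewrite /fprod; under [in RHS]eq_fun do rewrite scalerBr.
rewrite [in RHS]fsB; first last.
- by apply: efinZ; apply: efinZc; exact: (efinGU _ (fun t : nat => n + (l + m - s%:Z) - t%:Z) w (hC s) hG).
- by apply: efinZ; exact: (efinUG (fun t : nat => l + m - s%:Z - t%:Z) n w (hC s) hG).
rewrite scalerBr; congr (_ - _).
under [in RHS]eq_fun do rewrite scalerCA.
rewrite fsZ; last by apply: efinZ; exact: (efinGU _ (fun t : nat => n + (l + m - s%:Z) - t%:Z) w (hC s) hG).
rewrite !scalerA; congr (_ *: _); rewrite mulrCA; congr (_ * _).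
rewrite expfzDr ?expfzDr ?oppr_eq0 ?oner_eq0 // /a /b; congr (_ * _).
by rewrite -exprz_inv invrN1.
Qed.
Lemma fprod_idr p (U : field) : isfield U -> fprod p U (-1) (@idf F W) = U.
Proof.
move=> hU; apply/funext => n; apply/funext => w.
have ci : cpar p (@idf F W) = @idf F W.
  case: p => //; apply/funext => m; apply/funext => y.
  by rewrite /cpar /idf; case: ifP; rewrite ?parK ?par0.
rewrite /fprod ci; have [n0|n0] := leP 0 n.
  rewrite (@fs1 _ _ `|n|%N) => [|j jn].
    have -> : (-1) ^+ `|n|%N * binz (-1) `|n|%N = 1 by rewrite (binzN1 F0).
    rewrite /idf (_ : (n + _ == -1) = false); last by apply/eqP; lia.
    rewrite (_ : (n - 1 - _ == -1)); last by apply/eqP; lia.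
    by rewrite linG0 // sub0r scale1r exprN1 invrN1 scaleN1r opprK; congr (U _ _); lia.
  rewrite /idf (_ : (n + _ == -1) = false); last by apply/eqP; lia.
  rewrite (_ : (n - 1 - _ == -1) = false); last by apply/eqP; lia.
  by rewrite linG0 // scaler0 subrr scaler0.
rewrite (@fs1 _ _ (`|n|.-1)%N) => [|j jn].
  rewrite (binzN1 F0) scale1r /idf (_ : (n + _ == -1)); last by apply/eqP; lia.
  rewrite (_ : (n - 1 - _ == -1) = false); last by apply/eqP; lia.
  by rewrite scaler0 subr0; congr (U _ _); lia.
rewrite /idf (_ : (n + _ == -1) = false); last by apply/eqP; lia.
rewrite (_ : (n - 1 - _ == -1) = false); last by apply/eqP; lia.
by rewrite linG0 // scaler0 subrr scaler0.
Qed.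

(** Against the identity field both orders produce the same operators: the term [j] of one cancels
    the term [l - j] of the other. *)
Lemma fprod_idr_ge0 p (U : field) (l : nat) n w : isfield U -> fprod p U l%:Z (@idf F W) n w = 0.
Proof.
move=> hU.
have ci : cpar p (@idf F W) = @idf F W.
  case: p => //; apply/funext => m; apply/funext => y.
  by rewrite /cpar /idf; case: ifP; rewrite ?parK ?par0.
rewrite /fprod ci.
pose f1 (j : nat) := ((-1) ^+ j * binz l%:Z j) *: U (l%:Z - j%:Z) (idf (n + j%:Z) w).
pose f2 (j : nat) := ((-1) ^+ l * (-1) ^+ j * binz l%:Z j) *: @idf F W (n + l%:Z - j%:Z) (U j%:Z w).
have f1l j : (l < j)%N -> f1 j = 0 by move=> lj; rewrite /f1 (binz_small F0) // mulr0 scale0r.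
have f2l j : (l < j)%N -> f2 j = 0 by move=> lj; rewrite /f2 (binz_small F0) // mulr0 scale0r.
rewrite (@fs_eq _ _ _ (fun j => f1 j - f2 j)); last first.
  by move=> j; rewrite /f1 /f2 -exprnP scalerBr scalerA; congr (_ - _ *: _); ring.
rewrite fsB; [|by exists l.+1|by exists l.+1].
rewrite !(@fsE _ _ l.+1) // [X in _ - X](reindex_inj rev_ord_inj) -sumrB.
apply: big1 => -[j /= jl] _; rewrite /f1 /f2 subSS !(binz_nat F0) bin_sub //.
rewrite [(-1) ^+ l * _](_ : _ = (-1) ^+ j); last first.
  rewrite -exprD (_ : (l + (l - j) = j + (l - j).*2)%N); last by lia.
  by rewrite exprD -[X in _ * X]signr_odd odd_double mulr1.
rewrite (_ : n + l%:Z - (l - j)%N%:Z = n + j%:Z); last by lia.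
rewrite (_ : (l - j)%N%:Z = l%:Z - j%:Z); last by lia.
by rewrite /idf; case: ifP; rewrite ?linG0 // subrr.
Qed.

End ThreeFields.

(** * Locality and the Jacobi identity for fields *)

Section Locality.
Variables (F : fieldType) (W : superspace F).
Hypothesis F0 : forall n, (n%:R == 0 :> F) = (n == 0)%N.
Local Notation binz := (@binz F).
Local Notation field := (int -> W -> W).
Local Notation sgn := (sgn F).
Implicit Types (U B G : field) (p q : bool) (l m n : int) (w : W).
Local Notation cz l i := ((-1) ^+ i * binz l i).

(** Together with [pcomm] this expresses mutual locality: only finitely many nonnegative products
    are nonzero, uniformly in the mode and the vector, and they determine all commutators. *)
Definition ptrunc p U G : Prop :=
  exists J, forall s : nat, (J <= s)%N -> forall n w, fprod p U s%:Z G n w = 0.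

Definition pcomm p U G : Prop := forall m n w,
  U m (G n w) - cpar p G n (U m w) =
  fs (fun s : nat => binz m s *: fprod p U s%:Z G (m + n - s%:Z) w).

Definition pjac p U G : Prop := forall l m n w,
  fs (fun j : nat => binz m j *: fprod p U (l + j%:Z) G (m + n - j%:Z) w) =
  fs (fun j : nat => cz l j *:
    (U (m + l - j%:Z) (G (n + j%:Z) w) - (-1) ^ l *: cpar p G (n + l - j%:Z) (U (m + j%:Z) w))).

(** Here [D l m n] will be the difference of the two sides of the Jacobi identity. The recursion
    carries the vanishing on the axes [l = 0] and [m = 0] to all integers; for negative [m] it
    degenerates to a relation between neighbouring values of [l], which can be followed in both
    directions. *)
Lemma defect_eq0 (V : zmodType) (D : int -> int -> int -> V) :
  (forall l m n, D (l + 1) m n = D l (m + 1) n - D l m (n + 1)) ->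
  (forall l n, D l 0 n = 0) -> (forall m n, D 0 m n = 0) ->
  forall l m n, D l m n = 0.
Proof.
move=> Drec D0 D1 l m; elim/int_rect: m l => [|m IH|m IH] l n //.
  rewrite (_ : m.+1%:Z = m%:Z + 1); last by lia.
  by have := Drec l m n; rewrite !IH subr0 => <-.
have {}Drec l' n' : D (l' + 1) (- m.+1%:Z) n' = - D l' (- m.+1%:Z) (n' + 1).
  by rewrite Drec (_ : - m.+1%:Z + 1 = - m%:Z) ?IH ?sub0r //; lia.
elim/int_rect: l n => [|l IHl|l IHl] n //.
  by rewrite (_ : l.+1%:Z = l%:Z + 1) ?Drec ?IHl ?oppr0 //; lia.
have := Drec (- l.+1%:Z) (n - 1).
rewrite subrK (_ : - l.+1%:Z + 1 = - l%:Z) ?IHl; last by lia.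
by move=> /eqP; rewrite eq_sym oppr_eq0 => /eqP.
Qed.

Lemma ptrunc_shift p U G l : ptrunc p U G ->
  exists N, forall j : nat, (N <= j)%N -> forall n w, fprod p U (l + j%:Z) G n w = 0.
Proof.
move=> [J hJ]; exists (J + absz l)%N => j Jj n w.
have -> : l + j%:Z = (absz (l + j%:Z))%:Z by lia.
by apply: hJ; lia.
Qed.

Lemma pjac_efin p U G l m n w : isfield U -> isfield G -> efin (fun j : nat => cz l j *:
    (U (m + l - j%:Z) (G (n + j%:Z) w) - (-1) ^ l *: cpar p G (n + l - j%:Z) (U (m + j%:Z) w))).
Proof.
move=> hU hG; apply: efinZ; apply: efinB.
  exact: (efinUG (fun j => m + l - j%:Z) n w hU hG).
apply: efinZc; exact: (efinUG (fun j => n + l - j%:Z) m w (cpar_isfield p hG) hU).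
Qed.

(** For [m = 0] the identity is the definition of [fprod], for [l = 0] it is [pcomm], and by
    Pascal's rule both sides satisfy the recursion of [defect_eq0]. *)
Lemma pjac_of_comm p U G : isfield U -> isfield G -> ptrunc p U G -> pcomm p U G ->
  pjac p U G.
Proof.
move=> hU hG tG cG l m n w; apply/eqP; rewrite -subr_eq0; apply/eqP.
have hGp := cpar_isfield p hG.
pose X l n := fprod p U l G n w.
pose L l m n := fs (fun j : nat => binz m j *: X (l + j%:Z) (m + n - j%:Z)).
have XE l' m' a b : a = l' -> b = m' -> X a b = X l' m' by move=> -> ->.
pose A a b := U a (G b w); pose B a b := cpar p G a (U b w).
pose R l m n := fs (fun j : nat => cz l j *:
  (A (m + l - j%:Z) (n + j%:Z) - (-1) ^ l *: B (n + l - j%:Z) (m + j%:Z))).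
apply: (defect_eq0 (D := fun l m n => L l m n - R l m n)) => {l m n} [l m n|l n|m n].
- have Lfin l' m' n' (c : nat -> F) :
      efin (fun j : nat => c j *: X (l' + j%:Z) (m' + n' - j%:Z)).
    by have [N fN] := ptrunc_shift l' tG; exists N => j Nj; rewrite /X fN ?scaler0.
  have Rfin l' m' n' (c : nat -> F) (d : F) : efin (fun j : nat => c j *:
      (A (m' - j%:Z) (n' + j%:Z) - d *: B (l' - j%:Z) (m + j%:Z))).
    apply: efinZ; apply: efinB; first exact: (efinUG (fun j => m' - j%:Z) n' w hU hG).
    by apply: efinZc; exact: (efinUG (fun j => l' - j%:Z) m w hGp hU).
  have LS : L l (m + 1) n = L (l + 1) m n + L l m (n + 1).
    rewrite /L fsS ?(binz0 F) // [X in _ = _ + X]fsS // !(binz0 F) addrCA; congr (_ + _).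
      by congr (_ *: _); apply: XE; lia.
    rewrite -fsD; [|exact: Lfin|exact: (efinS (Lfin l m (n + 1) (binz m)))].
    apply: fs_eq => j; rewrite (binzS F0) scalerDl addrC.
    by congr (_ *: _ + _ *: _); apply: XE; lia.
  have RS : R (l + 1) m n = R l (m + 1) n - R l m (n + 1).
    rewrite /R.
    pose T1 (j : nat) := A (m + l + 1 - j%:Z) (n + j%:Z) + (-1) ^ l *: B (n + l + 1 - j%:Z) (m + j%:Z).
    have T1fin (c : nat -> F) : efin (fun j => c j *: T1 j).
      have := Rfin (n + l + 1) (m + l + 1) n c (- (-1) ^ l).
      by under eq_fun do rewrite scaleNr opprK.
    have T1finS (c : nat -> F) : efin (fun j => c j *: T1 j.+1).
      have [N fN] := T1fin (fun=> 1); exists N => j Nj; have := fN j.+1 (leqW Nj).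
      by rewrite scale1r => ->; rewrite scaler0.
    transitivity (fs (fun j => cz (l + 1) j *: T1 j)).
      apply: fs_eq => j; rewrite /T1 expfzDr ?oppr_eq0 ?oner_eq0 // expr1z mulrN1 scaleNr opprK.
      by rewrite !addrA.
    rewrite fsS; last exact: T1fin.
    rewrite (binz0 F); transitivity (fs (fun j => cz l j *: T1 j) + fs (fun j => - cz l j *: T1 j.+1)).
      rewrite [in RHS]fsS; last exact: T1fin.
      rewrite (binz0 F) -addrA; congr (_ + _).
      rewrite -fsD; [|exact: (T1finS (fun j => cz l j.+1))|exact: T1finS].
      apply: fs_eq => j; rewrite -scalerDl; congr (_ *: _).
      by rewrite (binzS F0) exprS; ring.
    rewrite -!fsB; first last.
    + exact: pjac_efin.
    + exact: pjac_efin.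
    rewrite -fsD; first last.
    + exact: T1finS.
    + exact: T1fin.
    apply: fs_eq => j; rewrite /T1.
    have e1 : m + l + 1 - j%:Z = m + 1 + l - j%:Z by lia.
    have e2 : n + l + 1 - j%:Z = n + 1 + l - j%:Z by lia.
    have e3 : m + l + 1 - j.+1%:Z = m + l - j%:Z by lia.
    have e4 : n + l + 1 - j.+1%:Z = n + l - j%:Z by lia.
    have e5 : n + j.+1%:Z = n + 1 + j%:Z by lia.
    have e6 : m + j.+1%:Z = m + 1 + j%:Z by lia.
    rewrite e1 e2 e3 e4 e5 e6; lmod F.
  by rewrite RS LS; lmod F.
- apply/eqP; rewrite subr_eq0; apply/eqP.
  rewrite /L (@fs1 _ _ 0%N) => [|[|j] // _]; last by rewrite binz0S ?scale0r.
  rewrite (binz0 F) scale1r /X /R /fprod addr0 add0r subr0.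
  by apply: fs_eq => j; rewrite !add0r.
apply/eqP; rewrite subr_eq0; apply/eqP.
rewrite /R (@fs1 _ _ 0%N) => [|[|j] // _]; last by rewrite binz0S ?mulr0 ?scale0r.
rewrite (binz0 F) mulr1 scale1r expr0z scale1r !subr0 ?addr0 /A /B cG.
by apply: fs_eq => j; rewrite add0r.
Qed.

Lemma fprod0 p U l G n w : isfield U -> (forall n w, G n w = 0) -> fprod p U l G n w = 0.
Proof.
move=> hU G0; apply: fs_eq0 => j; rewrite G0 linG0 //.
by rewrite /cpar; case: p; rewrite !G0 ?par0 scaler0 subrr scaler0.
Qed.

Lemma pcomm_cpar p q U G : hpar p U -> isfield U -> isfield G -> ptrunc p U G -> pcomm p U G ->
  forall m n w, U m (cpar q G n w) - cpar (p (+) q) G n (U m w) =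
  sgn (p && q) *: fs (fun s : nat => binz m s *: cpar q (fprod p U s%:Z G) (m + n - s%:Z) w).
Proof.
move=> pU hU hG [J tG] cG m n w; case: q; last first.
  by rewrite andbF addbF scale1r cG.
rewrite andbT; have := congr1 (@par _ W) (cG m n (par w)).
rewrite parB pU (fs_lin (@par_linear _ W)); last first.
  by exists J => s Js; rewrite tG ?scaler0.
under eq_fun do rewrite parZ.
move=> /(congr1 ( *:%R (sgn p))); rewrite scalerBr scalerA sgnK scale1r => <-.
congr (_ - _).
have -> : U m (par w) = sgn p *: par (U m w) by rewrite pU scalerA sgnK scale1r.
rewrite linGZ; last exact: cpar_isfield.
rewrite /cpar; case: p {pU J tG cG} => /=; rewrite ?parK /Defs.sgn ?expr0 ?expr1 ?scale1r //.
by rewrite parZ parK scalerA mulrNN mulr1 scale1r.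
Qed.

(** Dong's lemma in commutator form. Commuting [U] past [B] gives the [C s], whose terms are summed
    by the Jacobi identity of [C s] and [G]; commuting [U] past [G] gives the products of [U] and
    [G], multiplied by [B]. The right-hand side is brought to the same shape by [fprod_comm]. The
    truncation of the products of [U] with the new field is an assumption; for fields of vectors it
    is inherited from [Vk]. *)
Lemma pcomm_fprod p q U B G (C : nat -> field) J m :
  hpar p U -> hpar q B -> isfield U -> isfield B -> isfield G ->
  (forall s, isfield (C s)) -> gcomm p U B C J ->
  (forall s, (s < J)%N -> ptrunc (p (+) q) (C s) G /\ pjac (p (+) q) (C s) G) ->
  ptrunc p U G -> pcomm p U G -> ptrunc p U (fprod q B m G) ->
  pcomm p U (fprod q B m G).
Proof.
move=> pU qB hU hB hG hC UBC CG tG cG tBG M n w.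
have hGp r := cpar_isfield r hG.
have [J' hJ'] := tG; have hP (s : nat) : isfield (fprod p U s%:Z G) by apply: fprod_isfield.
pose b := (-1) ^ m : F; pose sg := sgn (p && q).
pose Q1 s i := C s (M - s%:Z + m - i%:Z) (G (n + i%:Z) w)
   - b *: cpar (p (+) q) G (n + m - i%:Z) (C s (M - s%:Z + i%:Z) w).
pose Q2 s i := B (m - i%:Z) (fprod p U s%:Z G (M + n - s%:Z + i%:Z) w)
   - b *: cpar q (fprod p U s%:Z G) (M + n - s%:Z + m - i%:Z) (B i%:Z w).
have Q1fin s c : efin (fun i : nat => c i *: Q1 s i).
  apply: efinZ; apply: efinB; first exact: (efinUG (fun i => M - s%:Z + m - i%:Z) n w (hC s) hG).
  apply: efinZc; exact: (efinUG (fun j => n + m - j%:Z) (M - s%:Z) w (hGp _) (hC s)).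
have Q2fin s c : efin (fun i : nat => c i *: Q2 s i).
  by apply: efinZ; apply: fprod_efin.
have E i : U M (B (m - i%:Z) (G (n + i%:Z) w) - b *: cpar q G (n + m - i%:Z) (B i%:Z w))
   - sg *: (B (m - i%:Z) (cpar p G (n + i%:Z) (U M w)) -
      b *: cpar q (cpar p G) (n + m - i%:Z) (B i%:Z (U M w))) =
   \sum_(s < J) binz M s *: Q1 s i + sg *: \sum_(s < J') binz M s *: Q2 s i.
  have UB x y : U M (B x y) = sg *: B x (U M y) + \sum_(s < J) binz M s *: C s (M + x - s%:Z) y.
    by rewrite -UBC (cpar_hpar _ _ _ qB) addrC subrK.
  have UG x : U M (G x w) = cpar p G x (U M w)
       + \sum_(s < J') binz M s *: fprod p U s%:Z G (M + x - s%:Z) w.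
    by rewrite -(@fsE _ _ J' (fun s => binz M s *: fprod p U s%:Z G (M + x - s%:Z) w))
      => [|s Js]; [rewrite -cG addrC subrK|rewrite hJ' ?scaler0].
  have UGq x y : U M (cpar q G x y) = cpar (p (+) q) G x (U M y)
       + sg *: \sum_(s < J') binz M s *: cpar q (fprod p U s%:Z G) (M + x - s%:Z) y.
    rewrite -(@fsE _ _ J' (fun s => binz M s *: cpar q (fprod p U s%:Z G) (M + x - s%:Z) y)).
      by rewrite -pcomm_cpar // addrC subrK.
    by move=> s Js; rewrite /cpar; case: (q); rewrite hJ' ?par0 ?scaler0.
  rewrite linGB // linGZ // UB UG UGq UB linGD // cpar_cpar [q (+) p]addbC.
  rewrite linGD ?linGZ //.
  rewrite linG_sum // [cpar _ _ _ (\sum_(s < J) _)]linG_sum //.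
  have -> : \sum_(s < J) binz M s *: Q1 s i =
     \sum_(s < J) binz M s *: C s (M + (m - i%:Z) - s%:Z) (G (n + i%:Z) w)
     - b *: \sum_(s < J) cpar (p (+) q) G (n + m - i%:Z) (binz M s *: C s (M + i%:Z - s%:Z) w).
    rewrite scaler_sumr -sumrB; apply: eq_bigr => s _.
    rewrite /Q1 scalerBr linGZ //; congr (_ *: C _ _ _ - _); first by lia.
    rewrite scalerCA; congr (_ *: (_ *: cpar _ _ _ (C _ _ _))); lia.
  have -> : \sum_(s < J') binz M s *: Q2 s i =
     \sum_(s < J') B (m - i%:Z) (binz M s *: fprod p U s%:Z G (M + (n + i%:Z) - s%:Z) w)
     - b *: \sum_(s < J') binz M s *: cpar q (fprod p U s%:Z G) (M + (n + m - i%:Z) - s%:Z) (B i%:Z w).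
    rewrite [b *: _]scaler_sumr -sumrB; apply: eq_bigr => s _.
    rewrite /Q2 scalerBr linGZ //; congr (_ *: B _ (fprod _ _ _ _ _ _) - _); first by lia.
    rewrite scalerCA; congr (_ *: (_ *: cpar _ _ _ _)); lia.
  lmod F.
have LE : U M (fprod q B m G n w) - cpar p (fprod q B m G) n (U M w) =
  \sum_(s < J) binz M s *: fs (fun i : nat => cz m i *: Q1 s i)
  + sg *: \sum_(s < J') binz M s *: fprod q B m (fprod p U s%:Z G) (M + n - s%:Z) w.
  have fin1 := fprod_efin q m n w hB hG.
  have fin2 := fprod_efin q m n (U M w) hB (hGp p).
  rewrite cpar_fprod // [q && p]andbC -/sg /fprod (fs_lin (proj1 hU _)); last exact: efinZ.
  rewrite -fsZ; last exact: efinZ.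
  rewrite -fsB; first last.
  - by apply: efinZc; apply: efinZ.
  - have [N fN] := fin1; exists N => j Nj; by rewrite fN // scaler0 linG0.
  transitivity (fs (fun i : nat => \sum_(s < J) binz M s *: (cz m i *: Q1 s i)
      + sg *: \sum_(s < J') binz M s *: (cz m i *: Q2 s i))).
    apply: fs_eq => i; rewrite linGZ // (scalerCA sg (cz m i)) -scalerBr E.
    rewrite scalerDr !scaler_sumr; congr (_ + _); first by apply: eq_bigr => s _; rewrite scalerCA.
    by apply: eq_bigr => s _; rewrite (scalerCA (cz m i)) (scalerCA (cz m i)).
  rewrite fsD; first last.
  - by apply: efinZc; apply: (@efin_sum _ _ J' (fun s i => binz M s *: (cz m i *: Q2 s i))) => s; apply: efinZc.
  - by apply: (@efin_sum _ _ J (fun s i => binz M s *: (cz m i *: Q1 s i))) => s; apply: efinZc.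
  congr (_ + _).
    rewrite (@fs_sum _ _ J (fun s i => binz M s *: (cz m i *: Q1 s i))) => [|s]; last exact: efinZc.
    by apply: eq_bigr => s _; rewrite fsZ.
  rewrite fsZ; last by apply: (@efin_sum _ _ J' (fun s i => binz M s *: (cz m i *: Q2 s i))) => s; apply: efinZc.
  congr (_ *: _).
  rewrite (@fs_sum _ _ J' (fun s i => binz M s *: (cz m i *: Q2 s i))) => [|s]; last exact: efinZc.
  by apply: eq_bigr => s _; rewrite fsZ.
rewrite {}LE.
pose X s l n := fprod (p (+) q) (C s) l G n w.
have RE (j : nat) : fprod p U j%:Z (fprod q B m G) (M + n - j%:Z) w =
   sg *: fprod q B m (fprod p U j%:Z G) (M + n - j%:Z) w +
   \sum_(s < J) binz j%:Z s *: X s (j%:Z + m - s%:Z) (M + n - j%:Z).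
  by rewrite -(fprod_comm F0 _ _ _ _ pU qB hU hB hG hC UBC) [RHS]addrC subrK.
have Xfin s : (s < J)%N -> efin (fun j : nat => binz M j *: (binz j%:Z s *: X s (j%:Z + m - s%:Z) (M + n - j%:Z))).
  case/CG => tC _; have [N XN] := ptrunc_shift (m - s%:Z) tC; exists N => j Nj.
  by rewrite /X (_ : j%:Z + m - s%:Z = m - s%:Z + j%:Z) ?XN ?scaler0 //; lia.
pose X' s j := if (s < J)%N then binz M j *: (binz j%:Z s *: X s (j%:Z + m - s%:Z) (M + n - j%:Z)) else 0.
have X'fin s : efin (X' s).
  by rewrite /X'; have [/Xfin //|_] := ltnP s J; apply: efin0.
rewrite [RHS](@fs_eq _ _ _ (fun j : nat => binz M j *: (sg *: fprod q B m (fprod p U j%:Z G) (M + n - j%:Z) w)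
   + \sum_(s < J) X' s j)); last first.
  move=> j; rewrite RE scalerDr scaler_sumr; congr (_ + _).
  by apply: eq_bigr => s _; rewrite /X' ltn_ord.
rewrite fsD; first last.
- exact: efin_sum.
- by exists J' => j Jj; rewrite fprod0 ?scaler0 //; apply: hJ'.
rewrite addrC; congr (_ + _).
  rewrite (@fsE _ _ J') => [|j Jj]; last by rewrite fprod0 ?scaler0 //; apply: hJ'.
  by rewrite scaler_sumr; apply: eq_bigr => s _; rewrite scalerCA.
rewrite fs_sum //; apply: eq_bigr => -[s /= sJ] _.
have [_ /(_ m (M - s%:Z) n w) jC] := CG _ sJ.
rewrite [RHS](@fs_shift _ _ s) //; last first.
  by move=> j js; rewrite /X' sJ (binz_small F0) // scale0r scaler0.
rewrite /Q1 -jC -fsZ; last first.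
  have [tC _] := CG _ sJ; have [N XN] := ptrunc_shift m tC; exists N => j Nj.
  by rewrite XN ?scaler0.
apply: fs_eq => j; rewrite /X' sJ !scalerA (binz_nat_trans F0); congr (_ *: fprod _ _ _ _ _ _); lia.
Qed.
End Locality.

(** * Induced modules *)

Section InducedLift.
Variables (F : fieldType) (g : liesuper F) (S : pred g) (M : superspace F) (rho : g -> M -> M).
Hypothesis rho_par : forall b m, S b -> par (rho b m) = sgn F (lpar b) *: rho b (par m).
Local Notation I := (@ind_mod F g S M rho rho_par).
Local Notation iota := (ind_in rho_par).

Lemma lpi_actE b x :
  @act F g I b (lpi (ind_rel_subspace S rho) x) = lpi (ind_rel_subspace S rho) (lmul b x).
Proof.
exact: (lquot_mapE (ind_rel_subspace S rho) (@lmul_linear F g M b) (@ind_relM F g S M rho b) x).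
Qed.

Lemma ind_in_par m : par (iota m : I) = iota (par m).
Proof.
rewrite /ind_in /= (lquot_mapE _ (@tpar_linear F g M) (ind_rel_par rho_par)) tpar_mon.
by rewrite scale1r.
Qed.

Lemma ind_in_act b m : S b -> act b (iota m : I) = iota (rho b m).
Proof.
move=> Sb; rewrite /ind_in lpi_actE lmul_mon; apply/lpi_eq.
exact: ind_rel_sub.
Qed.

Lemma ind_in_linear : linear (iota : M -> I).
Proof.
move=> c m m'; rewrite /ind_in -lpi_linear; apply/lpi_eq; exact: ind_rel_lin.
Qed.

Lemma ind_generated (T : I -> Prop) : subspace T ->
  (forall b w, T w -> T (act b w)) -> (forall m, T (iota m)) -> forall w, T w.
Proof.
move=> [T0 TD] Tact Tin w; rewrite -[w]lreprK; elim/mon_ind: (lrepr w) => [|c u m x Tx].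
  by rewrite (lin0 (lpi_linear _)).
rewrite lpi_linear; apply: TD => //.
by elim: u => [|b u IH]; [exact: Tin|rewrite -lmul_mon -lpi_actE; apply: Tact].
Qed.

Variables (X : lmodType F) (ok : X -> Prop) (op : g -> X -> X) (f : M -> X).
Hypotheses (ok_sub : subspace ok) (op_ok : forall b x, ok x -> ok (op b x)).
Hypothesis op_lin : forall b c x y, ok x -> ok y -> op b (c *: x + y) = c *: op b x + op b y.
Hypothesis op_br : forall a b x, ok x ->
  op a (op b x) - sgn F (lpar a && lpar b) *: op b (op a x) = \sum_(p <- lbr a b) p.1 *: op p.2 x.
Hypotheses (f_lin : linear f) (f_ok : forall m, ok (f m)).
Hypothesis f_rho : forall b m, S b -> op b (f m) = f (rho b m).

(** Universal property of the induced module. The operators [op] have to form a representation only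
    on the subspace [ok]: families [int -> W -> W] satisfy the affine relations only if they are
    fields, and zero modes represent gl(1|1) only on vectors killed by the positive modes. *)
Lemma ind_lift : exists phi : I -> X,
  [/\ linear phi, forall w, ok (phi w), forall b w, phi (act b w) = op b (phi w) &
      forall m, phi (iota m) = f m].
Proof.
have [ok0 okD] := ok_sub.
pose wd (u : seq g) m := foldr op (f m) u.
pose L := fglift (fun p : seq g * M => wd p.1 p.2).
have LL : linear L by apply: fglift_linear.
have Lm u m : L (mon u m) = wd u m by rewrite /L /mon liftU scale1r.
have okw u m : ok (wd u m) by elim: u => [|b u IH]; [exact: f_ok|exact: op_ok].
have okL x : ok (L x).
  elim/mon_ind: x => [|c u m x okx]; first by rewrite (lin0 LL).
  by rewrite LL Lm; apply: okD.
have op0 b : op b 0 = 0.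
  by have := @op_lin b (-1) 0 0 ok0 ok0; rewrite scaler0 addr0 scaleN1r addNr.
have Lmul b x : L (lmul b x) = op b (L x).
  elim/mon_ind: x => [|c u m x IH].
    by rewrite (lin0 (@lmul_linear F g M b)) (lin0 LL) op0.
  by rewrite lmul_linear !LL lmul_mon !Lm op_lin // IH.
have Lrel x : ind_rel S rho x -> L x = 0.
  elim=> {x} [|c x y _ Lx _ Ly|b x _ Lx|c m m'|a b u m|b m Sb].
  - exact: lin0 LL.
  - by rewrite LL Lx Ly scaler0 addr0.
  - by rewrite Lmul Lx op0.
  - by rewrite (linB LL) LL !Lm /= f_lin subrr.
  - rewrite !(linB LL) (linZ LL) (lin_sum LL) !Lm /= op_br //.
    by apply/eqP; rewrite subr_eq0; apply/eqP; apply: eq_bigr => p _; rewrite (linZ LL) Lm.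
  - by rewrite (linB LL) !Lm /= f_rho // subrr.
pose phi (w : I) := L (lrepr w).
have phiE x : phi (lpi (ind_rel_subspace S rho) x) = L x.
  apply/eqP; rewrite /phi -subr_eq0 -(linB LL); apply/eqP; apply: Lrel.
  by apply/(lpi_eq (ind_rel_subspace S rho)); rewrite lreprK.
exists phi; split => [c u v|w|b w|m].
- by rewrite -[u]lreprK -[v]lreprK -lpi_linear !phiE LL.
- exact: okL.
- by rewrite -[w]lreprK lpi_actE !phiE Lmul.
- by rewrite phiE Lm.
Qed.
End InducedLift.

(** * The currents of a module of level k *)

Section Currents.
Variables (F : fieldType) (k : F).
Hypothesis F0 : forall n, (n%:R == 0 :> F) = (n == 0)%N.
Local Notation binz := (@binz F).
Local Notation Vk := (Vk k).
Local Notation vac := (vacuum k).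

Definition level (W : smod (agl11 F)) : Prop := forall w : W, act (None : agl11 F) w = k *: w.
Definition smooth (W : smod (agl11 F)) : Prop :=
  forall a (w : W), exists N : int, forall r, N <= r -> act (mode F a r) w = 0.

Lemma act_central (W : smod (agl11 F)) b (w : W) :
  act (None : agl11 F) (act b w) = act b (act (None : agl11 F) w).
Proof.
by have /eqP := act_br (None : agl11 F) b w; rewrite /= scale1r big_nil subr_eq0 => /eqP.
Qed.

Lemma level_hat (M : smod (gl11 F)) : level (hat k M).
Proof.
pose T (w : hat k M) := act (None : agl11 F) w = k *: w.
apply: (ind_generated (T := T)) => [|b w IH|m].
- split=> [|c u v hu hv]; first by rewrite /T scaler0 (lin0 (@act_linear _ _ _ _)).
  by rewrite /T act_linear hu hv scalerDr !scalerA mulrC.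
- by rewrite /T act_central IH (linZ (@act_linear _ _ (hat k M) b)).
- by rewrite /T ind_in_act // /hat_char (linZ (ind_in_linear _)).
Qed.

Lemma vac_act a r : 0 <= r -> act (mode F a r) vac = 0.
Proof.
move=> r0; rewrite /vacuum /hat_in ind_in_act // /hat_char.
have Z : ind_in (@hat_char_par F k (A_mod (0 : F))) 0 = 0 by apply: lin0 (ind_in_linear _).
by case: ifP => // _; case: a; rewrite /= ?scale0r Z.
Qed.

Lemma vac_par : par vac = vac. Proof. exact: ind_in_par. Qed.

Lemma Vk_ind (T : Vk -> Prop) : subspace T -> T vac ->
  (forall a r v, T v -> T (act (mode F a r) v)) -> forall v, T v.
Proof.
move=> Ts Tv Ta; apply: ind_generated => // [[[a r]|] v Tv'|m].
- exact: Ta.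
- by rewrite level_hat -[_ *: _]addr0; apply: (proj2 Ts) => //; apply: (proj1 Ts).
- have -> : m = m *: (1 : F^o) + 0 by rewrite addr0 /GRing.scale /= mulr1.
  rewrite ind_in_linear; apply: (proj2 Ts) => //.
  rewrite (lin0 (ind_in_linear _)); exact: (proj1 Ts).
Qed.

Section Module.
Variable W : smod (agl11 F).
Hypotheses (Wk : level W) (Ws : smooth W).
Local Notation field := (int -> W -> W).

Definition cur (a : gl11_basis) : field := fun n w => act (mode F a n) w.

Lemma actZ (b : agl11 F) c (w : W) : act b (c *: w) = c *: act b w.
Proof. exact: linZ (@act_linear _ _ _ _) _ _. Qed.
Lemma act0 (b : agl11 F) : act b (0 : W) = 0.
Proof. exact: lin0 (@act_linear _ _ _ _). Qed.

Lemma cur_isfield a : isfield (cur a).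
Proof. by split=> [n|w]; [exact: act_linear|exact: Ws]. Qed.

Lemma cur_hpar a : hpar (gl11_par a) (cur a).
Proof. by move=> n w; apply: act_par. Qed.

Lemma fprodZ p c (U G : field) l n w : isfield U -> isfield G ->
  fprod p (fun n w => c *: U n w) l G n w = c *: fprod p U l G n w.
Proof.
move=> hU hG; rewrite /fprod -fsZ; last by apply: efinZ; apply: fprod_efin.
apply: fs_eq => j; rewrite linGZ; last exact: cpar_isfield.
by move: (U _ _) (cpar _ _ _ _) => x y; lmod F.
Qed.

(** The operator product of two currents: the bracket at the simple pole and the invariant form,
    times the level, at the double pole. *)
Definition cur_br a b (s : nat) : field := fun n w =>
  match s with
  | 0 => \sum_(p <- gl11_br F a b) p.1 *: cur p.2 n w
  | 1 => (k * kappa F a b) *: idf n w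
  | _ => 0
  end.

Lemma cur_comm a b : gcomm (gl11_par a) (cur a) (cur b) (cur_br a b) 2.
Proof.
move=> m n w; rewrite (cpar_hpar _ _ _ (cur_hpar b)).
rewrite [LHS](@act_br F (agl11 F) W (mode F a m) (mode F b n) w) /= big_cat big_map /=.
rewrite big_ord_recl big_ord1 /= (binz0 F) scale1r subr0; congr (_ + _).
have -> : binz m 1 = m%:~R by rewrite /Defs.binz big_ord1 subr0 divr1.
rewrite /idf (_ : (_ == -1) = (m + n == 0)); last by rewrite /bump /=; apply/eqP/eqP; lia.
case: eqP => _ /=; last by rewrite !scaler0 big_nil.
case: eqP => [->|_]; first by rewrite /= big_nil mulr0 scale0r scaler0.
by rewrite big_seq1 Wk /= !scalerA; congr (_ *: _); ring.
Qed.
End Module.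
End Currents.

(** * Vertex structures on smooth modules *)

Section FieldMap.
Variables (F : fieldType) (k : F).
Hypothesis F0 : forall n, (n%:R == 0 :> F) = (n == 0)%N.
Local Notation binz := (@binz F).
Local Notation Vk := (Vk k).
Local Notation vac := (vacuum k).
Variable W : smod (agl11 F).
Hypotheses (Wk : level k W) (Ws : smooth W).
Local Notation field := (int -> W -> W).
Local Notation cur := (@cur F W).

Lemma cur_br_isfield a b s : isfield (cur_br k a b s : field).
Proof.
split=> [n c u v|w].
  case: s => [|[|s]] /=; last by rewrite scaler0 addr0.
    rewrite scaler_sumr -big_split /=; apply: eq_bigr => p _.
    by rewrite (proj1 (cur_isfield Ws p.2)) scalerDr scalerCA.
  by rewrite (proj1 (idf_isfield W)) scalerDr scalerCA.
case: s => [|[|s]] /=; last by exists 0.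
  elim: (gl11_br F a b) => [|p r [N IH]]; first by exists 0 => n _; rewrite big_nil.
  have [M hM] := proj2 (cur_isfield Ws p.2) w.
  exists (Num.max N M) => n; rewrite ge_max => /andP[Nn Mn].
  by rewrite big_cons IH // hM // scaler0 addr0.
have [N hN] := proj2 (idf_isfield W) w.
by exists N => n Nn; rewrite hN // scaler0.
Qed.

Lemma fprod_cur_br0 a b l (G : field) n w : isfield G ->
  fprod (gl11_par a (+) gl11_par b) (cur_br k a b 0) l G n w =
  \sum_(p <- gl11_br F a b) p.1 *: fprod (gl11_par p.2) (cur p.2) l G n w.
Proof.
move=> hG.
have Z p c x (U : field) : isfield U -> (forall n w, x n w = c *: U n w) ->
    fprod p x l G n w = c *: fprod p U l G n w.
  by move=> hU xE; rewrite -fprodZ //; congr fprod; apply/funext => ?; apply/funext => ?.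
have N p (U : field) : (forall n w, U n w = 0) -> fprod p U l G n w = 0.
  move=> U0; rewrite (Z _ 0 U (@idf F W)) ?scale0r //; first exact: idf_isfield.
  by move=> ? ?; rewrite U0 scale0r.
case: a; case: b; rewrite /= ?big_nil ?big_seq1 /=;
  first [ by apply: N => ? ?; rewrite /= big_nil
        | by apply: Z => [|? ?]; [exact: cur_isfield|rewrite /= big_seq1] ].
Qed.

Lemma fprod_cur_br1 a b l (G : field) n w : isfield G ->
  fprod (gl11_par a (+) gl11_par b) (cur_br k a b 1) l G n w =
  (k * kappa F a b) *: if l == -1 then G n w else 0.
Proof.
move=> hG; have hi := idf_isfield W.
rewrite [LHS](fprodZ _ _ _ _ _ hi hG) -(fprod_id F0) //.
by case: a; case: b; rewrite //= !mulr0 !scale0r.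
Qed.

Definition fop (x : agl11 F) (G : field) : field :=
  match x with
  | Some (a, r) => fprod (gl11_par a) (cur a) r G
  | None => fun n w => k *: G n w
  end.

Lemma isfield_subspace : subspace (@isfield F W : field -> Prop).
Proof.
split=> [|c G H [lG tG] [lH tH]].
  by split=> [n c u v|w]; [rewrite /= scaler0 addr0|exists 0].
split=> [n d u v|w].
  rewrite -[LHS]/(c *: G n (d *: u + v) + H n (d *: u + v)).
  rewrite -[RHS]/(d *: (c *: G n u + H n u) + (c *: G n v + H n v)).
  rewrite lG lH; lmod F.
have [N GN] := tG w; have [M HM] := tH w.
exists (Num.max N M) => n; rewrite ge_max => /andP[Nn Mn].
by rewrite -[LHS]/(c *: G n w + H n w) GN // HM // scaler0 addr0.
Qed.

Lemma fprod_linear p (U : field) l c (G H : field) : isfield U -> isfield G -> isfield H ->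
  fprod p U l (c *: G + H) = c *: fprod p U l G + fprod p U l H.
Proof.
move=> hU hG hH; apply/funext => n; apply/funext => w.
rewrite -[RHS]/(c *: fprod p U l G n w + fprod p U l H n w) /fprod.
have fG := fprod_efin p l n w hU hG; have fH := fprod_efin p l n w hU hH.
rewrite -fsZ; last exact: efinZ.
rewrite -fsD; [|by apply: efinZc; apply: efinZ|exact: efinZ].
apply: fs_eq => j.
have -> : cpar p (c *: G + H) (n + l - j%:Z) (U j%:Z w)
    = c *: cpar p G (n + l - j%:Z) (U j%:Z w) + cpar p H (n + l - j%:Z) (U j%:Z w).
  by case: (p) => //; rewrite /cpar -[X in par X]/(c *: G _ _ + H _ _) parD parZ.
rewrite -[X in U _ X]/(c *: G _ w + H _ w) (proj1 hU); lmod F.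
Qed.

(** For two currents the sum in [fprod_comm] has the terms [s = 0] and [s = 1] only, and these are
    the two terms of the affine bracket. Thus the fields form a module of level [k]. *)
Lemma fop_br a b (G : field) : isfield G ->
  fop a (fop b G) - sgn F (lpar a && lpar b) *: fop b (fop a G) =
  \sum_(p <- lbr a b) p.1 *: fop p.2 G.
Proof.
move=> hG; apply/funext => n; apply/funext => w.
rewrite -[LHS]/(fop a (fop b G) n w - sgn F (lpar a && lpar b) *: fop b (fop a G) n w).
have sumE (r : seq (F * agl11 F)) : (\sum_(p <- r) p.1 *: fop p.2 G) n w
    = \sum_(p <- r) p.1 *: fop p.2 G n w.
  by elim: r => [|p r IH]; rewrite ?big_nil // !big_cons -IH.
have kZ a' r : fop (Some (a', r)) (fun n w => k *: G n w) n w = k *: fop (Some (a', r)) G n w.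
  have := fprod_linear (gl11_par a') r k (cur_isfield Ws a') hG (proj1 isfield_subspace).
  rewrite !addr0 => /(congr1 (fun f => f n w)) /= => E.
  have Z : fprod (gl11_par a') (cur a') r 0 = 0.
    apply/funext => n'; apply/funext => w'; apply: fprod0 => //; exact: cur_isfield.
  by move: E; rewrite Z addr0.
rewrite sumE; case: a => [[a r]|]; last first.
  rewrite [lbr _ _]/= big_nil scale1r; case: b => [[b s]|] /=; last by rewrite subrr.
  by rewrite -[X in _ - X]/(fop (Some (b, s)) (fun n w => k *: G n w) n w) kZ subrr.
case: b => [[b s]|]; last first.
  rewrite [lbr _ _]/= big_nil andbF scale1r.
  by rewrite kZ /= subrr.
rewrite [LHS](fprod_comm F0 _ _ _ _ (cur_hpar a) (cur_hpar b) (cur_isfield Ws a)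
  (cur_isfield Ws b) hG (cur_br_isfield a b) (cur_comm Wk a b)).
rewrite big_ord_recl big_ord1 [nat_of_ord _]/= [nat_of_ord _]/= (binz0 F) scale1r subr0.
rewrite fprod_cur_br0 // fprod_cur_br1 // [lbr _ _]/= big_cat big_map; congr (_ + _).
have -> : binz r 1 = r%:~R by rewrite /Defs.binz big_ord1 subr0 divr1.
rewrite (_ : (_ == -1) = (r + s == 0)); last by rewrite /= ?/bump /=; apply/eqP/eqP; lia.
case: eqP => _ /=; last by rewrite !scaler0 big_nil.
case: eqP => [->|_]; first by rewrite /= big_nil mulr0 scale0r scaler0.
by rewrite big_seq1 /= !scalerA; congr (_ *: _); ring.
Qed.

(** The identity field is killed by the nonnegative modes ([fprod_idr_ge0]), so it is a vacuum
    vector in the module of fields, and [ind_lift] applies. *)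
Lemma field_map_exists : exists phi : Vk -> field,
  [/\ linear phi, forall v, isfield (phi v),
      forall a r v, phi (act (mode F a r) v) = fprod (gl11_par a) (cur a) r (phi v),
      phi vac = @idf F W & forall v, phi (par v) = cpar true (phi v)].
Proof.
have hi := idf_isfield W.
pose f (c : even_line F) : field := fun n w => (c : F) *: idf n w.
have fidE c : f c = (c : F) *: (@idf F W : field) by [].
have f_lin : linear f.
  move=> c x y; apply/funext => n; apply/funext => w.
  by rewrite /f -[RHS]/(c *: ((x : F) *: idf n w) + (y : F) *: idf n w) scalerDl scalerA.
have fopi b r : 0 <= r -> fop (Some (b, r)) (@idf F W) = 0.
  move=> r0; apply/funext => n; apply/funext => w; rewrite /fop -(gez0_abs r0).
  by rewrite fprod_idr_ge0 //; apply: cur_isfield.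
have fop_lin b c x y : isfield x -> isfield y ->
    fop b (c *: x + y) = c *: fop b x + fop b y.
  case: b => [[b r]|] hx hy; first exact: fprod_linear (cur_isfield Ws b) hx hy.
  apply/funext => n; apply/funext => w.
  rewrite -[LHS]/(k *: (c *: x n w + y n w)) -[RHS]/(c *: (k *: x n w) + k *: y n w).
  lmod F.
have [|||||||phi [phiL phiF phiA phiI]] :=
  @ind_lift F (agl11 F) (@agl11_nonneg F) (A_mod (0 : F)) (hat_char k (M := A_mod 0))
    (@hat_char_par F k (A_mod 0)) [the lmodType F of field] (@isfield F W) fop f.
- exact: isfield_subspace.
- move=> [[b r]|] x hx; first exact: fprod_isfield (cur_isfield Ws b) hx.
  by have := proj2 isfield_subspace k x 0 hx (proj1 isfield_subspace); rewrite addr0.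
- exact: fop_lin.
- exact: fop_br.
- exact: f_lin.
- move=> c; rewrite fidE; have := proj2 isfield_subspace c _ 0 hi (proj1 isfield_subspace).
  by rewrite addr0.
- move=> b m; case: b => [[b r]|] r0; last first.
    by apply/funext => n; apply/funext => w; rewrite /f /= /f -scalerA.
  have -> : hat_char k (Some (b, r) : agl11 F) m = 0 :> A_mod (0 : F).
    by rewrite /hat_char; case: ifP => // _; case: b {r0} => //=; rewrite scale0r.
  have := fop_lin (Some (b, r)) m (@idf F W) 0 hi (proj1 isfield_subspace).
  rewrite addr0 -fidE => ->; rewrite fopi // scaler0 add0r [RHS](lin0 f_lin).
  by apply/funext => n; apply/funext => w; apply: fprod0 => //; apply: cur_isfield.
have phiv : phi vac = @idf F W.
  by rewrite /vacuum /hat_in phiI; apply/funext => n; apply/funext => w; rewrite /f scale1r.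
exists phi; split=> //.
apply: (Vk_ind (T := fun v => phi (par v) = cpar true (phi v))).
- split=> [|c u v hu hv]; first by rewrite par0 (lin0 phiL); apply/funext => n; apply/funext => w; rewrite /cpar [RHS]par0.
  rewrite parD parZ !phiL hu hv; apply/funext => n; apply/funext => w.
  by rewrite -[LHS]/(c *: par _ + par _) /cpar -parZ -parD.
- rewrite vac_par phiv; apply/funext => n; apply/funext => w.
  by rewrite /cpar /idf; case: ifP; rewrite ?parK ?par0.
- move=> a r v IH; rewrite act_par (linZ phiL) !phiA IH.
  apply/funext => n; apply/funext => w.
  rewrite cpar_fprod ?andbT //; [exact: cur_hpar|exact: cur_isfield].
Qed.
End FieldMap.

(** * Consequences of the Jacobi identity *)

Section ModuleFields.
Variables (F : fieldType) (V W : superspace F) (vac : V) (YV : V -> int -> V -> V).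
Variable (Y : V -> int -> W -> W).
Hypothesis F0 : forall n, (n%:R == 0 :> F) = (n == 0)%N.
Hypothesis hV : field_axioms vac YV YV.
Hypothesis hY : field_axioms vac YV Y.
Local Notation binz := (@binz F).
Local Notation sgn := (sgn F).

Lemma two_neq0 : 2%:R != 0 :> F. Proof. by rewrite F0. Qed.

Lemma homog_split (v : V) : exists v0 v1, [/\ v = v0 + v1, homog false v0 & homog true v1].
Proof.
exists (2%:R^-1 *: (v + par v)), (2%:R^-1 *: (v - par v)); split.
- by lmod_core F; field; exact: two_neq0.
- by rewrite /homog parZ parD parK scale1r [par v + v]addrC.
- by rewrite /homog parZ parB parK /Defs.sgn expr1 scaleN1r -scalerN opprB.
Qed.

Lemma homog_ind (T : V -> Prop) : (forall u v, T u -> T v -> T (u + v)) ->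
  (forall p v, homog p v -> T v) -> forall v, T v.
Proof.
by move=> TD Th v; have [v0 [v1 [-> h0 h1]]] := homog_split v; apply: TD; apply: Th; eassumption.
Qed.

Lemma Y_isfield v : isfield (Y v).
Proof. by split=> [n|w]; [exact: (Y_linear_r hY)|exact: (Y_trunc hY)]. Qed.

Lemma Y0 n w : Y 0 n w = 0.
Proof. exact: lin0 (Y_linear_l hY n w). Qed.

Lemma Y_cpar v : cpar true (Y v) = Y (par v).
Proof. by apply/funext => n; apply/funext => w; rewrite /cpar (Y_par hY) parK. Qed.

Lemma Y_hpar p v : homog p v -> hpar p (Y v).
Proof. by move=> hv n w; rewrite (Y_par hY) hv (linZ (Y_linear_l hY n _)). Qed.

Lemma V_nat u v l : exists N, forall j : nat, (N <= j)%N -> YV u (l + j%:Z) v = 0.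
Proof.
have [N hN] := Y_trunc hV u v; exists `|N - l|%N => j Nj; apply: hN; lia.
Qed.

Lemma homog_Y p q u v n : homog p u -> homog q v -> homog (p (+) q) (YV u n v).
Proof.
move=> hu hv; rewrite /homog (Y_par hV) hu hv (linZ (Y_linear_l hV n _)).
by rewrite (linZ (Y_linear_r hV u n)) scalerA sgnM.
Qed.

(** With [cpar] in place of the sign the identity becomes linear in [v], and so it passes from
    homogeneous vectors to sums of an even and an odd one. *)
Lemma Y_jac p u v l m n w : homog p u ->
  fs (fun j : nat => binz m j *: Y (YV u (l + j%:Z) v) (m + n - j%:Z) w) =
  fs (fun j : nat => ((-1) ^+ j * binz l j) *:
    (Y u (m + l - j%:Z) (Y v (n + j%:Z) w)
     - (-1) ^ l *: cpar p (Y v) (n + l - j%:Z) (Y u (m + j%:Z) w))).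
Proof.
move=> hu.
have LF (v' : V) : efin (fun j : nat => binz m j *: Y (YV u (l + j%:Z) v') (m + n - j%:Z) w).
  have [N hN] := V_nat u v' l; exists N => j Nj; by rewrite hN // Y0 scaler0.
have RF v' := pjac_efin p l m n w (Y_isfield u) (Y_isfield v').
apply: (homog_ind (T := fun v => fs (fun j : nat => binz m j *: Y (YV u (l + j%:Z) v) (m + n - j%:Z) w) =
  fs (fun j : nat => ((-1) ^+ j * binz l j) *:
    (Y u (m + l - j%:Z) (Y v (n + j%:Z) w)
     - (-1) ^ l *: cpar p (Y v) (n + l - j%:Z) (Y u (m + j%:Z) w))))) => [v1 v2 h1 h2|q {}v hv].
  transitivity (fs (fun j : nat => binz m j *: Y (YV u (l + j%:Z) v1) (m + n - j%:Z) w
      + binz m j *: Y (YV u (l + j%:Z) v2) (m + n - j%:Z) w)).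
    apply: fs_eq => j; rewrite -scalerDr -(linD (Y_linear_l hY _ w)).
    by rewrite -(linD (Y_linear_r hV u _)).
  rewrite fsD // h1 h2 -fsD //; apply: fs_eq => j.
  have -> : cpar p (Y (v1 + v2)) (n + l - j%:Z) (Y u (m + j%:Z) w) =
      cpar p (Y v1) (n + l - j%:Z) (Y u (m + j%:Z) w) + cpar p (Y v2) (n + l - j%:Z) (Y u (m + j%:Z) w).
    by case: (p); rewrite ?Y_cpar ?parD -(linD (Y_linear_l hY _ _)).
  rewrite (linD (Y_linear_l hY (n + j%:Z) w)) (linD (Y_linear_r hY u _)).
  lmod F.
have [N0 hJ] := Y_jacobi hY w l m n hu hv.
have [N1 h1] := LF v; have [N2 h2] := RF v.
pose N := maxn N0 (maxn N1 N2).
rewrite (@fsE _ _ N) => [|j Nj]; last by apply: h1; rewrite (leq_trans _ Nj) // !leq_max leqnn orbT.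
rewrite (@fsE _ _ N) => [|j Nj]; last by apply: h2; rewrite (leq_trans _ Nj) // !leq_max leqnn !orbT.
rewrite hJ ?leq_max ?leqnn //; apply: eq_bigr => j _.
by rewrite (cpar_hpar _ _ _ (Y_hpar hv)) scalerA.
Qed.

Lemma Y_prod p u v l : homog p u -> Y (YV u l v) = fprod p (Y u) l (Y v).
Proof.
move=> hu; apply/funext => n; apply/funext => w.
have := Y_jac v l 0 n w hu; rewrite (@fs1 _ _ 0%N) => [|[|j] // _]; last first.
  by rewrite binz0S ?scale0r.
rewrite (binz0 F) scale1r addr0 add0r subr0 => ->.
by apply: fs_eq => j; rewrite !add0r.
Qed.

Lemma Y_comm p u v m n w : homog p u ->
  Y u m (Y v n w) - cpar p (Y v) n (Y u m w) =
  fs (fun j : nat => binz m j *: Y (YV u j%:Z v) (m + n - j%:Z) w).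
Proof.
move=> hu; transitivity (fs (fun j : nat => ((-1) ^+ j * binz 0 j) *:
    (Y u (m + 0 - j%:Z) (Y v (n + j%:Z) w)
     - (-1) ^ 0 *: cpar p (Y v) (n + 0 - j%:Z) (Y u (m + j%:Z) w)))).
  rewrite (@fs1 _ _ 0%N) => [|[|j] // _]; last first.
    by rewrite (binz0S F0) ?mulr0 scale0r.
  by rewrite (binz0 F) mulr1 scale1r expr0z scale1r !subr0 ?addr0.
by rewrite -Y_jac //; apply: fs_eq => j; rewrite add0r.
Qed.

End ModuleFields.

(** * Derivatives of products *)

Section Derivative.
Variables (F : fieldType) (W : superspace F).
Hypothesis F0 : forall n, (n%:R == 0 :> F) = (n == 0)%N.
Local Notation binz := (@binz F).
Local Notation field := (int -> W -> W).

Lemma ffz1S l i : ffz F l i.+1 = l%:~R * ffz F (l - 1) i.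
Proof. by rewrite -add1n ffzD /ffz big_ord1 subr0. Qed.

Lemma binz_mulS l i : i.+1%:R * binz l i.+1 = l%:~R * binz (l - 1) i.
Proof.
apply: (mulIf (fact_neq0 F0 i)); transitivity (ffz F l i.+1).
  by rewrite -(binzE F0) factS natrM; ring.
by rewrite ffz1S -(binzE F0); ring.
Qed.

Lemma binz_subM l j : (l%:~R - j%:R) * binz l j = l%:~R * binz (l - 1) j.
Proof.
apply: (mulIf (fact_neq0 F0 j)); transitivity (ffz F l j.+1).
  by rewrite ffzSr -(binzE F0); ring.
by rewrite ffz1S -(binzE F0); ring.
Qed.

(** The derivative of [G] has modes [- n G_(n-1)]. This is the Leibniz rule for the [l]-th product,
    where the product of the derivative of [U] with [G] is already written as [- l] times the
    [(l-1)]-th product. *)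
Lemma fprod_deriv p (U G : field) l n w : isfield U -> isfield G ->
  - n%:~R *: fprod p U l G (n - 1) w =
  fprod p U l (fun n w => - n%:~R *: G (n - 1) w) n w - l%:~R *: fprod p U (l - 1) G n w.
Proof.
move=> hU hG; have hGp := cpar_isfield p hG.
pose f1 (j : nat) := U (l - j%:Z) (G (n - 1 + j%:Z) w).
pose f2 (j : nat) := cpar p G (n - 1 + l - j%:Z) (U j%:Z w).
have f1fin (c : nat -> F) : efin (fun j => c j *: f1 j).
  by apply: efinZ; exact: (efinUG (fun j => l - j%:Z) (n - 1) w hU hG).
have f2fin (c : nat -> F) : efin (fun j => c j *: f2 j).
  by apply: efinZ; exact: (efinGU p (fun j => n - 1 + l - j%:Z) w hU hG).
have -> : fprod p U l G (n - 1) w =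
   fs (fun j => ((-1) ^+ j * binz l j) *: f1 j) -
   fs (fun j => ((-1) ^+ j * binz l j * (-1) ^ l) *: f2 j).
  by rewrite -fsB //; apply: fs_eq => j; rewrite scalerBr scalerA.
have -> : fprod p U l (fun n w => - n%:~R *: G (n - 1) w) n w =
   fs (fun j => ((-1) ^+ j * binz l j * (- n%:~R - j%:R)) *: f1 j) -
   fs (fun j => ((-1) ^+ j * binz l j * (-1) ^ l * (- n%:~R - l%:~R + j%:R)) *: f2 j).
  rewrite -fsB //; apply: fs_eq => j.
  have -> : cpar p (fun n w => - n%:~R *: G (n - 1) w) (n + l - j%:Z) (U j%:Z w)
     = (- n%:~R - l%:~R + j%:R) *: f2 j.
    rewrite /f2 (_ : n - 1 + l - j%:Z = n + l - j%:Z - 1); last by lia.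
    have -> : - n%:~R - l%:~R + j%:R = - (n + l - j%:Z)%:~R :> F.
      by rewrite rmorphB rmorphD /= -pmulrn; ring.
    by rewrite /cpar; case: (p); rewrite ?parZ.
  rewrite linGZ // (_ : n + j%:Z - 1 = n - 1 + j%:Z); last by lia.
  rewrite -/(f1 j) rmorphD /= -pmulrn; move: (f1 j) (f2 j) => x y; lmod F.
have -> : fprod p U (l - 1) G n w =
   - fs (fun j => ((-1) ^+ j.+1 * binz (l - 1) j) *: f1 j.+1) +
   fs (fun j => ((-1) ^+ j * binz (l - 1) j * (-1) ^ l) *: f2 j).
  have f1Sfin (c : nat -> F) : efin (fun j => c j *: f1 j.+1).
    have [N fN] := f1fin (fun=> 1); exists N => j Nj.
    by have := fN j.+1 (leqW Nj); rewrite scale1r => ->; rewrite scaler0.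
  rewrite -fsN // -fsD //; last by apply: efinN.
  apply: fs_eq => j; rewrite /f1 /f2.
  rewrite (_ : l - j.+1%:Z = l - 1 - j%:Z); last by lia.
  rewrite (_ : n - 1 + j.+1%:Z = n + j%:Z); last by lia.
  rewrite (_ : n - 1 + l - j%:Z = n + (l - 1) - j%:Z); last by lia.
  rewrite exprS expfzDr ?oppr_eq0 ?oner_eq0 // exprN1 invrN1.
  by move: (U _ _) (cpar _ _ _ _) => x y; lmod F.
have f1S : fs (fun j => ((-1) ^+ j * binz l j * j%:R) *: f1 j) =
    l%:~R *: fs (fun j => ((-1) ^+ j.+1 * binz (l - 1) j) *: f1 j.+1).
  rewrite fsS // mulr0 scale0r add0r -fsZ; last first.
    have [N fN] := f1fin (fun=> 1); exists N => j Nj.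
    by have := fN j.+1 (leqW Nj); rewrite scale1r => ->; rewrite scaler0.
  apply: fs_eq => j; rewrite scalerA; congr (_ *: _).
  by rewrite -mulrA [binz _ _ * _]mulrC binz_mulS; ring.
have f2S : fs (fun j => ((-1) ^+ j * binz l j * (-1) ^ l * (l%:~R - j%:R)) *: f2 j) =
    l%:~R *: fs (fun j => ((-1) ^+ j * binz (l - 1) j * (-1) ^ l) *: f2 j).
  rewrite -fsZ //; apply: fs_eq => j; rewrite scalerA; congr (_ *: _).
  transitivity ((-1) ^+ j * (-1) ^ l * ((l%:~R - j%:R) * binz l j)); first by ring.
  by rewrite binz_subM; ring.
have D1 : fs (fun j => ((-1) ^+ j * binz l j * (- n%:~R - j%:R)) *: f1 j) =
    - n%:~R *: fs (fun j => ((-1) ^+ j * binz l j) *: f1 j)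
    - fs (fun j => ((-1) ^+ j * binz l j * j%:R) *: f1 j).
  by rewrite -fsZ // -fsB //; [apply: fs_eq => j; lmod F|exact: efinZc].
have D2 : fs (fun j => ((-1) ^+ j * binz l j * (-1) ^ l * (- n%:~R - l%:~R + j%:R)) *: f2 j) =
    - n%:~R *: fs (fun j => ((-1) ^+ j * binz l j * (-1) ^ l) *: f2 j)
    - fs (fun j => ((-1) ^+ j * binz l j * (-1) ^ l * (l%:~R - j%:R)) *: f2 j).
  by rewrite -fsZ // -fsB //; [apply: fs_eq => j; lmod F|exact: efinZc].
rewrite D1 D2 f1S f2S; move: (fs _) (fs _) (fs _) (fs _) => *; lmod F.
Qed.

(** The right-hand side is the mode [n] of the [s]-th divided derivative of [U]. Induction on [s] by
    the Leibniz rule, the identity field having derivative zero. *)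
Lemma fprod_idrN p (U : field) s n w : isfield U ->
  fprod p U (- s.+1%:Z) (@idf F W) n w = ((-1) ^+ s * binz n s) *: U (n - s%:Z) w.
Proof.
move=> hU; elim: s n => [|s IH] n.
  by rewrite (_ : - 1%N%:Z = -1) // fprod_idr // (binz0 F) mulr1 scale1r subr0.
have := fprod_deriv p (- s.+1%:Z) n w hU (idf_isfield W).
have -> : (fun n w => - n%:~R *: @idf F W (n - 1) w) = (fun _ _ => 0).
  apply/funext => m; apply/funext => y; rewrite /idf; case: eqP => [m0|_]; last by rewrite scaler0.
  by rewrite (_ : m = 0) ?oppr0 ?scale0r //; lia.
rewrite [fprod _ _ _ (fun _ _ => 0) _ _](fprod0 _ _ _ _ hU) // sub0r IH.
rewrite (_ : - s.+1%:Z - 1 = - s.+2%:Z); last by lia.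
rewrite (_ : n - 1 - s%:Z = n - s.+1%:Z); last by lia.
move: (fprod _ _ _ _ _ _) (U _ _) => x y E.
have s0 : s.+1%:R != 0 :> F by rewrite F0.
apply: (scalerI s0); have -> : s.+1%:R *: x = - n%:~R *: (((-1) ^+ s * binz (n - 1) s) *: y).
  by rewrite E -scaleNr rmorphN opprK.
rewrite !scalerA; congr (_ *: _).
transitivity ((-1) ^+ s.+1 * (n%:~R * binz (n - 1) s)); first by rewrite exprS; ring.
by rewrite -binz_mulS; ring.
Qed.
End Derivative.

#[local] Opaque Vk hat ind_mod.

(** * The conformal vector *)

Section Conformal.
Variables (F : fieldType) (k : F).
Hypothesis F0 : forall n, (n%:R == 0 :> F) = (n == 0)%N.
Hypothesis k0 : k != 0.
Local Notation binz := (@binz F).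
Local Notation sgn := (sgn F).
Local Notation Vk := (Vk k).
Local Notation vac := (vacuum k).
Local Notation gen := (gen k).
Variables (Y : Vk -> int -> Vk -> Vk) (hY : affine_vsa Y).

Lemma affine_field : field_axioms vac Y Y. Proof. exact: vsa_field (proj1 hY). Qed.
Local Notation hV := affine_field.

Lemma genE a n v : Y (gen a) n v = act (mode F a n) v. Proof. exact: (proj2 hY). Qed.

Lemma gen_homog a : homog (gl11_par a) (gen a).
Proof. by rewrite /homog act_par vac_par. Qed.

Lemma creation v : Y v (-1) vac = v. Proof. exact: (proj1 (vsa_creation (proj1 hY) v)). Qed.
Lemma creation_ge0 v (j : nat) : Y v j%:Z vac = 0.
Proof. exact: (proj2 (vsa_creation (proj1 hY) v) j). Qed.

Lemma level_Vk : level k Vk. Proof. exact: level_hat. Qed.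
Lemma smooth_Vk : smooth Vk.
Proof.
move=> a v; have [N hN] := Y_trunc hV (gen a) v.
by exists N => r Nr; rewrite -genE hN.
Qed.

Section NormalOrder.
Variables (W : superspace F) (YW : Vk -> int -> W -> W).
Hypothesis hW : field_axioms vac Y YW.

(** The mode [n] of the normally ordered product of the currents [a] and [b], that is, of their
    [(-1)]-th product. *)
Definition nop a b n (w : W) : W := fs (fun j : nat =>
  YW (gen a) (- 1 - j%:Z) (YW (gen b) (n + j%:Z) w)
  + sgn (gl11_par a && gl11_par b) *: YW (gen b) (n - 1 - j%:Z) (YW (gen a) j%:Z w)).

Lemma Y_act a r v : YW (act (mode F a r) v) = fprod (gl11_par a) (YW (gen a)) r (YW v).
Proof. by rewrite -genE (Y_prod F0 hV hW _ _ (gen_homog a)). Qed.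

Lemma Y_nop a b n w : YW (act (mode F a (-1)) (gen b)) n w = nop a b n w.
Proof.
rewrite Y_act; apply: fs_eq => j.
rewrite (binzN1 F0) scale1r (cpar_hpar _ _ _ (Y_hpar hW (gen_homog b))).
by rewrite exprN1 invrN1 scaleN1r opprK addrAC -addrA.
Qed.

Lemma Y_omega n w : YW (omega k) n w =
  (2%:R * k)^-1 *: (nop gN gE n w + nop gE gN n w - nop gpsip gpsim n w + nop gpsim gpsip n w)
  + (2%:R * k ^+ 2)^-1 *: nop gE gE n w.
Proof.
have lY := Y_linear_l hW n w.
by rewrite /omega lY (linZ lY) (linD lY) (linB lY) (linD lY) !Y_nop.
Qed.
End NormalOrder.

Lemma act_gen y a (j : nat) : act (mode F y j%:Z) (gen a) = cur_br k y a j (-1) vac.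
Proof.
have := cur_comm level_Vk y a j%:Z (-1) vac.
have -> : cur y j vac = 0 by apply: vac_act.
rewrite linG0; last by apply: cpar_isfield; exact: (cur_isfield smooth_Vk).
rewrite subr0 big_ord_recl big_ord1 /= (binz0 F) scale1r subr0 => E.
rewrite -[LHS]/(@cur F Vk y j (@cur F Vk a (-1) vac)) E {E}.
case: j => [|[|j]].
- by rewrite add0r [X in _ + X](_ : _ = 0) ?addr0 // /idf scaler0 scaler0.
- have -> : binz 1 1 = 1 by rewrite (binz_nat F0).
  rewrite scale1r big1_seq ?add0r // => p _.
  by rewrite /cur vac_act ?scaler0.
- rewrite big1_seq ?add0r => [|p _]; last by rewrite /cur vac_act ?scaler0 //; lia.
  by rewrite /idf (_ : (_ == -1) = false) ?scaler0 //; rewrite /bump /=; apply/eqP; lia.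
Qed.

Lemma act_gen0 y a : act (mode F y 0) (gen a) = \sum_(p <- gl11_br F y a) p.1 *: gen p.2.
Proof. exact: (act_gen y a 0%N). Qed.

Lemma act_gen1 y a : act (mode F y 1) (gen a) = (k * kappa F y a) *: vac.
Proof. exact: (act_gen y a 1%N). Qed.

Lemma act_gen2 y a (j : nat) : act (mode F y j.+2%:Z) (gen a) = 0.
Proof. exact: (act_gen y a j.+2). Qed.

Lemma nop_gen0 x y a : nop Y x y 0 (gen a) =
  act (mode F x (-1)) (act (mode F y 0) (gen a)) + act (mode F x (-2)) (act (mode F y 1) (gen a))
  + sgn (gl11_par x && gl11_par y) *:
    (act (mode F y (-1)) (act (mode F x 0) (gen a)) + act (mode F y (-2)) (act (mode F x 1) (gen a))).
Proof.
rewrite /nop (@fsE _ _ 2) => [|[|[|j]] // _]; last first.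
  by rewrite !genE add0r !act_gen2 !act0 scaler0 addr0.
by rewrite big_ord_recl big_ord1 !genE scalerDr [RHS]addrACA.
Qed.

Lemma nop_gen1 x y a : nop Y x y 1 (gen a) =
  act (mode F x (-1)) (act (mode F y 1) (gen a))
  + sgn (gl11_par x && gl11_par y) *:
    (act (mode F y 0) (act (mode F x 0) (gen a)) + act (mode F y (-1)) (act (mode F x 1) (gen a))).
Proof.
rewrite /nop (@fsE _ _ 2) => [|[|[|j]] // _]; last first.
  rewrite !genE act_gen2 (_ : 1 + j.+2%:Z = j.+3%:Z); last by lia.
  by rewrite act_gen2 !act0 scaler0 addr0.
rewrite big_ord_recl big_ord1 !genE [act (mode F y (1 + _)) _ in X in _ + X](act_gen2 y a 0) act0.
by rewrite scalerDr -addrA; congr (_ + (_ + _)); apply: add0r.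
Qed.

Lemma comm_vac x y : act (mode F x (-1)) (gen y) =
  sgn (gl11_par x && gl11_par y) *: act (mode F y (-1)) (gen x)
  + \sum_(p <- gl11_br F x y) p.1 *: act (mode F p.2 (-2)) vac.
Proof.
have /eqP := @act_br F (agl11 F) Vk (mode F x (-1)) (mode F y (-1)) vac.
rewrite subr_eq addrC => /eqP ->; congr (_ + _).
by rewrite /= big_cat big_map /= big_nil addr0.
Qed.

(** A direct computation with the normally ordered products. It yields the commutators of [L_{-1}]
    with the currents, as [omega1_gen] does for [L_0]. *)
Lemma omega0_gen a : Y (omega k) 0 (gen a) = act (mode F a (-2)) vac.
Proof.
have two := two_neq0 F0; have k20 : k ^+ 2 != 0 by rewrite expf_neq0.
rewrite (Y_omega hV) !nop_gen0 !act_gen0 !act_gen1.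
case: a; rewrite /gl11_br /kappa !(big_cons, big_nil) [gl11_par _ && gl11_par _]/= ?[gl11_par _ && _]/=
  /Defs.sgn ?expr0 ?expr1 /fst /snd ?addr0 ?act0 !actZ.
- rewrite (comm_vac gpsim gpsip) /gl11_br !(big_cons, big_nil) /Defs.sgn /fst /snd [gl11_par _ && _]/= expr1.
  by lmod_core F; field; rewrite ?k0 ?two.
- by lmod_core F; field; rewrite ?k0 ?two.
- rewrite (comm_vac gpsip gE) /gl11_br !(big_cons, big_nil) /Defs.sgn /fst /snd [gl11_par _ && _]/= expr0.
  by lmod_core F; field; rewrite ?k0 ?two.
- rewrite (comm_vac gpsim gE) /gl11_br !(big_cons, big_nil) /Defs.sgn /fst /snd [gl11_par _ && _]/= expr0.
  by lmod_core F; field; rewrite ?k0 ?two.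
Qed.

(** For [a = N] the quadratic part of [omega] leaves an extra term [- E / k], because the Casimir of
    gl(1|1) sends [N] to [-2 E] in the adjoint representation. The summand of [omega] in [E_{-1}^2]
    cancels it; this explains its coefficient. *)
Lemma omega1_gen a : Y (omega k) 1 (gen a) = gen a.
Proof.
have two := two_neq0 F0; have k20 : k ^+ 2 != 0 by rewrite expf_neq0.
rewrite (Y_omega hV) !nop_gen1 !act_gen0 !act_gen1.
by case: a; rewrite /gl11_br /kappa !(big_cons, big_nil) [gl11_par _ && gl11_par _]/= ?[gl11_par _ && _]/=
  /Defs.sgn ?expr0 ?expr1 /fst /snd ?addr0 ?act0 !actZ ?act_gen0 /gl11_br ?(big_cons, big_nil) /fst /snd /Defs.gen;
  lmod_core F; field; rewrite ?k0 ?two.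
Qed.
End Conformal.

(** * From the field map to a vertex structure *)

Section Existence.
Variables (F : fieldType) (k : F).
Hypothesis F0 : forall n, (n%:R == 0 :> F) = (n == 0)%N.
Hypothesis k0 : k != 0.
Local Notation binz := (@binz F).
Local Notation sgn := (sgn F).
Local Notation Vk := (Vk k).
Local Notation vac := (vacuum k).
Local Notation gen := (gen k).
Local Notation omega := (omega k).
Variables (Y : Vk -> int -> Vk -> Vk) (hY : affine_vsa Y).
Local Notation hV := (affine_field hY).

(** What is known of the constructed field map. By [fmap_Y] the vertex operation of [Vk] itself has
    these properties, so that the results below also apply inside [Vk]. *)
Record fmap (W : smod (agl11 F)) (phi : Vk -> int -> W -> W) : Prop := FMap {
  fm_lin : forall n w, linear (fun v => phi v n w);
  fm_field : forall v, isfield (phi v);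
  fm_act : forall a r v, phi (act (mode F a r) v) = fprod (gl11_par a) (@cur F W a) r (phi v);
  fm_vac : phi vac = @idf F W;
  fm_par : forall v, phi (par v) = cpar true (phi v) }.

Lemma omega_even : homog false omega.
Proof.
rewrite /homog scale1r /omega parD !parZ parD parB parD !act_par !vac_par /Defs.sgn /gl11_par.
by rewrite /= expr0 expr1 !scale1r !(linZ (act_linear _)) !scalerA mulrNN mulr1 !scale1r.
Qed.

Lemma fmap_Y : fmap Y.
Proof.
split.
- exact: (Y_linear_l hV).
- exact: (Y_isfield hV).
- move=> a r v; rewrite (Y_act F0 hY hV); congr fprod.
  by apply/funext => n; apply/funext => w; rewrite (genE hY).
- by apply/funext => n; apply/funext => w; rewrite (Y_vac hV).
- by move=> v; rewrite (Y_cpar hV).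
Qed.

Lemma omega0_act a r v :
  Y omega 0 (act (mode F a r) v) = act (mode F a r) (Y omega 0 v) - r%:~R *: act (mode F a (r - 1)) v.
Proof.
have := Y_comm F0 hV hV (gen a) 0 r v omega_even; rewrite /= !(genE hY) => E.
rewrite -[LHS](subrK (act (mode F a r) (Y omega 0 v))) E.
rewrite (@fs1 _ _ 0%N) => [|[|j] // _]; last by rewrite (binz0S F0) scale0r.
rewrite (binz0 F) scale1r omega0_gen // (fm_act fmap_Y) (fm_vac fmap_Y) add0r subr0.
rewrite (_ : -2 = - 2%N%:Z) // fprod_idrN //; last exact: (cur_isfield (smooth_Vk hY)).
have -> : binz r 1 = r%:~R by rewrite /Defs.binz big_ord1 subr0 divr1.
by rewrite expr1 mulN1r scaleNr addrC.
Qed.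

Section TranslationCovariance.
Variable W : smod (agl11 F).
Hypotheses (Wk : level k W) (Ws : smooth W).
Variables (phi : Vk -> int -> W -> W) (hphi : fmap phi).
Local Notation cur := (@cur F W).

Lemma fm_lin0 n w : phi 0 n w = 0. Proof. exact: lin0 (fm_lin hphi n w). Qed.

(** Induction on [v]: the commutator of [L_{-1}] with [a_r] in [Vk] matches the Leibniz rule
    [fprod_deriv]. *)
Lemma fm_omega0 v n w : phi (Y omega 0 v) n w = - n%:~R *: phi v (n - 1) w.
Proof.
move: v n w; apply: Vk_ind => [||a r v IH].
- split=> [n w|c u v hu hv n w].
    by rewrite (lin0 (Y_linear_r hV omega 0)) !fm_lin0 scaler0.
  by rewrite (Y_linear_r hV) !(fm_lin hphi) hu hv scalerDr scalerCA.
- move=> n w; rewrite (creation_ge0 hY omega 0) fm_lin0 (fm_vac hphi) /idf.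
  case: eqP => [n0|_]; last by rewrite scaler0.
  by rewrite (_ : n = 0) ?oppr0 ?scale0r //; lia.
move=> n w; rewrite omega0_act (linB (fm_lin hphi n w)) (linZ (fm_lin hphi n w)) !(fm_act hphi).
rewrite (fprod_deriv F0 _ _ _ _ (cur_isfield Ws a) (fm_field hphi v)).
congr (fprod _ _ _ _ _ _ - _).
by apply/funext => m; apply/funext => y; rewrite IH.
Qed.
End TranslationCovariance.

Section CurrentCommutators.
Variable W : smod (agl11 F).
Hypotheses (Wk : level k W) (Ws : smooth W).
Variables (phi : Vk -> int -> W -> W) (hphi : fmap phi).
Local Notation cur := (@cur F W).
Local Notation lin0 := (fm_lin0 hphi).

(** The vector [Y u (- s - 1) vac] is the divided power of [L_{-1}] applied to [u], so its field is
    a divided derivative of the field of [u]. *)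
Lemma fm_translate s u n w :
  phi (Y u (- s.+1%:Z) vac) n w = ((-1) ^+ s * binz n s) *: phi u (n - s%:Z) w.
Proof.
elim: s n w => [|s IH] n w; first by rewrite (creation hY) (binz0 F) mulr1 scale1r subr0.
have om : Y omega 0 (Y u (- s.+1%:Z) vac) = s.+1%:R *: Y u (- s.+2%:Z) vac.
  have := Y_comm F0 hV hV u 0 (- s.+1%:Z) vac omega_even.
  rewrite /= (creation_ge0 hY omega 0) (linG0 _ (Y_isfield hV u)) subr0 => ->.
  rewrite (@fs1 _ _ 0%N) => [|[|j] // _]; last by rewrite (binz0S F0) scale0r.
  rewrite (binz0 F) scale1r add0r subr0 (fm_omega0 (smooth_Vk hY) fmap_Y) rmorphN opprK.
  by congr (_ *: Y u _ _); lia.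
have s0 : s.+1%:R != 0 :> F by rewrite F0.
have := fm_omega0 Ws hphi (Y u (- s.+1%:Z) vac) n w.
rewrite om (linZ (fm_lin hphi n w)) IH => /(congr1 ( *:%R s.+1%:R^-1)).
rewrite !scalerA mulVf // scale1r => ->.
rewrite (_ : n - 1 - s%:Z = n - s.+1%:Z); last by lia.
have -> : binz n s.+1 = s.+1%:R^-1 * (n%:~R * binz (n - 1) s) by rewrite -(binz_mulS F0) mulKf.
by congr (_ *: _); rewrite exprS; ring.
Qed.

Lemma fm_ptrunc_cur a v : ptrunc (gl11_par a) (cur a) (phi v).
Proof.
have [N hN] := smooth_Vk hY a v; exists `|N|%N => s Ns n w.
by rewrite -(fm_act hphi) hN ?lin0 //; lia.
Qed.

Lemma pcomm_id p (U : int -> W -> W) : isfield U -> hpar p U -> pcomm p U (@idf F W).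
Proof.
move=> hU pU m n w; rewrite fs_eq0 => [|s]; last by rewrite fprod_idr_ge0 ?scaler0.
have -> : cpar p (@idf F W) = @idf F W.
  case: (p) => //; apply/funext => j; apply/funext => y.
  by rewrite /cpar /idf; case: ifP; rewrite ?parK ?par0.
by rewrite /idf; case: ifP; rewrite ?linG0 // subrr.
Qed.

Lemma pcomm_idl (G : int -> W -> W) : isfield G -> pcomm false (@idf F W) G.
Proof.
move=> hG m n w; rewrite fs_eq0 => [|s]; last first.
  by rewrite (fprod_id F0) // (_ : (_ == -1) = false) ?scaler0 //; apply/eqP; lia.
by rewrite /cpar /idf; case: ifP; rewrite ?linG0 // subrr.
Qed.

Lemma ptrunc_idl (G : int -> W -> W) : isfield G -> ptrunc false (@idf F W) G.
Proof.
move=> hG; exists 0%N => s _ n w; by rewrite (fprod_id F0).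
Qed.

Lemma ptruncZ p c (U G : int -> W -> W) : isfield U -> isfield G -> ptrunc p U G ->
  ptrunc p (fun n w => c *: U n w) G.
Proof.
by move=> hU hG [J hJ]; exists J => s Js n w; rewrite fprodZ // hJ ?scaler0.
Qed.

Lemma pjacZ p c (U G : int -> W -> W) : isfield U -> isfield G -> ptrunc p U G ->
  pjac p U G -> pjac p (fun n w => c *: U n w) G.
Proof.
move=> hU hG tG jG l m n w; have hGp := cpar_isfield p hG.
have [N hN] := ptrunc_shift l tG.
transitivity (c *: fs (fun j : nat => binz m j *: fprod p U (l + j%:Z) G (m + n - j%:Z) w)).
  rewrite -fsZ; last by exists N => j Nj; rewrite hN // scaler0.
  by apply: fs_eq => j; rewrite fprodZ // scalerCA.
rewrite jG -fsZ; last exact: pjac_efin.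
by apply: fs_eq => j; rewrite linGZ //; lmod F.
Qed.

Lemma pjac_cur_br a b s (G : int -> W -> W) : (s < 2)%N -> isfield G ->
  (forall x, ptrunc (gl11_par x) (cur x) G) -> (forall x, pcomm (gl11_par x) (cur x) G) ->
  ptrunc (gl11_par a (+) gl11_par b) (cur_br k a b s) G /\
  pjac (gl11_par a (+) gl11_par b) (cur_br k a b s) G.
Proof.
move=> s2 hG tG cG.
have jG x : pjac (gl11_par x) (cur x) G.
  by apply: pjac_of_comm => //; exact: cur_isfield.
have hi := idf_isfield W.
have ji := pjac_of_comm F0 hi hG (ptrunc_idl hG) (pcomm_idl hG).
have Z p c (x U : int -> W -> W) : isfield U -> (forall n w, x n w = c *: U n w) ->
    ptrunc p U G -> pjac p U G -> ptrunc p x G /\ pjac p x G.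
  move=> hU xE tU jU; have -> : x = fun n w => c *: U n w.
    by apply/funext => ?; apply/funext => ?.
  by split; [exact: ptruncZ|exact: pjacZ].
have N p (x : int -> W -> W) : (forall n w, x n w = 0) -> ptrunc p x G /\ pjac p x G.
  move=> x0; have f0 l n w : fprod p x l G n w = 0.
    by apply: fs_eq0 => j; rewrite !x0 linG0 ?scaler0 ?subrr ?scaler0 //; exact: cpar_isfield.
  split; first by exists 0%N => *; apply: f0.
  move=> l m n w; rewrite !fs_eq0 // => j; last by rewrite f0 scaler0.
  by rewrite !x0 linG0 ?scaler0 ?subrr ?scaler0 //; exact: cpar_isfield.
case: s s2 => [|[|//]] _.
  have [E|[c [x [E <-]]]] : gl11_br F a b = [::] \/ exists c x,
      gl11_br F a b = [:: (c, x)] /\ gl11_par x = gl11_par a (+) gl11_par b.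
    by case: a; case: b; try (by left); right; do 2!eexists; split.
  - by apply: N => n w; rewrite /= E big_nil.
  - apply: (Z _ c _ (cur x)) => // [|n w]; first exact: cur_isfield.
    by rewrite /= E big_seq1.
case: (eqVneq (kappa F a b) 0) => [e|ne].
  by apply: N => n w; rewrite /= e mulr0 scale0r.
have -> : gl11_par a (+) gl11_par b = false by case: a ne; case: b => //=; rewrite eqxx.
exact: Z hi (fun _ _ => erefl) (ptrunc_idl hG) ji.
Qed.

Lemma pcomm_linear p c (U G H : int -> W -> W) : isfield U -> isfield G -> isfield H ->
  ptrunc p U G -> ptrunc p U H -> pcomm p U G -> pcomm p U H -> pcomm p U (c *: G + H).
Proof.
move=> hU hG hH [NG tG] [NH tH] cG cH m n w.
transitivity (c *: fs (fun s : nat => binz m s *: fprod p U s%:Z G (m + n - s%:Z) w)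
   + fs (fun s : nat => binz m s *: fprod p U s%:Z H (m + n - s%:Z) w)).
  rewrite -cG -cH.
  have -> : cpar p (c *: G + H) n (U m w) = c *: cpar p G n (U m w) + cpar p H n (U m w).
    by case: (p) => //; rewrite /cpar -[X in par X]/(c *: G _ _ + H _ _) parD parZ.
  rewrite -[X in U _ X]/(c *: G _ w + H _ w) (proj1 hU); lmod F.
rewrite -fsZ; last by exists NG => s Ns; rewrite tG ?scaler0.
rewrite -fsD; first last.
- by exists NH => s Ns; rewrite tH ?scaler0.
- by exists NG => s Ns; rewrite tG ?scaler0.
apply: fs_eq => s; rewrite fprod_linear //.
rewrite -[X in _ = _ *: X]/(c *: fprod _ _ _ _ _ _ + fprod _ _ _ _ _ _); lmod F.
Qed.

Lemma fm_linE c u v : phi (c *: u + v) = c *: (phi u : int -> W -> W) + phi v.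
Proof. by apply/funext => n; apply/funext => w; rewrite (fm_lin hphi). Qed.

(** Induction on [v] by [pcomm_fprod], with a current as the middle field. The truncations hold
    because [a_s v = 0] in [Vk] for large [s]. *)
Lemma fm_pcomm_cur v a : pcomm (gl11_par a) (cur a) (phi v).
Proof.
have hc := cur_isfield Ws.
move: v a; apply: Vk_ind => [||b r v IH].
- split=> [a m n w|c u v hu hv a]; last first.
    rewrite fm_linE; apply: pcomm_linear => //; try exact: (fm_field hphi); exact: fm_ptrunc_cur.
  rewrite fs_eq0 => [|s]; last by rewrite fprod0 ?scaler0 // => *; apply: lin0.
  by rewrite lin0 linG0 // /cpar; case: (gl11_par a); rewrite lin0 ?par0 subrr.
- by move=> a; rewrite (fm_vac hphi); apply: pcomm_id => //; apply: cur_hpar.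
move=> a; rewrite (fm_act hphi).
apply: (pcomm_fprod F0 (C := cur_br k a b) (J := 2)) => //.
- exact: cur_hpar.
- exact: cur_hpar.
- exact: (fm_field hphi).
- exact: cur_br_isfield.
- exact: cur_comm.
- move=> s s2; apply: pjac_cur_br => //; first exact: (fm_field hphi).
  by move=> x; apply: fm_ptrunc_cur.
- exact: fm_ptrunc_cur.
- by rewrite -(fm_act hphi); apply: fm_ptrunc_cur.
Qed.
Lemma fm_hpar p u : homog p u -> hpar p (phi u).
Proof.
move=> hu n w; have := congr1 (fun f => f n (par w)) (fm_par hphi u).
rewrite /cpar parK => <-.
by rewrite hu (linZ (fm_lin hphi n _)).
Qed.

End CurrentCommutators.

(** Skew symmetry against a generator: the commutator of [b_{-1}] with [u_i] is applied to the
    vacuum, which [u_i] kills. *)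
Lemma skew_gen p u b (i : nat) : homog p u -> Y u i%:Z (gen b) =
  - sgn (gl11_par b && p) *: fs (fun t : nat =>
     (-1) ^+ (i + t) *: Y (act (mode F b (i + t)%N%:Z) u) (- t.+1%:Z) vac).
Proof.
move=> hu; have := fm_pcomm_cur (@level_Vk F k) (smooth_Vk hY) fmap_Y u b (-1) i%:Z vac.
rewrite (creation_ge0 hY) {1}/cur act0 sub0r (cpar_hpar _ _ _ (fm_hpar fmap_Y hu)).
rewrite -[@cur _ _ _ _ _]/(gen b) => E.
have -> : Y u i%:Z (gen b) = - sgn (gl11_par b && p) *: - (sgn (gl11_par b && p) *: Y u i%:Z (gen b)).
  by rewrite scaleNr scalerN opprK scalerA sgnK scale1r.
rewrite E; congr (_ *: _).
have [N hN] := smooth_Vk hY b u.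
rewrite (@fs_shift _ _ i); first last.
- exists `|N|%N => s Ns; rewrite -(fm_act fmap_Y) hN ?(fm_lin0 fmap_Y) ?scaler0 //; lia.
- move=> j ji; rewrite -(fm_act fmap_Y) (_ : -1 + i%:Z - j%:Z = (i - j).-1%:Z); last by lia.
  by rewrite (creation_ge0 hY) scaler0.
apply: fs_eq => t; rewrite -(fm_act fmap_Y) (_ : -1 + i%:Z - (i + t)%N%:Z = - t.+1%:Z); last by lia.
congr (_ *: _); have := binzN1 F0 (i + t) => /(congr1 ( *%R ((-1) ^+ (i + t)))).
by rewrite mulrA -expr2 sqrr_sign mul1r mulr1.
Qed.

Section VertexStructure.
Variable W : smod (agl11 F).
Hypotheses (Wk : level k W) (Ws : smooth W).
Variables (phi : Vk -> int -> W -> W) (hphi : fmap phi).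
Local Notation cur := (@cur F W).
Local Notation lin0 := (fm_lin0 hphi).

(** [fm_pcomm_cur] gives this commutator in terms of the vectors [b_s u]. Skew symmetry turns the
    right-hand side into the same terms: the fields of the translated vectors come from
    [fm_translate], and the coefficients agree along diagonals by [alt_Vandermonde]. *)
Lemma fm_comm_gen p u b : homog p u -> exists J,
  (forall j : nat, (J <= j)%N -> Y u j%:Z (gen b) = 0) /\
  gcomm p (phi u) (cur b) (fun j => phi (Y u j%:Z (gen b))) J.
Proof.
move=> hu; have [J hJ] := V_nat hV u (gen b) 0.
have {}hJ (j : nat) : (J <= j)%N -> Y u j%:Z (gen b) = 0 by move=> /hJ; rewrite add0r.
exists J; split=> // m n w; rewrite (cpar_hpar _ _ _ (cur_hpar b)).
pose P s := phi (act (mode F b s%:Z) u) (m + n - s%:Z) w.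
have Pfin (c : nat -> F) : efin (fun s => c s *: P s).
  have [N hN] := smooth_Vk hY b u.
  by exists `|N|%N => s Ns; rewrite /P hN ?lin0 ?scaler0 //; lia.
have P2 (c : nat -> nat -> F) : efin2 (fun s t => c s t *: P (s + t)%N).
  have [N hN] := Pfin (fun=> 1); exists N => s t Nst.
  by have := hN _ Nst; rewrite scale1r => ->; rewrite scaler0.
have := fm_pcomm_cur Wk Ws hphi u b n m w.
rewrite (cpar_hpar _ _ _ (fm_hpar hphi hu)) => E.
have -> : phi u m (cur b n w) - sgn (p && gl11_par b) *: cur b n (phi u m w) =
   - sgn (gl11_par b && p) *: fs (fun s => binz n s *: P s).
  transitivity (- sgn (gl11_par b && p) *: (cur b n (phi u m w) - sgn (gl11_par b && p) *: phi u m (cur b n w))).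
    by rewrite andbC scalerBr scalerA mulNr sgnK scaleN1r opprK addrC scaleNr.
  rewrite E; congr (_ *: _); apply: fs_eq => s.
  by rewrite -(fm_act hphi) /P [n + m]addrC.
rewrite -(@fsE _ _ J (fun s => binz m s *: phi (Y u s%:Z (gen b)) (m + n - s%:Z) w)); last first.
  by move=> s Js; rewrite hJ // lin0 scaler0.
transitivity (- sgn (gl11_par b && p) *: fs (fun s => fs (fun t =>
    ((-1) ^+ s * binz m s * binz (m + n - s%:Z) t) *: P (s + t)%N))); last first.
  rewrite -fsZ; last exact: efin2_fs.
  apply: fs_eq => s; rewrite (skew_gen b s hu) (linZ (fm_lin hphi _ w)) [RHS]scalerCA.
  congr (_ *: _); rewrite (fs_lin (fm_lin hphi (m + n - s%:Z) w)); last first.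
    have [N hN] := smooth_Vk hY b u; exists `|N|%N => t Nt.
    by rewrite hN ?(Y0 hV) ?scaler0 //; lia.
  rewrite -fsZ; last first.
    have [N hN] := smooth_Vk hY b u; exists `|N|%N => t Nt.
    by rewrite hN ?(Y0 hV) ?scaler0 ?lin0 ?scaler0 //; lia.
  apply: fs_eq => t; rewrite (linZ (fm_lin hphi _ w)) (fm_translate Ws hphi) /P.
  rewrite (_ : m + n - (s + t)%N%:Z = m + n - s%:Z - t%:Z); last by lia.
  rewrite !scalerA; congr (_ *: _); rewrite exprD.
  have tt : (-1) ^+ t * (-1) ^+ t = 1 :> F by rewrite -expr2 sqrr_sign.
  transitivity ((-1) ^+ s * binz m s * binz (m + n - s%:Z) t * ((-1) ^+ t * (-1) ^+ t)); last by ring.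
  by rewrite tt mulr1.
congr (_ *: _); rewrite fs2_diag //; apply: fs_eq => t.
rewrite -[in LHS](_ : m + n - m = n); last by lia.
rewrite -(alt_Vandermonde F0) scaler_suml; apply: eq_bigr => -[s /= st] _.
by rewrite subnKC.
Qed.

(** Induction on the right factor for all [u] at once. For [v = vac] both sides are divided
    derivatives of the field of [u], or zero. For [b_r v] the vector [u] is moved past [b_r] by
    [Y_comm] in [Vk] and by [fprod_comm] on fields; the correction terms involve the vectors
    [u_s b], to which the induction hypothesis also applies. *)
Lemma fm_jacobi v p u : homog p u ->
  (forall l, phi (Y u l v) = fprod p (phi u) l (phi v)) /\ pcomm p (phi u) (phi v).
Proof.
have hf := fm_field hphi.
have tr p' u' v' : (forall l, phi (Y u' l v') = fprod p' (phi u') l (phi v')) ->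
    ptrunc p' (phi u') (phi v').
  have [N hN] := V_nat hV u' v' 0.
  by move=> E; exists N => s Ns n w; rewrite -E -[s%:Z]add0r hN // lin0.
move: v p u; apply: Vk_ind => [||b r v IH].
- split=> [p u hu|c v1 v2 h1 h2 p u hu].
    split=> [l|m n w].
      apply/funext => n; apply/funext => w.
      by rewrite (linG0 _ (Y_isfield hV u)) lin0 fprod0 // => *; apply: lin0.
    rewrite fs_eq0 => [|s]; last by rewrite fprod0 ?scaler0 // => *; apply: lin0.
    by rewrite lin0 linG0 // /cpar; case: (p); rewrite lin0 ?par0 subrr.
  have [i1 c1] := h1 _ _ hu; have [i2 c2] := h2 _ _ hu; split=> [l|].
    by rewrite (Y_linear_r hV) !(fm_linE hphi) i1 i2 fprod_linear.
  by rewrite (fm_linE hphi); apply: pcomm_linear => //; apply: tr.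
- move=> p u hu; rewrite (fm_vac hphi); split=> [l|]; last first.
    by apply: pcomm_id => //; apply: fm_hpar.
  apply/funext => n; apply/funext => w; case: l => l.
    by rewrite (creation_ge0 hY) lin0 fprod_idr_ge0.
  by rewrite NegzE (fm_translate Ws hphi) fprod_idrN.
move=> p u hu; have [J [hJ cub]] := fm_comm_gen b hu.
have hub (s : nat) := homog_Y hV s%:Z hu (gen_homog k b).
have it l : phi (Y u l (act (mode F b r) v)) = fprod p (phi u) l (phi (act (mode F b r) v)).
  apply/funext => n; apply/funext => w; rewrite (fm_act hphi).
  have := fprod_comm F0 l r n w (fm_hpar hphi hu) (cur_hpar b) (hf u) (cur_isfield Ws b) (hf v)
    (fun s => hf _) cub.
  move=> /(canRL (subrK _)) ->.
  have := Y_comm F0 hV hV (gen b) l r v hu; rewrite (cpar_hpar _ _ _ (Y_hpar hV (gen_homog k b))).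
  rewrite !(genE hY) => /(canRL (subrK _)) ->.
  rewrite (linD (fm_lin hphi n w)) (linZ (fm_lin hphi n w)) (fm_act hphi).
  rewrite (proj1 (IH _ _ hu)); congr (_ + _).
  rewrite (@fsE _ _ J) => [|s Js]; last by rewrite hJ // (Y0 hV) scaler0.
  rewrite (lin_sum (fm_lin hphi n w)); apply: eq_bigr => s _.
  by rewrite (linZ (fm_lin hphi n w)) (proj1 (IH _ _ (hub s))).
split=> //; rewrite (fm_act hphi).
apply: (pcomm_fprod F0 _ _ _ _ _ _ cub) => //.
- exact: fm_hpar.
- exact: cur_hpar.
- exact: cur_isfield.
- move=> s _; have [i1 c1] := IH _ _ (hub s).
  by split; [exact: tr|apply: pjac_of_comm => //; exact: tr].
- exact: tr (proj1 (IH _ _ hu)).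
- exact: (proj2 (IH _ _ hu)).
- by rewrite -(fm_act hphi); apply: tr.
Qed.

Lemma fm_axioms : field_axioms vac Y phi.
Proof.
have hf := fm_field hphi; split.
- exact: (fm_lin hphi).
- by move=> v n; apply: (proj1 (hf v)).
- move=> v n w; have := congr1 (fun f => f n (par w)) (fm_par hphi v).
  by rewrite /cpar parK => ->.
- by move=> v w; apply: (proj2 (hf v)).
- by move=> n w; rewrite (fm_vac hphi).
move=> p q u v w l m n hu hv; have [it cm] := fm_jacobi v hu.
have jac : pjac p (phi u) (phi v).
  apply: pjac_of_comm => //; have [N hN] := V_nat hV u v 0.
  by exists N => s Ns n' w'; rewrite -it -[s%:Z]add0r hN // lin0.
have [N1 h1] := V_nat hV u v l; have [N2 h2] := pjac_efin p l m n w (hf u) (hf v).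
exists (maxn N1 N2) => N; rewrite geq_max => /andP[N1N N2N].
have := jac l m n w; rewrite (@fsE _ _ N) => [|j Nj]; last first.
  by rewrite -it h1 ?lin0 ?scaler0 // (leq_trans N1N).
rewrite (@fsE _ _ N) => [|j Nj]; last by apply: h2; rewrite (leq_trans N2N).
under eq_bigr do rewrite -it; move=> ->; apply: eq_bigr => j _.
by rewrite (cpar_hpar _ _ _ (fm_hpar hphi hv)) scalerA.
Qed.

Lemma fm_vmod : vmod_axioms (V := Vk_vsalg hY) phi.
Proof. by split; [exact: fm_axioms|move=> v n w; apply: (fm_omega0 Ws hphi)]. Qed.
End VertexStructure.

Theorem vertex_structure_exists (W : smod (agl11 F)) : level k W -> smooth W ->
  exists YW : Vk -> int -> W -> W, vertex_structure hY YW.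
Proof.
move=> Wk Ws; have [phi [pL pF pA pV pP]] := field_map_exists F0 Wk Ws.
have hphi : fmap phi.
  split=> //; move=> n w c u v.
  by rewrite pL.
exists phi; split; first exact: fm_vmod.
move=> a n w; rewrite /gen pA pV fprod_idr //; exact: cur_isfield.
Qed.
End Existence.

(** * Vertex modules as affine modules *)

Section VertexModules.
Variables (F : fieldType) (k : F).
Hypothesis F0 : forall n, (n%:R == 0 :> F) = (n == 0)%N.
Hypothesis k0 : k != 0.
Local Notation binz := (@binz F).
Local Notation sgn := (sgn F).
Local Notation Vk := (Vk k).
Local Notation vac := (vacuum k).
Local Notation gen := (gen k).
Local Notation omega := (omega k).
Variables (Y : Vk -> int -> Vk -> Vk) (hY : affine_vsa Y).
Local Notation hV := (affine_field hY).
Local Notation VA := (Vk_vsalg hY).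

Section ToSmod.
Variable X : vmod VA.
Local Notation YX := (@vm_Y F VA X : Vk -> int -> X -> X).

Lemma vmod_field : field_axioms vac Y YX. Proof. exact: (proj1 (@vm_axioms F VA X)). Qed.
Local Notation hX := vmod_field.

Definition vact (x : agl11 F) (w : X) : X :=
  match x with Some (a, r) => YX (gen a) r w | None => k *: w end.

Fact vact_linear x : linear (vact x).
Proof.
case: x => [[a r]|] /=; first exact: (Y_linear_r hX).
by move=> c u v; rewrite /= scalerDr scalerCA.
Qed.

Fact vact_par x w : par (vact x w) = sgn (agl11_par x) *: vact x (par w).
Proof.
case: x => [[a r]|] /=; last by rewrite scale1r parZ.
by rewrite (Y_hpar hX (gen_homog k a)).
Qed.

Fact vact_br a b w : vact a (vact b w) - sgn (agl11_par a && agl11_par b) *: vact b (vact a w) =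
  \sum_(p <- agl11_br F a b) p.1 *: vact p.2 w.
Proof.
case: a => [[a r]|]; last by rewrite big_nil scale1r (linZ (vact_linear b)) subrr.
case: b => [[b s]|]; last first.
  by rewrite big_nil andbF scale1r (linZ (vact_linear (Some (a, r)))) subrr.
rewrite -[LHS]/(YX (gen a) r (YX (gen b) s w)
  - sgn (gl11_par a && gl11_par b) *: YX (gen b) s (YX (gen a) r w)).
rewrite -(cpar_hpar _ _ _ (Y_hpar hX (gen_homog k b))) (Y_comm F0 hV hX _ _ _ _ (gen_homog k a)).
rewrite (@fsE _ _ 2) => [|[|[|j]] // _]; last first.
  by rewrite (genE hY) (act_gen2 F0 hY) (Y0 hX) scaler0.
rewrite big_ord_recl big_ord1 [nat_of_ord _]/= [nat_of_ord _]/= (binz0 F) scale1r subr0.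
rewrite !(genE hY) (act_gen0 F0 hY) (act_gen1 F0 hY) big_cat big_map; congr (_ + _).
  rewrite (lin_sum (Y_linear_l hX (r + s) w)); apply: eq_bigr => p _.
  exact: (linZ (Y_linear_l hX (r + s) w)).
have -> : binz r 1 = r%:~R by rewrite /Defs.binz big_ord1 subr0 divr1.
rewrite (linZ (Y_linear_l hX _ w)) (Y_vac hX).
rewrite (_ : (_ == -1) = (r + s == 0)); last by rewrite /= ?/bump /=; apply/eqP/eqP; lia.
case: eqP => _ /=; last by rewrite !scaler0 big_nil.
case: eqP => [->|_]; first by rewrite /= big_nil mulr0 scale0r scaler0.
by rewrite big_seq1 /= !scalerA; congr (_ *: _); ring.
Qed.

Definition smod_of : smod (agl11 F) := @Smod F (agl11 F) X vact vact_linear vact_par vact_br.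

Lemma smod_of_vertex : vertex_structure (W := smod_of) hY YX.
Proof. by split=> //; exact: (@vm_axioms F VA X). Qed.
End ToSmod.

Section Vertex.
Variables (W : smod (agl11 F)) (YW : Vk -> int -> W -> W).
Hypothesis hW : vertex_structure hY YW.

Lemma vs_field : field_axioms vac Y YW. Proof. exact: (proj1 (proj1 hW)). Qed.
Local Notation hf := vs_field.

Lemma vs_gen a n w : YW (gen a) n w = act (mode F a n) w. Proof. exact: (proj2 hW). Qed.

Lemma vs_smooth : smooth W.
Proof.
move=> a w; have [N hN] := Y_trunc hf (gen a) w.
by exists N => r Nr; rewrite -vs_gen hN.
Qed.

Lemma vs_act a r v : YW (act (mode F a r) v) = fprod (gl11_par a) (@cur F W a) r (YW v).
Proof.
rewrite (Y_act F0 hY hf); congr fprod.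
by apply/funext => n; apply/funext => w; rewrite vs_gen.
Qed.

Lemma L0_act a r w : YW omega 1 (act (mode F a r) w) =
  act (mode F a r) (YW omega 1 w) - r%:~R *: act (mode F a r) w.
Proof.
have := Y_comm F0 hV hf (gen a) 1 r w (omega_even k).
rewrite /= !vs_gen => /(canRL (subrK _)) ->.
rewrite addrC; congr (_ + _).
rewrite (@fsE _ _ 2) => [|[|[|j]] // _]; last by rewrite (binz_small F0 (i := 1)) ?scale0r.
rewrite big_ord_recl big_ord1 [nat_of_ord _]/= [nat_of_ord _]/= (binz0 F) scale1r subr0.
rewrite (omega1_gen F0 k0 hY) (_ : 1 + r - 1%N%:Z = r); last by lia.
have -> : binz 1 1 = 1 by rewrite (binz_nat F0 1).
have /= -> := proj2 (proj1 hW) (gen a) (1 + r) w.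
rewrite (_ : 1 + r - 1 = r); last by lia.
by rewrite !vs_gen rmorphD /=; lmod F.
Qed.

Lemma L0_linear : linear (YW omega 1). Proof. exact: (Y_linear_r hf). Qed.

(** The Sugawara formula. The cutoff [M] stays free, so that it can be taken beyond [|l|] in
    [Dop_sing]. *)
Lemma L0_sugawara w : exists N, forall M, (N <= M)%N -> YW omega 1 w =
  (2%:R * k)^-1 *: \sum_(j < M)
    (act (mode F gN (-1 - j%:Z)) (act (mode F gE (1 + j%:Z)) w)
     + act (mode F gE (- j%:Z)) (act (mode F gN j%:Z) w)
     + (act (mode F gE (-1 - j%:Z)) (act (mode F gN (1 + j%:Z)) w)
     + act (mode F gN (- j%:Z)) (act (mode F gE j%:Z) w))
     - (act (mode F gpsip (-1 - j%:Z)) (act (mode F gpsim (1 + j%:Z)) w)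
     - act (mode F gpsim (- j%:Z)) (act (mode F gpsip j%:Z) w))
     + (act (mode F gpsim (-1 - j%:Z)) (act (mode F gpsip (1 + j%:Z)) w)
     - act (mode F gpsip (- j%:Z)) (act (mode F gpsim j%:Z) w)))
  + (2%:R * k ^+ 2)^-1 *: \sum_(j < M)
    (act (mode F gE (-1 - j%:Z)) (act (mode F gE (1 + j%:Z)) w)
     + act (mode F gE (- j%:Z)) (act (mode F gE j%:Z) w)).
Proof.
have fin a : exists N : nat, forall j : nat, (N <= j)%N -> act (mode F a j%:Z) w = 0.
  by have [N hN] := vs_smooth a w; exists `|N|%N => j Nj; apply: hN; lia.
have [N1 h1] := fin gN; have [N2 h2] := fin gE; have [N3 h3] := fin gpsip; have [N4 h4] := fin gpsim.
exists (N1 + N2 + (N3 + N4))%N => M NM; rewrite (Y_omega F0 hY hf).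
have nopE a b : (forall j : nat, (M <= j)%N -> act (mode F a j%:Z) w = 0) ->
    (forall j : nat, (M <= j)%N -> act (mode F b j%:Z) w = 0) ->
    nop YW a b 1 w = \sum_(j < M) (act (mode F a (-1 - j%:Z)) (act (mode F b (1 + j%:Z)) w)
      + sgn (gl11_par a && gl11_par b) *: act (mode F b (- j%:Z)) (act (mode F a j%:Z) w)).
  move=> ha hb; rewrite /nop (@fsE _ _ M) => [|j Mj].
    by apply: eq_bigr => j _; rewrite !vs_gen subrr sub0r.
  by rewrite !vs_gen ha // (_ : 1 + j%:Z = j.+1%:Z) // hb ?act0 ?scaler0 ?addr0 // ltnW.
rewrite !nopE; try by move=> j Mj; first [apply: h1|apply: h2|apply: h3|apply: h4];
  rewrite (leq_trans _ Mj) // (leq_trans _ NM) //; lia.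
congr (_ *: _ + _ *: _).
  rewrite -big_split -sumrB -big_split; apply: eq_bigr => j _.
  by rewrite /Defs.sgn [gl11_par _ && gl11_par _]/= ?[gl11_par _ && _]/= expr0 expr1 !scale1r !scaleN1r.
by apply: eq_bigr => j _; rewrite scale1r.
Qed.

(** Every field is obtained from the identity by products with currents. Stability under the parity
    is used because odd currents bring in [cpar]. *)
Lemma vs_sub (S : W -> Prop) : smod_sub S -> forall v n w, S w -> S (YW v n w).
Proof.
move=> [[S0 SD] Sp Sa]; have SZ c u : S u -> S (c *: u).
  by move=> hu; rewrite -[_ *: _]addr0; apply: SD.
have SB u v : S u -> S v -> S (u - v).
  by move=> hu hv; rewrite addrC -scaleN1r; apply: SD.
apply: (Vk_ind (T := fun v => forall n w, S w -> S (YW v n w))) => [|n w hw|a r v IH n w hw].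
- split=> [n w hw|c u v hu hv n w hw]; first by rewrite (Y0 hf).
  by rewrite (Y_linear_l hf); apply: SD; [apply: hu|apply: hv].
- by rewrite (Y_vac hf); case: ifP.
have [N fN] := fprod_efin (gl11_par a) r n w (cur_isfield vs_smooth a) (Y_isfield hf v).
rewrite vs_act /fprod (@fsE _ _ N) => [|j Nj]; last by rewrite fN // scaler0.
elim: N {fN} => [|N IHN]; first by rewrite big_ord0.
rewrite big_ord_recr -[X in S (X + _)]scale1r; apply: (SD) => //; apply: (SZ); apply: (SB).
  by apply: Sa; apply: IH.
apply: SZ; rewrite /cpar; case: (gl11_par a); last by apply: IH; apply: Sa.
by apply: (Sp); apply: IH; apply: Sp; apply: Sa.
Qed.
End Vertex.

(** The map commutes with the modes without a Koszul sign, even for odd [b]; in the terms with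
    [cpar] the sign of [f] occurs twice and cancels. *)
Lemma vs_hom (W Z : smod (agl11 F)) (YW : Vk -> int -> W -> W) (YZ : Vk -> int -> Z -> Z)
  (hW : vertex_structure hY YW) (hZ : vertex_structure hY YZ) (f : W -> Z) b :
  linear f -> (forall w, par (f w) = sgn b *: f (par w)) ->
  (forall a r w, f (act (mode F a r) w) = act (mode F a r) (f w)) ->
  forall v n w, f (YW v n w) = YZ v n (f w).
Proof.
move=> lf pf af; have hfW := vs_field hW; have hfZ := vs_field hZ.
apply: Vk_ind => [||a r v IH n w].
- split=> [n w|c u v hu hv n w]; first by rewrite (Y0 hfW) (Y0 hfZ) (lin0 lf).
  by rewrite (Y_linear_l hfW) (Y_linear_l hfZ) lf hu hv.
- by move=> n w; rewrite (Y_vac hfW) (Y_vac hfZ); case: ifP => _; rewrite ?(lin0 lf).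
rewrite (vs_act hW) (vs_act hZ) /fprod (fs_lin lf); last first.
  by apply: efinZ; apply: fprod_efin; [exact: (cur_isfield (vs_smooth hW))|exact: Y_isfield hfW v].
apply: fs_eq => j; rewrite (linZ lf) (linB lf) (linZ lf) /cur af IH; congr (_ *: (_ - _ *: _)).
rewrite /cpar; case: (gl11_par a); last by rewrite IH af.
have fp x : f (par x) = sgn b *: par (f x) by rewrite pf scalerA sgnK scale1r.
by rewrite fp IH fp af (linZ (Y_linear_r hfZ v _)) parZ scalerA sgnK scale1r.
Qed.
End VertexModules.

(** * Generalized eigenspaces *)

Section PolynomialAction.
Variables (F : fieldType) (V : lmodType F) (f : V -> V).
Hypothesis lf : linear f.
Implicit Types p q : {poly F}.

Definition pact q (v : V) : V := \sum_(i < size q) q`_i *: iter i f v.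

Lemma pactE N q v : (size q <= N)%N -> pact q v = \sum_(i < N) q`_i *: iter i f v.
Proof.
move=> qN; rewrite (@sum_trunc _ _ (fun i => q`_i *: iter i f v) (size q) N) // => j qj.
by rewrite nth_default ?scale0r.
Qed.

Lemma iter_linear i : linear (iter i f).
Proof. by elim: i => [|i IH] // c u v; rewrite !iterS IH lf. Qed.

Lemma pact_linear q : linear (pact q).
Proof.
move=> c u v; rewrite /pact scaler_sumr -big_split; apply: eq_bigr => i _ /=.
by rewrite iter_linear scalerDr !scalerA mulrC.
Qed.

Lemma pact0 v : pact 0 v = 0.
Proof. by rewrite /pact size_poly0 big_ord0. Qed.

Lemma pactD p q v : pact (p + q) v = pact p v + pact q v.
Proof.
pose N := maxn (size p) (size q).
rewrite (@pactE N (p + q)) ?size_polyD // (@pactE N p) ?leq_maxl // (@pactE N q) ?leq_maxr //.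
rewrite -[RHS]big_split /=.
by apply: eq_bigr => i _; rewrite coefD scalerDl.
Qed.

Lemma pactZ c q v : pact (c *: q) v = c *: pact q v.
Proof.
rewrite !(@pactE (size q)) ?size_scale_leq // scaler_sumr.
by apply: eq_bigr => i _; rewrite coefZ scalerA.
Qed.

Lemma pactC c v : pact c%:P v = c *: v.
Proof.
rewrite (@pactE 1) ?size_polyC_leq1 // big_ord1 coefC eqxx //.
Qed.

Lemma pactXM q v : pact (q * 'X) v = f (pact q v).
Proof.
rewrite (@pactE (size q).+1); last first.
  by rewrite (leq_trans (size_polyMleq _ _)) // size_polyX addn2.
rewrite big_ord_recl coefMX eqxx scale0r add0r /pact (lin_sum lf).
by apply: eq_bigr => i _; rewrite coefMX (linZ lf).
Qed.

Lemma pactM p q v : pact (p * q) v = pact p (pact q v).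
Proof.
elim/poly_ind: p => [|p c IH]; first by rewrite mul0r !pact0.
by rewrite mulrDl pactD mulrAC pactXM IH mul_polyC pactZ pactD pactXM pactC.
Qed.

Lemma pactXsubC c n v : pact (('X - c%:P) ^+ n) v = iter n (fun x => f x - c *: x) v.
Proof.
elim: n v => [|n IH] v; first by rewrite expr0 -polyC1 pactC scale1r.
rewrite exprS pactM IH iterS -polyCN pactD pactC scaleNr.
by rewrite -[X in pact X _]mul1r pactXM -polyC1 pactC scale1r.
Qed.

Lemma pact_stable (S : V -> Prop) q v : subspace S -> (forall x, S x -> S (f x)) -> S v -> S (pact q v).
Proof.
move=> [S0 SD] Sf Sv; elim/poly_ind: q => [|q c IH]; first by rewrite pact0.
by rewrite addrC pactD pactC pactXM; apply: SD => //; apply: Sf.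
Qed.

Definition geigen (h : F) (v : V) : Prop := exists p : nat, iter p (fun x => f x - h *: x) v = 0.

Lemma geigen_le h (p n : nat) v : iter p (fun x => f x - h *: x) v = 0 -> (p <= n)%N ->
  iter n (fun x => f x - h *: x) v = 0.
Proof.
move=> hp /subnK <-; rewrite iterD hp.
by elim: (n - p)%N => // m; rewrite iterS => ->; rewrite (lin0 lf) scaler0 subr0.
Qed.
End PolynomialAction.

Lemma pact_morph (F : fieldType) (V W : lmodType F) (f : V -> V) (g : W -> W) (h : V -> W) q v :
  linear f -> linear g -> linear h -> (forall x, h (f x) = g (h x)) ->
  h (pact f q v) = pact g q (h v).
Proof.
move=> lf lg lh hfg; elim/poly_ind: q => [|q c IH]; first by rewrite !pact0 (lin0 lh).
by rewrite !pactD // !pactXM // !pactC // (linD lh) hfg IH (linZ lh).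
Qed.

(** By Bezout for [(X - c0)^M] and the product of the other factors [(X - c i)^N]. The polynomial
    depends on the exponent [r] but not on the module in which [z] lies: the same [q] can therefore
    be used on both sides of a homomorphism, projecting in the source and fixing a given vector of
    the target. *)
Lemma geigen_projection (F : fieldType) (V : lmodType F) (f : V -> V) n (c : 'I_n -> F)
    (x : 'I_n -> V) (c0 : F) (r : nat) : linear f -> (forall i, geigen f (c i) (x i)) ->
  exists q : {poly F},
    (forall i, pact f q (x i) = if c i == c0 then x i else 0) /\
    (forall (W : lmodType F) (g : W -> W) z, linear g ->
       iter r (fun y => g y - c0 *: y) z = 0 -> pact g q z = z).
Proof.
move=> lf hx; have [N hN] : exists N, forall i, iter N (fun y => f y - c i *: y) (x i) = 0.
  have h i : exists p, iter p (fun y => f y - c i *: y) (x i) = 0 by exact: hx.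
  pose p i := projT1 (cid (h i)); exists (\max_i p i) => i.
  by apply: geigen_le (leq_bigmax i) => //; apply: (projT2 (cid (h i))).
pose M := maxn N r; pose A : {poly F} := ('X - c0%:P) ^+ M.
pose B : {poly F} := \prod_(i | c i != c0) ('X - (c i)%:P) ^+ N.
have AB : coprimep A B.
  rewrite /B; apply: (big_rec (coprimep A)); first exact: coprimep1.
  move=> i b ci Ab; rewrite coprimepMr Ab andbT; apply: coprimep_expr; apply: coprimep_expl.
  by apply: coprimep_XsubC2; rewrite subr_eq0.
have /Bezout_eq1_coprimepP [[u v] /= uv] := AB.
have lin1 (W : lmodType F) (g : W -> W) z : linear g ->
    iter M (fun y => g y - c0 *: y) z = 0 -> pact g (v * B) z = z.
  move=> lg gz; have -> : v * B = 1 - u * A by rewrite -uv addrC addKr.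
  rewrite pactD // -polyC1 pactC scale1r -mulNr pactM // pactXsubC // gz.
  by rewrite (lin0 (pact_linear lg _)) addr0.
exists (v * B); split=> [i|W g z lg gz]; last first.
  by apply: lin1 => //; apply: geigen_le gz _; rewrite // leq_maxr.
case: eqVneq => [ci|ci].
  by apply: lin1 => //; rewrite -ci; apply: geigen_le (hN i) _; rewrite // leq_maxl.
rewrite pactM // /B (bigD1 i) //= mulrC pactM // pactXsubC // hN.
by rewrite (lin0 (pact_linear lf _)) (lin0 (pact_linear lf _)).
Qed.

(** * The twisted grading *)

Section Singular.
Variables (F : fieldType) (k : F).
Hypothesis F0 : forall n, (n%:R == 0 :> F) = (n == 0)%N.
Hypothesis k0 : k != 0.
Local Notation omega := (omega k).
Variable W : smod (agl11 F).
Hypothesis Wk : level k W.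
Implicit Types (r s i j l : int) (w x y : W).
Local Notation N r := (@act F (agl11 F) W (mode F gN r)).
Local Notation E r := (@act F (agl11 F) W (mode F gE r)).
Local Notation p r := (@act F (agl11 F) W (mode F gpsip r)).
Local Notation m r := (@act F (agl11 F) W (mode F gpsim r)).

Lemma act_swap (a b : agl11 F) w : act a (act b w) =
  sgn F (agl11_par a && agl11_par b) *: act b (act a w) + \sum_(q <- agl11_br F a b) q.1 *: @act F (agl11 F) W q.2 w.
Proof. by rewrite -(@act_br F (agl11 F) W a b w) addrC subrK. Qed.

Let simp := (big_cons, big_nil, addr0, scale1r, scaleN1r, mulr1, mulrN1, scale0r).

Lemma brNN r s w : N r (N s w) = N s (N r w).
Proof. by rewrite act_swap /= eqxx andbF big_nil addr0 scale1r. Qed.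
Lemma brEE r s w : E r (E s w) = E s (E r w).
Proof. by rewrite act_swap /= eqxx andbF big_nil addr0 scale1r. Qed.
Lemma brEp r s w : E r (p s w) = p s (E r w).
Proof. by rewrite act_swap /= eqxx andbF big_nil addr0 scale1r. Qed.
Lemma brEm r s w : E r (m s w) = m s (E r w).
Proof. by rewrite act_swap /= eqxx andbF big_nil addr0 scale1r. Qed.
Lemma brNp r s w : N r (p s w) = p s (N r w) + p (r + s) w.
Proof. by rewrite act_swap /= eqxx andbF !simp. Qed.
Lemma brNm r s w : N r (m s w) = m s (N r w) - m (r + s) w.
Proof. by rewrite act_swap /= eqxx andbF !simp. Qed.
Lemma brpp r s w : p r (p s w) = - p s (p r w).
Proof. by rewrite act_swap /= eqxx andbF big_nil addr0 /Defs.sgn expr1 scaleN1r. Qed.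
Lemma brmm r s w : m r (m s w) = - m s (m r w).
Proof. by rewrite act_swap /= eqxx andbF big_nil addr0 /Defs.sgn expr1 scaleN1r. Qed.
Lemma brNE r s w : N r (E s w) = E s (N r w) + (if r + s == 0 then r%:~R * k else 0) *: w.
Proof.
rewrite act_swap /= oner_eq0 andbT scale1r; congr (_ + _).
by case: eqP => _; rewrite ?big_cons ?big_nil ?scale0r //= addr0 mulr1 Wk scalerA.
Qed.
Lemma brEN r s w : E r (N s w) = N s (E r w) + (if r + s == 0 then r%:~R * k else 0) *: w.
Proof.
rewrite act_swap /= oner_eq0 andbT scale1r; congr (_ + _).
by case: eqP => _; rewrite ?big_cons ?big_nil ?scale0r //= addr0 mulr1 Wk scalerA.
Qed.
Lemma brEN0 w : E 0 (N 0 w) = N 0 (E 0 w).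
Proof. by rewrite brEN addr0 eqxx mul0r scale0r addr0. Qed.
Lemma brpm r s w : p r (m s w) =
  - m s (p r w) + E (r + s) w + (if r + s == 0 then r%:~R * k else 0) *: w.
Proof.
rewrite act_swap /= oner_eq0 andbT /Defs.sgn expr1 scaleN1r big_cons scale1r -!addrA.
congr (_ + (_ + _)).
by case: eqP => _; rewrite ?big_cons ?big_nil ?scale0r //= addr0 mulr1 Wk scalerA.
Qed.
Lemma brmp r s w : m r (p s w) =
  - p s (m r w) + E (r + s) w - (if r + s == 0 then r%:~R * k else 0) *: w.
Proof.
rewrite act_swap /= oppr_eq0 oner_eq0 andbT /Defs.sgn expr1 scaleN1r big_cons scale1r -!addrA.
congr (_ + (_ + _)).
by case: eqP => _; rewrite ?big_cons ?big_nil ?scale0r ?oppr0 //= addr0 mulrN1 scaleNr Wk scalerA.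
Qed.

Lemma eq_opp0 w : w = - w -> w = 0.
Proof.
move=> e; have : 2%:R *: w = 0 by rewrite scaler_nat mulr2n {2}e subrr.
by move=> /eqP; rewrite scaler_eq0 F0 /= => /eqP.
Qed.

Lemma pp0 r w : p r (p r w) = 0. Proof. by apply: eq_opp0; apply: brpp. Qed.
Lemma mm0 r w : m r (m r w) = 0. Proof. by apply: eq_opp0; apply: brmm. Qed.

(** The bounds for the two kinds of odd modes are independent, so that they can be lowered one at a
    time; vectors of type [(n, l)] have [i = l] and [j = - l]. *)
Definition sing i j w : Prop :=
  [/\ forall r, 0 < r -> N r w = 0, forall r, 0 < r -> E r w = 0,
      forall r, i < r -> m r w = 0 & forall r, j < r -> p r w = 0].

Lemma sing_le i j i' j' w : i <= i' -> j <= j' -> sing i j w -> sing i' j' w.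
Proof. by move=> ii jj [hN hE hm hp]; split=> // r hr; [apply: hm|apply: hp]; lia. Qed.

(** The condition on [i + j] makes the modes of [E] that come from the anticommutators positive, and
    excludes the central term. *)
Lemma sing_m i j w : 0 <= i + j -> sing i j w -> sing (i - 1) j (m i w).
Proof.
move=> ij [hN hE hm hp]; split=> r hr.
- by rewrite brNm hN // hm ?act0 ?subr0 //; lia.
- by rewrite brEm hE ?act0.
- have [->|ri] := eqVneq r i; first exact: mm0.
  by rewrite brmm hm ?act0 ?oppr0 //; lia.
- rewrite brpm hp // act0 oppr0 hE ?addr0 ?add0r; last by lia.
  by rewrite (_ : r + i == 0 = false) ?scale0r //; apply/eqP; lia.
Qed.

Lemma sing_p i j w : 0 <= i + j -> sing i j w -> sing i (j - 1) (p j w).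
Proof.
move=> ij [hN hE hm hp]; split=> r hr.
- by rewrite brNp hN // hp ?act0 ?addr0 //; lia.
- by rewrite brEp hE ?act0.
- rewrite brmp hm // act0 oppr0 hE ?addr0 ?add0r; last by lia.
  by rewrite (_ : r + j == 0 = false) ?scale0r ?oppr0 //; apply/eqP; lia.
- have [->|ri] := eqVneq r j; first exact: pp0.
  by rewrite brpp hp ?act0 ?oppr0 //; lia.
Qed.

Definition etype (n e : F) w : Prop := N 0 w = n *: w /\ E 0 w = e *: w.

Lemma etype_m n e i w : etype n e w -> etype (n - 1) e (m i w).
Proof.
move=> [hN hE]; split; last by rewrite brEm hE actZ.
by rewrite brNm hN actZ add0r scalerBl scale1r.
Qed.

Lemma etype_p n e i w : etype n e w -> etype (n + 1) e (p i w).
Proof.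
move=> [hN hE]; split; last by rewrite brEp hE actZ.
by rewrite brNp hN actZ add0r scalerDl scale1r.
Qed.

Lemma etype_NE n e r w : etype n e w -> etype n e (N r w) /\ etype n e (E r w).
Proof.
move=> [hN hE]; split; split.
- by rewrite brNN hN actZ.
- by rewrite brEN hE actZ mul0r (_ : (if _ then _ else _) = 0) ?scale0r ?addr0 //; case: ifP.
- by rewrite brNE hN actZ mul0r (_ : (if _ then _ else _) = 0) ?scale0r ?addr0 //; case: ifP.
- by rewrite brEE hE actZ.
Qed.

(* The zero modes of the spectral flow: [sing l (- l)] is preserved by them. *)
Lemma sing_zero_m l w : sing l (- l) w -> sing l (- l) (m l w).
Proof. by move=> h; apply: sing_le (sing_m _ h); lia. Qed.
Lemma sing_zero_p l w : sing l (- l) w -> sing l (- l) (p (- l) w).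
Proof. by move=> h; apply: sing_le (sing_p _ h); lia. Qed.

(** Atypicality enters here: the anticommutator of the two zero modes is [E_0 - l k], which
    vanishes. *)
Lemma zero_pm l w : E 0 w = (l%:~R * k) *: w -> p (- l) (m l w) = - m l (p (- l) w).
Proof.
by move=> hE; rewrite brpm addNr eqxx hE -addrA -scalerDl rmorphN mulNr subrr scale0r addr0.
Qed.

Lemma zero_nilp l w : E 0 w = (l%:~R * k) *: w -> m l (p (- l) (m l (p (- l) w))) = 0.
Proof.
move=> hE; rewrite zero_pm; last by rewrite brEp hE actZ.
by rewrite pp0 act0 oppr0 act0.
Qed.

Variables (Y : Vk k -> int -> Vk k -> Vk k) (hY : affine_vsa Y).
Variables (YW : Vk k -> int -> W -> W).
Hypothesis hW : vertex_structure hY YW.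

Definition Dop s w : W := YW omega 1 w - s%:~R *: N 0 w.

Definition deg s (x : agl11 F) : int :=
  match x with
  | Some (gpsip, r) => r + s | Some (gpsim, r) => r - s | Some (_, r) => r | None => 0
  end.

Lemma Dop_linear s : linear (Dop s).
Proof.
move=> c u v; rewrite /Dop (L0_linear hW) act_linear; lmod F.
Qed.

Lemma Dop_act s (x : agl11 F) w : Dop s (act x w) = act x (Dop s w) - (deg s x)%:~R *: act x w.
Proof.
case: x => [[a r]|]; last by rewrite !Wk scale0r subr0 (linZ (Dop_linear s)).
rewrite -[Some _]/(mode F a r) /Dop (L0_act F0 k0 hW) (linB (@act_linear _ _ W _)) actZ.
case: a; rewrite /deg.
- by rewrite brNN; lmod F.
- by rewrite brNE (_ : (if _ then _ else _) = 0) ?mul0r; [lmod F|case: ifP; rewrite ?mul0r].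
- by rewrite brNp add0r rmorphD /=; lmod F.
- by rewrite brNm add0r rmorphB /=; lmod F.
Qed.

(** This evaluates the reordering terms in [Dop_sing]. Subtraction is truncated, so that the terms
    beyond [l] are zero. *)
Lemma sum_sub_sqr (l M : nat) : (l <= M)%N ->
  \sum_(j < M) ((l - j)%N%:R + (l - j.+1)%N%:R) = (l%:R ^+ 2 : F).
Proof.
move=> lM; rewrite (@sum_trunc _ F^o (fun t : nat => (l - t)%N%:R + (l - t.+1)%N%:R) l) // => [|j lj]; last first.
  by rewrite (eqP lj) (eqP (leqW lj)) addr0.
elim: l {M lM} => [|l IH]; first by rewrite big_ord0 expr0n.
rewrite big_ord_recl subn0 subn1 /=; under eq_bigr do rewrite !subSS.
by rewrite IH -natr1; ring.
Qed.

(** In the Sugawara sum the terms in [N] and [E] give [l N_0], which [D] subtracts, and the terms in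
    [E E] give [l^2 / 2]. Moving the odd modes between [- |l|] and [|l|] into the order in which
    they kill [y] gives [- l^2 / 2]. What remains is the pair of zero modes. *)
Lemma Dop_sing l y : sing l (- l) y -> E 0 y = (l%:~R * k) *: y ->
  Dop l y = k^-1 *: m l (p (- l) y).
Proof.
move=> [hN hE hm hp] hE0; have [N0 hs] := L0_sugawara F0 k0 hW y.
have two := two_neq0 F0; have k20 : k ^+ 2 != 0 by rewrite expf_neq0.
pose a (j : int) := m (- j) (p j y); pose b (j : int) := p (- j) (m j y).
have aE j : a j = if j < - l then ((l + j)%:~R * k) *: y else if j == - l then m l (p (- l) y) else 0.
  rewrite /a; case: ltP => [jl|lj]; last first.
    case: (eqVneq j (- l)) => [->|ne]; first by rewrite opprK.
    by rewrite hp ?act0 //; lia.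
  rewrite brmp hm; last by lia.
  rewrite act0 oppr0 add0r addNr eqxx hE0 -scalerBl; congr (_ *: _).
  by rewrite rmorphN rmorphD /=; ring.
have bE j : b j = if j < l then ((l - j)%:~R * k) *: y else if j == l then - m l (p (- l) y) else 0.
  rewrite /b; case: ltP => [jl|lj]; last first.
    case: (eqVneq j l) => [->|ne]; first by rewrite zero_pm.
    by rewrite hm ?act0 //; lia.
  rewrite brpm hp; last by lia.
  rewrite act0 oppr0 add0r addNr eqxx hE0 -scalerDl; congr (_ *: _).
  by rewrite rmorphN rmorphB /=; ring.
pose M := (N0 + (absz l).+2)%N; have M0 : (N0 <= M)%N by apply: leq_addr.
rewrite /Dop (hs M M0).
have -> : \sum_(j < M)
    (E (-1 - j%:Z) (E (1 + j%:Z) y) + E (- j%:Z) (E j%:Z y)) = (l%:~R * k) ^+ 2 *: y.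
  rewrite /M addnS big_ord_recl big1 => [|j _]; first last.
    by rewrite !hE ?act0 ?addr0 // lift0; lia.
  by rewrite hE // act0 add0r addr0 oppr0 !hE0 actZ hE0 scalerA expr2.
set T := \sum_(j < M) _.
have -> : T = 2%:R *: ((l%:~R * k) *: N 0 y) +
    \sum_(j < M) ((a j%:Z + a j.+1%:Z) - (b j%:Z + b j.+1%:Z)).
  transitivity (\sum_(j < M) ((if j == 0%N :> nat then 2%:R *: ((l%:~R * k) *: N 0 y) else 0)
     + ((a j%:Z + a j.+1%:Z) - (b j%:Z + b j.+1%:Z)))).
    apply: eq_bigr => j _; rewrite /a /b.
    have -> : -1 - j%:Z = - j.+1%:Z by lia.
    have -> : 1 + j%:Z = j.+1%:Z by lia.
    rewrite (hE j.+1%:Z) // (hN j.+1%:Z) // !act0 add0r.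
    have -> : (if j == 0%N :> nat then 2%:R *: ((l%:~R * k) *: N 0 y) else 0) =
        E (- j%:Z) (N j%:Z y) + N (- j%:Z) (E j%:Z y).
      case: eqP => [->|j0]; last by rewrite hE ?hN ?act0 ?addr0 //; lia.
      by rewrite oppr0 brEN0 hE0 actZ scaler_nat mulr2n.
    by lmod F.
  rewrite big_split; congr (_ + _).
  by rewrite /M addnS big_ord_recl big1 => [|j _]; rewrite ?lift0 //= addr0.
have sumE (L : nat) (z : W) : (0 < L < M)%N -> \sum_(j < M)
    ((((L - j)%N%:R *: (k *: y) + (if j == L :> nat then z else 0))
     + ((L - j.+1)%N%:R *: (k *: y) + (if j.+1 == L :> nat then z else 0)))) =
    L%:R ^+ 2 *: (k *: y) + 2%:R *: z.
  move=> /andP[L0 LM]; rewrite -(sum_sub_sqr (ltnW LM)) scaler_suml.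
  have -> : 2%:R *: z = \sum_(j < M) (if j == L :> nat then z else 0)
      + \sum_(j < M) (if j.+1 == L :> nat then z else 0).
    have L1M : (L.-1 < M)%N by lia.
    rewrite (bigD1 (Ordinal LM)) //= eqxx big1 => [|j]; last by rewrite -val_eqE /= => /negbTE ->.
    rewrite (bigD1 (Ordinal L1M)) //= prednK // eqxx big1 => [|j].
      by rewrite !addr0 scaler_nat mulr2n.
    by rewrite -val_eqE /= => jL; case: eqP => // jL'; move: jL; rewrite -jL' eqxx.
  by rewrite addrA -!big_split; apply: eq_bigr => j _ /=; rewrite scalerDl; lmod F.
have two_k : (2%:R * k)^-1 = 2%:R^-1 * k^-1 by rewrite invfM.
have -> : \sum_(j < M) ((a j%:Z + a j.+1%:Z) - (b j%:Z + b j.+1%:Z)) =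
    - l%:~R ^+ 2 *: (k *: y) + 2%:R *: m l (p (- l) y).
  (* For [l < 0] only the [a j] contribute, for [l > 0] only the [b j], and for [l = 0] both do, at
     index [0] alone. *)
  have [l0|l0|l0] := ltrgtP l 0.
  - have LM : (0 < absz l < M)%N by rewrite /M; lia.
    have := sumE _ (- m l (p (- l) y)) LM => /(congr1 -%R).
    rewrite -sumrN => E1; rewrite (_ : - l%:~R ^+ 2 *: _ + _ = - ((absz l)%:R ^+ 2 *: (k *: y) + 2%:R *: - m l (p (- l) y))); last first.
      have -> : l%:~R = - (absz l)%:R :> F by rewrite -[in LHS](opprK l) rmorphN pmulrn; congr (- _%:~R); lia.
      lmod F.
    rewrite -E1; apply: eq_bigr => j _; rewrite !bE.
    have bz (t : nat) : (if t%:Z < l then ((l - t%:Z)%:~R * k) *: y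
        else if t%:Z == l then - m l (p (- l) y) else 0) = 0.
      by rewrite ltNge (_ : l <= t%:Z) /=; [case: eqP => // tl; lia|lia].
    have az (t : nat) : a t%:Z = - ((absz l - t)%N%:R *: (k *: y) + (if t == absz l then - m l (p (- l) y) else 0)).
      rewrite aE; case: ltP => lt.
        rewrite (_ : (t == _) = false); last by apply/eqP; lia.
        rewrite addr0 scalerA -scaleNr -mulNr; congr (_ * _ *: _).
        by rewrite pmulrn -rmorphN; congr (_%:~R); lia.
      have -> : (absz l - t)%N = 0%N by lia.
      rewrite scale0r add0r (_ : (t == absz l) = (t%:Z == - l)); last by apply/eqP/eqP; lia.
      by case: eqP; rewrite ?opprK ?oppr0.
    by rewrite !bz !az addr0 subr0 -opprD.
  - have LM : (0 < absz l < M)%N by rewrite /M; lia.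
    have := sumE _ (- m l (p (- l) y)) LM => /(congr1 -%R).
    rewrite -sumrN => E1; rewrite (_ : - l%:~R ^+ 2 *: _ + _ = - ((absz l)%:R ^+ 2 *: (k *: y) + 2%:R *: - m l (p (- l) y))); last first.
      have -> : l%:~R = (absz l)%:R :> F by rewrite pmulrn; congr (_%:~R); lia.
      lmod F.
    rewrite -E1; apply: eq_bigr => j _; rewrite !aE.
    have az (t : nat) : (if t%:Z < - l then ((l + t%:Z)%:~R * k) *: y
        else if t%:Z == - l then m l (p (- l) y) else 0) = 0.
      by rewrite ltNge (_ : - l <= t%:Z) /=; [case: eqP => // tl; lia|lia].
    have bz (t : nat) : b t%:Z = (absz l - t)%N%:R *: (k *: y) + (if t == absz l then - m l (p (- l) y) else 0).
      rewrite bE; case: ltP => lt.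
        rewrite (_ : (t == _) = false); last by apply/eqP; lia.
        rewrite addr0 scalerA; congr (_ * _ *: _).
        by rewrite pmulrn; congr (_%:~R); lia.
      have -> : (absz l - t)%N = 0%N by lia.
      rewrite scale0r add0r (_ : (t == absz l) = (t%:Z == l)); last by apply/eqP/eqP; lia.
      by case: eqP.
    by rewrite !bz !az addr0 sub0r.
  - have az : a 0 = m l (p (- l) y) by rewrite aE l0.
    have bz : b 0 = - m l (p (- l) y) by rewrite bE l0.
    have aS (t : nat) : a t.+1%:Z = 0 by rewrite aE !ifF //; lia.
    have bS (t : nat) : b t.+1%:Z = 0 by rewrite bE !ifF //; lia.
    rewrite /M addnS big_ord_recl big1 => [|j _]; last by rewrite lift0 !aS !bS !addr0 subrr.
    have l2 : l%:~R ^+ 2 = 0 :> F by rewrite l0 mulr0z expr0n.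
    by rewrite az bz aS bS l2; lmod F.
by lmod_core F; field; rewrite ?k0 ?two.
Qed.
End Singular.

Section Span.
Variables (F : fieldType) (V : lmodType F).
Implicit Types (P Q : V -> Prop).

Inductive lspan P : V -> Prop :=
| lspan0 : lspan P 0
| lspan_cons c x y : P x -> lspan P y -> lspan P (c *: x + y).

Lemma lspan_in P x : P x -> lspan P x.
Proof. by move=> Px; rewrite -[x]addr0 -[x]scale1r; apply: lspan_cons Px (lspan0 P). Qed.

Lemma lspanD P x y : lspan P x -> lspan P y -> lspan P (x + y).
Proof.
elim=> {x} [|c x z Px _ IH] hy; first by rewrite add0r.
by rewrite -addrA; apply: lspan_cons => //; apply: IH.
Qed.

Lemma lspanZ P c x : lspan P x -> lspan P (c *: x).
Proof.
elim=> {x} [|d x z Px _ IH]; first by rewrite scaler0; apply: lspan0.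
by rewrite scalerDr scalerA; apply: lspan_cons.
Qed.

Lemma lspan_subspace P : subspace (lspan P).
Proof. by split=> [|a u v hu hv]; [apply: lspan0|apply: lspanD => //; apply: lspanZ]. Qed.

Lemma lspan_sum P (I : Type) (r : seq I) (f : I -> V) : (forall i, lspan P (f i)) ->
  lspan P (\sum_(i <- r) f i).
Proof.
move=> hf; elim: r => [|i r IH]; first by rewrite big_nil; apply: lspan0.
by rewrite big_cons; apply: lspanD.
Qed.

Lemma lspan_min P (S : V -> Prop) x : subspace S -> (forall y, P y -> S y) -> lspan P x -> S x.
Proof. by move=> [S0 SD] PS; elim=> // c {}x y /PS Sx _ Sy; apply: SD. Qed.

Lemma lspanP P x : lspan P x -> exists n (c : 'I_n -> F) (y : 'I_n -> V),
  x = \sum_i c i *: y i /\ forall i, P (y i).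
Proof.
move=> hx; suff [s sP ->] : exists2 s : seq (F * V), (forall q, List.In q s -> P q.2) &
    x = \sum_(q <- s) q.1 *: q.2.
  exists (size s), (fun i => (nth (0, 0) s i).1), (fun i => (nth (0, 0) s i).2); split.
    by rewrite (big_nth (0, 0)) big_mkord.
  move=> [i /= lt_i]; apply: sP; elim: s i lt_i => // q s IH [|i] /=; first by left.
  by move=> lt_i; right; apply: IH.
elim: hx => [|c y z Py _ [s sP ->]]; first by exists [::] => //; rewrite big_nil.
by exists ((c, y) :: s); [move=> q [<-|/sP]|rewrite big_cons].
Qed.

Lemma lspan_map (W : lmodType F) (f : V -> W) P (Q : W -> Prop) x :
  linear f -> (forall y, P y -> Q (f y)) -> subspace Q -> lspan P x -> Q (f x).
Proof.
move=> lf PQ [Q0 QD]; elim=> [|c y z Py _ IH]; first by rewrite (lin0 lf).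
by rewrite lf; apply: QD => //; apply: PQ.
Qed.

Lemma subspaceZ (S : V -> Prop) c x : subspace S -> S x -> S (c *: x).
Proof. by move=> [S0 SD] Sx; rewrite -[_ *: _]addr0; apply: SD. Qed.
Lemma subspaceD (S : V -> Prop) x y : subspace S -> S x -> S y -> S (x + y).
Proof. by move=> [S0 SD] Sx Sy; rewrite -[x]scale1r; apply: SD. Qed.
Lemma subspaceB (S : V -> Prop) x y : subspace S -> S x -> S y -> S (x - y).
Proof. by move=> Ss Sx Sy; apply: subspaceD => //; rewrite -scaleN1r; apply: subspaceZ. Qed.
Lemma subspace_sum (S : V -> Prop) (I : Type) (r : seq I) (f : I -> V) : subspace S ->
  (forall i, S (f i)) -> S (\sum_(i <- r) f i).
Proof.
move=> Ss hf; elim: r => [|i r IH]; first by rewrite big_nil; apply: (proj1 Ss).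
by rewrite big_cons; apply: subspaceD.
Qed.

Lemma geigenZ (f : V -> V) h c x : linear f -> geigen f h x -> geigen f h (c *: x).
Proof.
move=> lf [p hp]; exists p.
rewrite (linZ (@iter_linear _ _ (fun x => f x - h *: x) _ p)) ?hp ?scaler0 //.
by move=> a u v; rewrite /= lf; lmod F.
Qed.

Lemma geigen0 (f : V -> V) h : geigen f h 0. Proof. by exists 0%N. Qed.
End Span.

(** * Words in modes of negative degree *)

Section Words.
Variables (F : fieldType) (k : F).
Hypothesis F0 : forall n, (n%:R == 0 :> F) = (n == 0)%N.
Hypothesis k0 : k != 0.
Variable W : smod (agl11 F).
Hypothesis Wk : level k W.
Variables (Y : Vk k -> int -> Vk k -> Vk k) (hY : affine_vsa Y).
Variables (YW : Vk k -> int -> W -> W).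
Hypothesis hW : vertex_structure hY YW.
Variable s : int.
Local Notation D := (Dop YW s).
Local Notation deg := (@deg F s).

Lemma geigen_act h x (a : agl11 F) : geigen D h x -> geigen D (h - (deg a)%:~R) (act a x).
Proof.
move=> [n hn]; exists n.
suff -> : iter n (fun y => D y - (h - (deg a)%:~R) *: y) (act a x) =
    act a (iter n (fun y => D y - h *: y) x) by rewrite hn act0.
elim: n {hn} => // n IH; rewrite !iterS IH; move: (iter n _ x) => y.
by rewrite (Dop_act F0 k0 Wk hW) [RHS](linB (@act_linear _ _ W a)) actZ; lmod F.
Qed.

Section Base.
(* [xs h x]: x is a generator of generalized weight h; a word is a product of
   modes of negative degree applied to a generator. *)
Variable xs : F -> W -> Prop.

Inductive word : F -> nat -> W -> Prop :=
| word0 h x : xs h x -> word h 0 x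
| wordS h d e (a : agl11 F) x : word h d x -> deg a = - e.+1%:Z -> word h (d + e.+1) (act a x).

Definition words x := exists h d, word h d x.
Definition gens x := exists h, xs h x.

Hypothesis xs_stable : forall h x (a : agl11 F), xs h x -> 0 <= deg a -> lspan gens (act a x).

Lemma gens_words x : lspan gens x -> lspan words x.
Proof.
apply: lspan_min; first exact: lspan_subspace.
by move=> y [h hy]; apply: lspan_in; exists h, 0%N; apply: word0.
Qed.

Lemma words_neg (a : agl11 F) x : deg a < 0 -> lspan words x -> lspan words (act a x).
Proof.
move=> a0; apply: lspan_map; [exact: act_linear| |exact: lspan_subspace].
move=> y [h [d hy]]; apply: lspan_in; exists h, (d + (absz (deg a)).-1.+1)%N.
apply: wordS => //; lia.
Qed.

(** Any mode is commuted to the right until it meets a generator; there [xs_stable] deals with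
    nonnegative degree, while a mode of negative degree starts a new word. Letters are not ordered,
    so they can be put back in front. *)
Lemma words_stable (a : agl11 F) x : lspan words x -> lspan words (act a x).
Proof.
move=> hx; apply: (lspan_map (P := words)) hx; [exact: act_linear| |exact: lspan_subspace].
move=> y [h [d hy]]; elim: hy a => {x h d y} [h x hx|h d e b x hx IH eb] a.
  have [a0|a0] := leP 0 (deg a); first by apply: gens_words; apply: xs_stable hx a0.
  by apply: words_neg => //; apply: gens_words; apply: lspan_in; exists h.
rewrite act_swap; apply: lspanD; last by apply: lspan_sum => q; apply: lspanZ; apply: IH.
by apply: lspanZ; apply: words_neg => //; rewrite eb; lia.
Qed.

Hypothesis xs_eigen : forall h x, xs h x -> geigen D h x.

Lemma word_eigen h d x : word h d x -> geigen D (h + d%:R) x.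
Proof.
elim=> {h d x} [h x /xs_eigen|h d e a x _ IH ea]; first by rewrite addr0.
have := geigen_act a IH; rewrite ea rmorphN opprK /= -pmulrn => H.
by rewrite natrD addrA.
Qed.

(** The polynomial of [geigen_projection], applied to an expansion of [x] in words, fixes [x] and
    removes the words of other weights. *)
Lemma words_weight c x : lspan words x -> geigen D c x ->
  lspan (fun y => exists h d, word h d y /\ h + d%:R = c) x.
Proof.
move=> /lspanP [n [b [y [xE hy]]]] [r hr].
pose h i := projT1 (cid (hy i)); have hh i : exists d, word (h i) d (y i) := projT2 (cid (hy i)).
pose d i := projT1 (cid (hh i)); have hd i : word (h i) (d i) (y i) := projT2 (cid (hh i)).
have lD := Dop_linear hW s.
have [q [qy qx]] := geigen_projection c r lD (fun i => word_eigen (hd i)).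
rewrite -(qx _ _ _ lD hr) xE (lin_sum (pact_linear lD q)); apply: lspan_sum => i.
rewrite (linZ (pact_linear lD q)) qy; apply: lspanZ; case: eqP => e; last exact: lspan0.
by apply: lspan_in; exists (h i), (d i).
Qed.

Lemma word_base h d x : word h d x -> exists x0, xs h x0.
Proof. by elim=> // {h d x} h x hx; exists x. Qed.

Lemma words_weight_eq0 c x : lspan words x -> geigen D c x ->
  (forall h d y, word h d y -> h + d%:R <> c) -> x = 0.
Proof.
move=> wx cx hc; have := words_weight wx cx.
apply: (lspan_min (S := fun x => x = 0)); last by move=> y [h [d [/hc]]].
by split=> // a u v -> ->; rewrite scaler0 addr0.
Qed.
End Base.
End Words.

(** * Grading by the conformal weight *)

Section Grading.
Variables (F : fieldType) (k : F).
Hypothesis F0 : forall n, (n%:R == 0 :> F) = (n == 0)%N.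
Hypothesis k0 : k != 0.
Variable W : smod (agl11 F).
Hypothesis Wk : level k W.
Variables (Y : Vk k -> int -> Vk k -> Vk k) (hY : affine_vsa Y).
Variables (YW : Vk k -> int -> W -> W).
Hypothesis hW : vertex_structure hY YW.
Variable L : seq (F * W).
Local Notation xs := (fun h x => (h, x) \in L).
Hypothesis xs_stable : forall h x (a : agl11 F), (h, x) \in L -> 0 <= deg 0 a ->
  lspan (gens xs) (act a x).
Hypothesis xs_eigen : forall h x, (h, x) \in L -> geigen (Dop YW 0) h x.
Hypothesis xs_gen : forall w, lspan (words 0 xs) w.

Lemma Dop0 : Dop YW 0 = YW (omega k) 1.
Proof. by apply/funext => w; rewrite /Dop scale0r subr0. Qed.

Definition letters (J : nat) : seq (agl11 F) :=
  [seq mode F a (- e%:Z) | a <- [:: gN; gE; gpsip; gpsim], e <- iota 0 J.+1].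

Fixpoint word_list (J : nat) : seq W :=
  if J is J'.+1 then word_list J' ++ [seq act q y | q <- letters J'.+1, y <- word_list J']
  else map snd L.

Lemma word_listP J h d x : word 0 xs h d x -> (d <= J)%N -> x \in word_list J.
Proof.
have base h' x' J' : (h', x') \in L -> x' \in word_list J'.
  elim: J' => [|J' IH] hx; first by apply/mapP; exists (h', x').
  by rewrite /= mem_cat IH.
move=> hx; elim: hx J => {h d x} [h x hx|h d e a x _ IH ea] J dJ; first exact: base hx.
case: J dJ => [|J] dJ; first by rewrite addnS in dJ.
rewrite -[word_list _]/(word_list J ++ _) mem_cat; apply/orP; right.
apply/allpairsP; exists (a, x); split=> //=; last by apply: IH; lia.
case: a ea => [[a r]|] //= ea.
have rE : r = - e.+1%:Z by case: a ea; rewrite ?addr0 ?subr0.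
rewrite rE; apply/allpairsP; exists (a, e.+1); split=> //; first by case: (a); rewrite !inE.
by rewrite mem_iota /=; lia.
Qed.

Lemma weight_bound h : exists J, forall h' x (d : nat), (h', x) \in L -> h' + d%:R = h -> (d <= J)%N.
Proof.
  elim: (L) => [|[h1 x1] L' [J IH]]; first by exists 0%N.
  have [[d1 e1]|no] := pselect (exists d : nat, h1 + d%:R = h); last first.
    exists J => h' x d; rewrite inE => /orP[/eqP [-> _] e|]; last exact: IH.
    by case: no; exists d.
  exists (maxn J d1) => h' x d; rewrite inE => /orP[/eqP [-> _] e|hx e]; last first.
    by rewrite leq_max (IH _ _ _ hx e).
  have /eqP : h1 + d%:R = h1 + d1%:R by rewrite e e1.
  rewrite (inj_eq (addrI h1)) leq_max => /eqP dd.
  suff -> : d = d1 by rewrite leqnn orbT.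
  wlog dd1 : d d1 {e e1} dd / (d <= d1)%N.
    by move=> H; case/orP: (leq_total d d1) => ?; [apply: H|symmetry; apply: H].
  have := F0 (d1 - d); rewrite natrB // dd subrr eqxx => /esym /eqP e0; lia.
Qed.

Lemma spanned_finite (P : W -> Prop) (r : seq W) : (forall x, P x -> x \in r) ->
  forall w, lspan P w -> exists c : 'I_(size r) -> F, w = \sum_i c i *: nth 0 r i.
Proof.
move=> Pr w; elim=> [|c x y /Pr xr _ [b ->]].
  by exists (fun=> 0); rewrite big1 // => i _; rewrite scale0r.
have ir : (index x r < size r)%N by rewrite index_mem.
exists (fun i => (if i == Ordinal ir then c else 0) + b i).
under [in RHS]eq_bigr do rewrite scalerDl; rewrite [RHS]big_split; congr (_ + _).
rewrite (bigD1 (Ordinal ir)) //= eqxx nth_index // big1 ?addr0 // => i /negbTE ->.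
by rewrite scale0r.
Qed.

(** There are finitely many generators, and every letter raises the weight by a positive integer; so
    each weight has finitely many words, and weights far below a given one in its coset have
    none. *)
Lemma words_grading (hvm : vertex_structure hY YW) : grading_restricted (to_vmod hvm).
Proof.
have lD := Dop_linear hW 0; rewrite Dop0 in lD.
have we h d x (hx : word 0 xs h d x) : geigen (YW (omega k) 1) (h + d%:R) x.
  by rewrite -Dop0; apply: (word_eigen F0 k0 Wk hW xs_eigen hx).
split=> [w|h|h].
- have [n [c [x [-> hx]]]] := lspanP (xs_gen w).
  pose hh i := projT1 (cid (hx i)); have h2 i : exists d, word 0 xs (hh i) d (x i) := projT2 (cid (hx i)).
  pose d i := projT1 (cid (h2 i)); have hd i : word 0 xs (hh i) (d i) (x i) := projT2 (cid (h2 i)).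
  exists n, (fun i => hh i + (d i)%:R), (fun i => c i *: x i); split=> // i.
  by have := geigenZ (c i) lD (we _ _ _ (hd i)).
- have [J hJ] := weight_bound h; pose r := word_list J.
  exists (size r), (fun i => nth 0 r i) => w hw.
  apply: (@spanned_finite (fun y => exists h' d, word 0 xs h' d y /\ h' + d%:R = h)).
    by move=> x [h' [d [hx e]]]; have [x0 hx0] := word_base hx; apply: (word_listP hx); apply: hJ hx0 e.
  apply: (words_weight F0 k0 Wk hW xs_eigen (xs_gen w)).
  by rewrite Dop0.
- have [J hJ] := weight_bound h; exists J.+1 => n Jn w hw.
  apply: (words_weight_eq0 F0 k0 Wk hW xs_eigen (xs_gen w) (c := h - n%:R)).
    by rewrite Dop0.
  move=> h' d y hy e; have [x0 hx0] := word_base hy.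
  have h0 : h' + (d + n)%N%:R = h by rewrite natrD addrA e subrK.
  by have := hJ _ _ _ hx0 h0; lia.
Qed.

Lemma words_semisimple (f : W -> W) : linear f ->
  (forall h d x, word 0 xs h d x -> exists c, f x = c *: x) -> semisimple f.
Proof.
move=> lf hf w; have [n [c [x [-> hx]]]] := lspanP (xs_gen w).
have hc i : exists b, f (x i) = b *: x i by have [h [d /hf]] := hx i.
exists n, (fun i => projT1 (cid (hc i))), (fun i => c i *: x i); split=> // i.
by rewrite (linZ lf) {1}(projT2 (cid (hc i))) !scalerA mulrC.
Qed.
End Grading.

(** * Vectors of type (n, l) and the weights of D *)

Section AtypicalVectors.
Variables (F : fieldType) (k : F).
Hypothesis F0 : forall n, (n%:R == 0 :> F) = (n == 0)%N.
Hypothesis k0 : k != 0.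
Variable W : smod (agl11 F).
Hypothesis Wk : level k W.
Implicit Types (r s i j l : int) (w x y : W).
Local Notation N r := (@act F (agl11 F) W (mode F gN r)).
Local Notation E r := (@act F (agl11 F) W (mode F gE r)).
Local Notation p r := (@act F (agl11 F) W (mode F gpsip r)).
Local Notation m r := (@act F (agl11 F) W (mode F gpsim r)).

Lemma absz_natr (z : int) : 0 <= z -> (absz z)%:R = z%:~R :> F.
Proof. by move=> z0; rewrite pmulrn gez0_abs. Qed.

Definition vtype (n : F) l w : Prop := sing l (- l) w /\ etype n (l%:~R * k) w.

Definition generated w : Prop := forall S : W -> Prop, subspace S ->
  (forall (a : agl11 F) y, S y -> S (act a y)) -> S w -> forall y, S y.

Lemma E0_comm (a : agl11 F) w : E 0 (act a w) = act a (E 0 w).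
Proof.
case: a => [[a r]|]; last by rewrite !Wk actZ.
rewrite -[Some _]/(mode F a r); case: a.
- by rewrite (brEN Wk) mul0r (_ : (if _ then _ else _) = 0) ?scale0r ?addr0 //; case: ifP.
- exact: brEE.
- exact: brEp.
- exact: brEm.
Qed.

Lemma generated_E0 n l w : vtype n l w -> generated w -> forall y, E 0 y = (l%:~R * k) *: y.
Proof.
move=> [_ [_ hE]] gw; apply: gw => // [|a y hy]; last by rewrite E0_comm hy actZ.
split=> [|c u v hu hv]; first by rewrite act0 scaler0.
by rewrite act_linear hu hv scalerDr scalerCA.
Qed.

Lemma zero_stable l (B : W -> Prop) :
  (forall x, B x -> [/\ sing l (- l) x, exists n, etype n (l%:~R * k) x,
     lspan B (p (- l) x) & lspan B (m l x)]) ->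
  forall x (a : agl11 F), B x -> 0 <= deg l a -> lspan B (act a x).
Proof.
move=> hB x a Bx; have [[hN hE hm hp] [n [n0 e0]] px mx] := hB x Bx.
case: a => [[a r]|]; last by rewrite Wk => _; apply: lspanZ; apply: lspan_in.
rewrite -[Some _]/(mode F a r); case: a => /= r0.
- have [->|rn] := eqVneq r 0; first by rewrite n0; apply: lspanZ; apply: lspan_in.
  by rewrite hN; [apply: lspan0|lia].
- have [->|rn] := eqVneq r 0; first by rewrite e0; apply: lspanZ; apply: lspan_in.
  by rewrite hE; [apply: lspan0|lia].
- have [->|rn] := eqVneq r (- l); first exact: px.
  by rewrite hp; [apply: lspan0|lia].
- have [->|rn] := eqVneq r l; first exact: mx.
  by rewrite hm; [apply: lspan0|lia].
Qed.

Variables (Y : Vk k -> int -> Vk k -> Vk k) (hY : affine_vsa Y).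
Variables (YW : Vk k -> int -> W -> W).
Hypothesis hW : vertex_structure hY YW.
Local Notation D s := (Dop YW s).

Lemma Dop_sing2 l y : sing l (- l) y -> E 0 y = (l%:~R * k) *: y -> D l (D l y) = 0.
Proof.
move=> sy ey; rewrite (Dop_sing F0 k0 Wk hW sy ey) (linZ (Dop_linear hW l)).
rewrite (Dop_sing F0 k0 Wk hW); last by rewrite brEm brEp ey !actZ.
  by rewrite (zero_nilp F0 Wk ey) !scaler0.
by apply: (sing_zero_m F0 k0 Wk); apply: (sing_zero_p F0 k0 Wk).
Qed.

Lemma geigen_sing l y : sing l (- l) y -> E 0 y = (l%:~R * k) *: y -> geigen (D l) 0 y.
Proof. by move=> sy ey; exists 2%N; rewrite /= !scale0r !subr0 Dop_sing2. Qed.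

Lemma Dop_shift l n h y : N 0 y = n *: y -> geigen (D l) h y <-> geigen (D 0) (h + l%:~R * n) y.
Proof.
move=> hN; have E1 q : iter q (fun x => D l x - h *: x) y = iter q (fun x => D 0 x - (h + l%:~R * n) *: x) y
    /\ N 0 (iter q (fun x => D l x - h *: x) y) = n *: iter q (fun x => D l x - h *: x) y.
  elim: q => [//|q [IH1 IH2]]; rewrite !iterS -IH1; move: (iter q _ y) IH2 => {IH1} z hz.
  split; first by rewrite /Dop hz scale0r; lmod F.
  have := Dop_act F0 k0 Wk hW l (mode F gN 0) z; rewrite mulr0z scale0r subr0 hz => e.
  by rewrite (linB (@act_linear _ _ W _)) actZ hz -e (linZ (Dop_linear hW l)) scalerBr scalerCA.
by split=> -[q hq]; exists q; rewrite ?(proj1 (E1 q)) // -(proj1 (E1 q)).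
Qed.

(* Killing vectors by the remaining positive modes of the spectral flow. *)
Lemma lower_sing l i j n h y : l <= i -> - l <= j -> sing i j y -> y <> 0 ->
  etype n (l%:~R * k) y -> geigen (D l) h y ->
  exists y' n' (d : nat), [/\ y' <> 0, sing l (- l) y', etype n' (l%:~R * k) y' & geigen (D l) (h - d%:R) y'].
Proof.
(* Induction on [i + j], the number of odd modes of positive twisted degree that may still act
   nontrivially. The top one either kills [y] or replaces it and lowers its weight by the degree of
   the mode. *)
move=> li lj; have [d] : exists d : nat, i + j = d%:Z by exists (absz (i + j)); lia.
elim: d i j n h y li lj => [|d IH] i j n h y li lj ij sy y0 ey gy.
  exists y, n, 0%N; rewrite subr0; split=> //.
  have -> : - l = j by lia.
  by have -> : l = i by lia.
have [il|il] := eqVneq i l.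
  have [p0|p0] := pselect (p j y = 0).
    apply: (IH i (j - 1)) y0 ey gy; rewrite ?il //; try lia.
    case: sy => hN hE hm hp; split=> // r hr; first by apply: hm; lia.
    by have [->|rj] := eqVneq r j; [exact: p0|apply: hp; lia].
  have [|||||||y' [n' [e [h1 h2 h3 h4]]]] := IH i (j - 1) (n + 1) (h - (j + l)%:~R) (p j y); try lia.
  - by apply: sing_p => //; lia.
  - exact: p0.
  - exact: etype_p.
  - exact: (geigen_act F0 k0 Wk hW (mode F gpsip j) gy).
  exists y', n', (absz (j + l)%R + e)%N; split=> //.
  by rewrite natrD absz_natr ?opprD ?addrA //; lia.
have [m0|m0] := pselect (m i y = 0).
  apply: (IH (i - 1) j) y0 ey gy; try lia.
  case: sy => hN hE hm hp; split=> // r hr.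
  by have [->|rj] := eqVneq r i; [exact: m0|apply: hm; lia].
have [|||||||y' [n' [e [h1 h2 h3 h4]]]] := IH (i - 1) j (n - 1) (h - (i - l)%:~R) (m i y); try lia.
- by apply: sing_m => //; lia.
- exact: m0.
- exact: etype_m.
- exact: (geigen_act F0 k0 Wk hW (mode F gpsim i) gy).
exists y', n', (absz (i - l)%R + e)%N; split=> //.
by rewrite natrD absz_natr ?opprD ?addrA //; lia.
Qed.

Lemma geigen_disjoint (V : lmodType F) (f : V -> V) (h h' : F) (x : V) : linear f ->
  geigen f h x -> geigen f h' x -> h <> h' -> x = 0.
Proof.
move=> lf hx [r hr] hh.
have [q [qx qz]] := geigen_projection (n := 1) (c := fun=> h) (x := fun=> x) h' r lf (fun=> hx).
by rewrite -(qz _ _ _ lf hr) (qx ord0); case: eqP.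
Qed.

(* Lower boundedness of the conformal weights bounds the weights of D from
   below, although neither operator determines the other. *)
Lemma weight_nat n l h y : y <> 0 -> etype n (l%:~R * k) y -> geigen (D 0) h y ->
  (exists M : nat, forall M', (M <= M')%N -> forall z, geigen (D 0) (h - M'%:R) z -> z = 0) ->
  exists d : nat, h - l%:~R * n = d%:R.
Proof.
move=> y0 ey gy [M]; elim: M n h y y0 ey gy => [|M IH] n h y y0 ey gy hM.
  by case: y0; apply: (hM 0%N) => //; rewrite subr0.
(* Modes positive for both degrees are applied as long as possible; each lowers the [L_0]-weight by
   at least one, which is what the induction on [M] counts. Once they all kill [y], the bounds
   required by [lower_sing] hold. *)
pose T (a : agl11 F) := (0 < deg 0 a) && (0 < deg l a).
have [[a /andP[a0 al] ay]|no] := pselect (exists2 a : agl11 F, T a & act a y <> 0).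
  have gay := geigen_act F0 k0 Wk hW a gy.
  have [n' ea dn] : exists2 n', etype n' (l%:~R * k) (act a y) & (deg l a)%:~R = (deg 0 a)%:~R + l%:~R * (n' - n).
    case: a {gay ay} a0 al => [[a r]|] // a0 al; rewrite -[Some _]/(mode F a r); case: a a0 al => a0 al.
    - by exists n; [apply: (proj1 (etype_NE _ _ ey))|rewrite /= subrr mulr0 addr0].
    - by exists n; [apply: (proj2 (etype_NE _ _ ey))|rewrite /= subrr mulr0 addr0].
    - by exists (n + 1); [exact: etype_p|rewrite /= addr0 rmorphD /=; ring].
    - by exists (n - 1); [exact: etype_m|rewrite /= subr0 rmorphB /=; ring].
  have [|d hd] := IH n' _ _ ay ea gay.
    move=> M' MM' z; have -> : h - (deg 0 a)%:~R - M'%:R = h - (absz (deg 0 a) + M')%N%:R.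
      by rewrite natrD absz_natr ?opprD ?addrA //; lia.
    by apply: hM; lia.
  exists (d + absz (deg l a))%N; rewrite natrD -hd absz_natr; last by lia.
  by rewrite dn; ring.
have T0 (a : agl11 F) : T a -> act a y = 0.
  by move=> Ta; apply/eqP; case: eqP => // ay; case: no; exists a.
have sy : sing (Num.max 0 l) (Num.max 0 (- l)) y.
  by split=> r hr; apply: T0; rewrite /T /=; lia.
have gy' : geigen (D l) (h - l%:~R * n) y by apply/(Dop_shift _ _ (proj1 ey)); rewrite subrK.
have [||y' [n' [d [y'0 sy' ey' g']]]] := lower_sing _ _ sy y0 ey gy'; try lia.
(* The vector [y'] has weight [h - l n - d] by construction and weight [0] by nilpotency of [D];
   since it is nonzero, the two agree. *)
have g0 := geigen_sing sy' (proj2 ey').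
exists d; apply/eqP; rewrite -subr_eq0; apply/eqP; apply: contrapT => ne.
by apply: y'0; apply: geigen_disjoint (Dop_linear hW l) g' g0 ne.
Qed.
End AtypicalVectors.

(** * Finite length *)

Section QuotientModule.
Variables (F : fieldType) (g : liesuper F) (W : smod g) (S : W -> Prop).
Hypothesis Ssub : smod_sub S.
Let hS : subspace S := let: And3 h _ _ := Ssub in h.
Let hSp : forall w, S w -> S (par w) := let: And3 _ h _ := Ssub in h.
Let hSa : forall a w, S w -> S (act a w) := let: And3 _ _ h := Ssub in h.
Local Notation pi := (lpi hS).
Local Notation mapE := (fun lf hf => lquot_mapE hS lf hf).

Fact quot_parK : involutive (@lquot_map F W S hS (@par F W)).
Proof.
by move=> q; rewrite -[q]lreprK !(mapE (@par_linear F W) hSp) parK.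
Qed.

Definition quot_space : superspace F :=
  @Superspace F (lquot hS) (@lquot_map F W S hS (@par F W)) (@lquot_map_linear F W S hS _ (@par_linear F W) hSp) quot_parK.

Definition quot_act (a : g) : quot_space -> quot_space := @lquot_map F W S hS (act a).

Let actE a x : quot_act a (pi x) = pi (act a x).
Proof. exact: (mapE (@act_linear F g W a) (@hSa a)). Qed.
Let parE x : @par F quot_space (pi x) = pi (par x).
Proof. exact: (mapE (@par_linear F W) hSp). Qed.
Let piZ c x : pi (c *: x) = c *: pi x.
Proof. exact: linZ (lpi_linear hS) _ _. Qed.
Let pi_sum (I : Type) (r : seq I) (h : I -> W) : pi (\sum_(i <- r) h i) = \sum_(i <- r) pi (h i).
Proof. exact: (@lin_sum F W (lquot hS) _ (lpi_linear hS) I r h). Qed.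

Fact quot_act_linear a : linear (quot_act a).
Proof. exact: (@lquot_map_linear F W S hS _ (@act_linear F g W a) (@hSa a)). Qed.
Fact quot_act_par a w : par (quot_act a w) = sgn F (lpar a) *: quot_act a (par w).
Proof. by rewrite -[w]lreprK actE !parE actE act_par piZ. Qed.
Fact quot_act_br a b w :
  quot_act a (quot_act b w) - sgn F (lpar a && lpar b) *: quot_act b (quot_act a w) =
  \sum_(p <- lbr a b) p.1 *: quot_act p.2 w.
Proof.
rewrite -[w]lreprK !actE -piZ -lpiB act_br pi_sum.
by apply: eq_bigr => p _; rewrite piZ actE.
Qed.

Definition quot_smod : smod g := @Smod F g quot_space quot_act quot_act_linear quot_act_par quot_act_br.
Definition quot_pi (w : W) : quot_smod := pi w.

Lemma quot_pi_linear : linear quot_pi. Proof. exact: lpi_linear. Qed.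
Lemma quot_pi_act a w : quot_pi (act a w) = act a (quot_pi w). Proof. by rewrite -[RHS]/(quot_act _ _) actE. Qed.
Lemma quot_pi_par w : par (quot_pi w) = quot_pi (par w). Proof. exact: parE. Qed.
Lemma quot_pi_eq0 w : quot_pi w = 0 <-> S w.
Proof.
rewrite -(lin0 quot_pi_linear) -[X in _ <-> S X]subr0; exact: lpi_eq.
Qed.
Lemma quot_pi_surj : surj quot_pi.
Proof. by move=> q; exists (lrepr q); apply: lreprK. Qed.
End QuotientModule.

Section HomogeneousComponents.
Variables (F : fieldType) (V : lmodType F) (f : V -> V).
Hypothesis lf : linear f.

Lemma geigenD h x y : geigen f h x -> geigen f h y -> geigen f h (x + y).
Proof.
move=> [p hp] [q hq]; exists (maxn p q).
have lg : linear (fun x => f x - h *: x) by move=> c u v; rewrite lf; lmod F.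
by rewrite (linD (iter_linear lg _)) (geigen_le lf hp) ?leq_maxl // (geigen_le lf hq) ?leq_maxr // addr0.
Qed.

(** Stability under [f] puts the homogeneous components of the sum, which are polynomials in [f]
    applied to it, into [T]. In characteristic zero distinct natural numbers are distinct
    weights. *)
Lemma homogeneous_component (T S : V -> Prop) (m : nat) (h : 'I_m -> nat) (x : 'I_m -> V) :
  (forall n, (n%:R == 0 :> F) = (n == 0)%N) ->
  subspace T -> subspace S -> (forall v, T v -> T (f v)) ->
  (forall i, geigen f (h i)%:R (x i)) -> T (\sum_i x i) ->
  (forall (d : nat) v, geigen f d%:R v -> T v -> S v) -> S (\sum_i x i).
Proof.
move=> F0 hT hS fT hx Tx TS; pose M := (\max_i h i).+1.
have -> : \sum_i x i = \sum_(e < M) \sum_(i | h i == e :> nat) x i.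
  rewrite (partition_big (fun i => inord (h i) : 'I_M) predT) //=.
  apply: eq_bigr => e _; apply: eq_bigl => i.
  by rewrite -val_eqE /= inordK // ltnS; apply: leq_bigmax.
apply: subspace_sum => // e; apply: (TS e).
  by elim/big_ind: _ => [|u v|i /eqP <- //]; [exact: geigen0|exact: geigenD].
have [q [qx _]] := geigen_projection (c := fun i => (h i)%:R) (x := x) e%:R 0 lf hx.
have -> : \sum_(i | h i == e :> nat) x i = pact f q (\sum_i x i).
  rewrite (lin_sum (pact_linear lf q)) big_mkcond; apply: eq_bigr => i _.
  rewrite qx; congr (if _ then _ else _).
  have natP (a b : nat) : (b <= a)%N -> (a == b) = (a%:R == b%:R :> F).
    by move=> ba; rewrite -subr_eq0 -natrB // F0 subn_eq0 eqn_leq ba andbT.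
  by case: (leqP e (h i)) => [|/ltnW] /natP //; rewrite eq_sym => ->; rewrite eq_sym.
exact: pact_stable.
Qed.
End HomogeneousComponents.

Section CompositionSeries.
Variables (F : fieldType) (V : vsalg F) (W : vmod V).

Definition simple_or_trivial (S S' : W -> Prop) : Prop := forall T : W -> Prop, vsub T ->
  (forall w, S w -> T w) -> (forall w, T w -> S' w) ->
  (forall w, T w -> S w) \/ (forall w, S' w -> T w).

(** Consecutive layers may coincide, whereas a composition series has strict inclusions: repeated
    terms are dropped. *)
Lemma prune_series d (S : nat -> W -> Prop) :
  (forall w, S 0%N w <-> w = 0) -> (forall i, vsub (S i)) ->
  (forall i w, S i w -> S i.+1 w) -> (forall i, (i < d)%N -> simple_or_trivial (S i) (S i.+1)) ->
  exists (d' : nat) (S' : nat -> W -> Prop), [/\ forall w, S' 0%N w <-> w = 0, S' d' = S d,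
      forall i, (i <= d')%N -> vsub (S' i) &
      forall i, (i < d')%N ->
        [/\ forall w, S' i w -> S' i.+1 w, exists w, S' i.+1 w /\ ~ S' i w & simple_or_trivial (S' i) (S' i.+1)]].
Proof.
move=> S0 Ssub Smon; elim: d => [|d IH] Sst; first by exists 0%N, S; split=> // i _; apply: Ssub.
have [|d' [S' [h0 hd hs hst]]] := IH; first by move=> i id; apply: Sst; lia.
have [e|ne] := pselect (forall w, S d.+1 w -> S d w).
  exists d', S'; split=> //; rewrite hd; apply/funext => w; apply/propext; split; [exact: Smon|exact: e].
exists d'.+1, (fun i => if (i <= d')%N then S' i else S d.+1); split=> //.
- by rewrite ltnn.
- by move=> i _; case: ifP => // /hs.
- move=> i id; rewrite ltnS in id; rewrite id; case: (ltnP i d') => [/hst //|d'i].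
  have -> : i = d' by lia.
  rewrite hd; split; [exact: Smon| |exact: Sst].
  apply: contrapT => no; apply: ne => w Sw; apply: contrapT => nS; apply: no; by exists w.
Qed.
End CompositionSeries.

Lemma geigen_morph (F : fieldType) (V U : lmodType F) (f : V -> V) (g : U -> U) (q : V -> U) c x :
  linear q -> (forall y, q (f y) = g (q y)) -> geigen f c x -> geigen g c (q x).
Proof.
move=> lq qf [r hr]; exists r; rewrite -(lin0 lq) -hr; elim: r {hr} => // r IH.
by rewrite !iterS IH (linB lq) (linZ lq) qf.
Qed.

(** * The layers of a generated module *)

Section FiniteLength.
Variables (F : fieldType) (k : F).
Hypothesis F0 : forall n, (n%:R == 0 :> F) = (n == 0)%N.
Hypothesis k0 : k != 0.
Variable W : smod (agl11 F).
Hypothesis Wk : level k W.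
Variables (Y : Vk k -> int -> Vk k -> Vk k) (hY : affine_vsa Y).
Variables (YW : Vk k -> int -> W -> W).
Hypothesis hW : vertex_structure hY YW.
Variables (n : F) (l : int) (b : bool) (v : W).
Hypotheses (v_par : homog b v) (v_type : vtype k n l v) (v_gen : generated v).
Local Notation D := (Dop YW l).
Local Notation p := (@act F (agl11 F) W (mode F gpsip (- l))).
Local Notation m := (@act F (agl11 F) W (mode F gpsim l)).

(** Ordered so that both zero modes send each vector into the span of the earlier ones. From index
    [4] on the default value is [0]. *)
Definition zero_vec (i : nat) : W := nth 0 [:: m (p v); p v; m v; v] i.
Definition zero_base (i : nat) (x : W) : Prop := exists2 j, (j < i)%N & x = zero_vec j.

Lemma zero_vecP j : [/\ sing l (- l) (zero_vec j), exists n', etype n' (l%:~R * k) (zero_vec j),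
  exists c, par (zero_vec j) = c *: zero_vec j,
  lspan (zero_base j) (p (zero_vec j)) & lspan (zero_base j) (m (zero_vec j))].
Proof.
have [sv ev] := v_type; have E0 w := generated_E0 Wk v_type v_gen w.
have par1 (a : agl11 F) (w : W) c : par w = c *: w -> exists c', par (act a w) = c' *: act a w.
  by move=> hc; exists (sgn F (agl11_par a) * c); rewrite act_par hc actZ scalerA.
have zP i : (i < j)%N -> zero_base j (zero_vec i) by move=> ij; exists i.
have sm := sing_zero_m F0 k0 Wk; have sp := sing_zero_p F0 k0 Wk.
have em := fun n => @etype_m F W n (l%:~R * k) l; have ep := fun n => @etype_p F W n (l%:~R * k) (- l).
have [c1 h1] := par1 (mode F gpsip (- l)) _ _ v_par.
have [c2 h2] := par1 (mode F gpsim l) _ _ h1.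
have [c3 h3] := par1 (mode F gpsim l) _ _ v_par.
case: j zP => [|[|[|[|j]]]] zP.
- split; [exact/sm/sp|by exists (n + 1 - 1); apply/em/ep|by exists c2| |].
    by rewrite /zero_vec /= (zero_pm Wk) // (pp0 F0) act0 oppr0; apply: lspan0.
  by rewrite /zero_vec /= (mm0 F0); apply: lspan0.
- split; [exact: sp|by exists (n + 1); apply: ep|by exists c1| |].
    by rewrite /zero_vec /= (pp0 F0); apply: lspan0.
  by apply: lspan_in; apply: (zP 0%N).
- split; [exact: sm|by exists (n - 1); apply: em|by exists c3| |].
    rewrite /zero_vec /= (zero_pm Wk) // -scaleN1r; apply: lspanZ; apply: lspan_in; exact: (zP 0%N).
  by rewrite /zero_vec /= (mm0 F0); apply: lspan0.
- split; [exact: sv|by exists n|by exists (sgn F b)| |].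
    by apply: lspan_in; apply: (zP 1%N).
  by apply: lspan_in; apply: (zP 2%N).
- rewrite /zero_vec /= nth_nil; split.
  + by split=> *; rewrite act0.
  + by exists 0; split; rewrite act0 scaler0.
  + by exists 0; rewrite scaler0 (lin0 (@par_linear _ W)).
  + by rewrite act0; apply: lspan0.
  + by rewrite act0; apply: lspan0.
Qed.

Definition zero_gens (i : nat) (h : F) (x : W) : Prop := h = 0 /\ zero_base i x.
Definition layer (i : nat) : W -> Prop := lspan (words l (zero_gens i)).

Lemma lspan_sub (P Q : W -> Prop) w : (forall x, P x -> Q x) -> lspan P w -> lspan Q w.
Proof. by move=> PQ; elim=> [|c x y /PQ Qx _ hy]; [exact: lspan0|exact: lspan_cons]. Qed.

Lemma zero_gens_stable i h x (a : agl11 F) : zero_gens i h x -> 0 <= deg l a ->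
  lspan (gens (zero_gens i)) (act a x).
Proof.
move=> [_ Bx] a0; apply: (@lspan_sub (zero_base i)) => [y By|]; first by exists 0.
apply: (zero_stable k0 Wk _ Bx a0) => y [j ji ->].
have [hs he _ hp hm] := zero_vecP j.
by split=> //; [move: hp|move: hm]; apply: lspan_sub => z [j' j'j ->]; exists j' => //; lia.
Qed.

Lemma zero_gens_eigen i h x : zero_gens i h x -> geigen D h x.
Proof.
move=> [-> [j _ ->]]; have [hs _ _ _ _] := zero_vecP j.
by apply: (geigen_sing F0 k0 Wk hW) => //; exact: (generated_E0 Wk v_type v_gen).
Qed.

Lemma layer_sub i : smod_sub (layer i).
Proof.
split; first exact: lspan_subspace.
- move=> w; apply: lspan_map; [exact: par_linear| |exact: lspan_subspace].
  move=> y [h [d hy]]; suff [c ->] : exists c, par y = c *: y.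
    by apply: lspanZ; apply: lspan_in; exists h, d.
  elim: hy => {h d y} [h x [_ [j _ ->]]|h d e a x _ [c IH] _].
    by have [_ _] := zero_vecP j.
  by exists (sgn F (lpar a) * c); rewrite act_par IH actZ scalerA.
- by move=> a w; apply: (words_stable k0) => // h x a'; apply: zero_gens_stable.
Qed.

Lemma layerS i w : layer i w -> layer i.+1 w.
Proof.
apply: lspan_sub => y [h [d hy]]; exists h, d.
elim: hy => {h d y} [h x [-> [j ji ->]]|h d e a x _ IH ea].
  by apply: word0; split=> //; exists j => //; lia.
exact: wordS.
Qed.

Lemma words_min i (T : W -> Prop) : smod_sub T -> (forall j, (j < i)%N -> T (zero_vec j)) ->
  forall w, layer i w -> T w.
Proof.
move=> [Ts _ Ta] hT w; apply: lspan_min => // y [h [d hy]].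
by elim: hy => {h d y} [h x [_ [j ji ->]]|h d e a x _ /Ta //]; apply: hT.
Qed.

(** If [T] does not contain [zero_vec i], its homogeneous vectors [y] lie in [layer i], by induction
    on the [D]-weight. Modes of positive degree send [y] into [layer i], so the image of [y] in the
    quotient by [layer i] is singular and has weight [0]. Hence that image is zero unless [y] has
    weight [0]; in the latter case [y] is a combination of zero vectors, and a nonzero coefficient
    at [zero_vec i] would put this vector into [T]. *)
Lemma layer_step i (T : W -> Prop) : smod_sub T -> (forall w, layer i w -> T w) ->
  (forall w, T w -> layer i.+1 w) -> (forall w, T w -> layer i w) \/ (forall w, layer i.+1 w -> T w).
Proof.
move=> hT ST TS; have [Tx|Tx] := pselect (T (zero_vec i)).
  right; apply: words_min => // j; rewrite ltnS leq_eqVlt => /orP[/eqP ->//|ji].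
  by apply: ST; apply: lspan_in; exists 0, 0%N; apply: word0; split=> //; exists j.
have [Ts Tp Ta] := hT; have hS := layer_sub i; have [Ss _ Sa] := hS.
have TD w : T w -> T (D w).
  move=> Tw; apply: subspaceB => //; first exact: (vs_sub F0 hW).
  by apply: subspaceZ => //; apply: Ta.
have E0 w := generated_E0 Wk v_type v_gen w.
have key : forall (d : nat) y, geigen D d%:R y -> T y -> layer i y.
  move=> d; have [N dN] := ubnP d; elim: N => // N IH in d dN *; move=> y gy Ty.
  have up (a : agl11 F) : 0 < deg l a -> layer i (act a y).
    move=> a0; have ga := geigen_act F0 k0 Wk hW a gy.
    have [ad|da] := leqP (absz (deg l a)) d.
      apply: (IH (d - absz (deg l a))%N); [by lia| |exact: Ta].
      by rewrite natrB // absz_natr //; lia.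
    suff -> : act a y = 0 by apply: lspan0.
    apply: (words_weight_eq0 F0 k0 Wk hW (@zero_gens_eigen i.+1) (TS _ (Ta a _ Ty)) ga).
    move=> h d' y' hy'; have [x0 [-> _]] := word_base hy'; rewrite add0r => e.
    have : (d' + (absz (deg l a) - d))%N%:R = 0 :> F.
      by rewrite natrD natrB 1?ltnW // e absz_natr; [ring|lia].
    by move/eqP; rewrite F0; lia.
  have Qk : level k (quot_smod hS).
    by move=> q; have [x <-] := quot_pi_surj q; rewrite -quot_pi_act Wk (linZ (quot_pi_linear hS)).
  have Qs : smooth (quot_smod hS).
    move=> a q; have [x <-] := quot_pi_surj q; have [N' hN'] := vs_smooth hW a x.
    by exists N' => r /hN'; rewrite -quot_pi_act => ->; rewrite (lin0 (quot_pi_linear hS)).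
  (* The quotient receives a vertex structure of its own so that [geigen_sing] applies to it;
     [vs_hom] identifies its operator [D] with the one induced from [W]. *)
  have [YQ hQ] := vertex_structure_exists F0 k0 hY Qk Qs.
  have piD w : quot_pi hS (D w) = Dop YQ l (quot_pi hS w).
    rewrite /Dop (linB (quot_pi_linear hS)) (linZ (quot_pi_linear hS)) quot_pi_act.
    rewrite (vs_hom F0 hW hQ (b := false) (quot_pi_linear hS)) //.
      by move=> w'; rewrite quot_pi_par scale1r.
    by move=> a r w'; rewrite quot_pi_act.
  have gq : geigen (Dop YQ l) d%:R (quot_pi hS y).
    exact: (geigen_morph (quot_pi_linear hS) piD gy).
  have sq : sing l (- l) (quot_pi hS y).
    by split=> r hr; rewrite -quot_pi_act; apply/quot_pi_eq0; apply: up; rewrite /=; lia.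
  have eq0 : @act _ _ (quot_smod hS) (mode F gE 0) (quot_pi hS y) = (l%:~R * k) *: quot_pi hS y.
    by rewrite -quot_pi_act E0 (linZ (quot_pi_linear hS)).
  have g0 := geigen_sing F0 k0 Qk hQ sq eq0.
  have [d0|d0] := eqVneq d 0%N; last first.
    apply/(quot_pi_eq0 hS); apply: geigen_disjoint (Dop_linear hQ l) gq g0 _.
    by apply/eqP; rewrite F0.
  rewrite {}d0 in gy.
  have hy := words_weight F0 k0 Wk hW (@zero_gens_eigen i.+1) (TS _ Ty) gy.
  have [s [c [ss ye]]] : exists s c, layer i s /\ y = s + c *: zero_vec i.
    elim: hy => [|c x y' [h [d' [hx e]]] _ [s [c' [ss ->]]]].
      by exists 0, 0; split; [exact: lspan0|rewrite scale0r addr0].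
    have d'0 : d' = 0%N.
      by have [x0 [h0 _]] := word_base hx; move: e; rewrite h0 add0r => /eqP; rewrite F0 => /eqP.
    rewrite {}d'0 in hx e.
    have [j ji ->] : zero_base i.+1 x.
      inversion hx; last by lia.
      by case: H.
    move: ji; rewrite ltnS leq_eqVlt => /orP[/eqP ->|ji].
      by exists s, (c + c'); split=> //; lmod F.
    exists (c *: zero_vec j + s), c'; split; last by lmod F.
    apply: subspaceD => //; apply: subspaceZ => //; apply: lspan_in.
    by exists 0, 0%N; apply: word0; split=> //; exists j.
  have [c_0|c_0] := eqVneq c 0; first by rewrite ye c_0 scale0r addr0.
  case: Tx; rewrite -[zero_vec i]scale1r -(mulVf c_0) -scalerA; apply: subspaceZ => //.
  have -> : c *: zero_vec i = y - s by rewrite ye addrC addKr.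
  by apply: subspaceB => //; apply: ST.
left=> w Tw; have [M [c [x [we hx]]]] := lspanP (TS _ Tw); rewrite we in Tw *.
pose h i := projT1 (cid (hx i)); have hh i : exists d, word l (zero_gens _) (h i) d (x i) := projT2 (cid (hx i)).
pose d i := projT1 (cid (hh i)); have hd i : word l (zero_gens _) (h i) (d i) (x i) := projT2 (cid (hh i)).
apply: (homogeneous_component (Dop_linear hW l) (h := d) F0 Ts Ss TD) => //. move=> j.
have [x0 [h0 _]] := word_base (hd j).
have := word_eigen F0 k0 Wk hW (@zero_gens_eigen i.+1) (hd j).
rewrite h0 add0r => gj; apply: geigenZ gj; exact: Dop_linear hW l.
Qed.

Lemma generated_finite_length : finite_length (to_vmod hW).
Proof.
have sub_of (T : W -> Prop) : vsub (W := to_vmod hW) T -> smod_sub T.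
  move=> [Ts Tp TY]; split=> // -[[a r]|] w Tw; last by rewrite Wk; apply: subspaceZ.
  by have := TY (gen k a) r w Tw; rewrite /= (proj2 hW).
have of_sub (T : W -> Prop) : smod_sub T -> vsub (W := to_vmod hW) T.
  by move=> hT; have [Ts Tp _] := hT; split=> // u r w; apply: (vs_sub F0 hW).
have [|i|i w|i _|d [S [S0 Sd Ss Sst]]] := @prune_series F (Vk_vsalg hY) (to_vmod hW) 4 layer.
- move=> w; split=> [|->]; last exact: lspan0.
  elim=> // c x y [h [d hx]] _ ->.
  by elim: hx => {h d x} [h x [_ []]//|h d e a x _ IH _]; rewrite addr0 -actZ -[c *: x]addr0 IH act0.
- exact/of_sub/layer_sub.
- exact: layerS.
- by move=> T /sub_of; apply: layer_step.
exists d, S; split=> // w; rewrite Sd.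
have [Ss4 _ Sa4] := layer_sub 4; apply: v_gen => //.
by apply: lspan_in; exists 0, 0%N; apply: word0; split=> //; exists 3.
Qed.
End FiniteLength.

(** * Membership in the category *)

Section Membership.
Variables (F : fieldType) (k : F).
Hypothesis F0 : forall n, (n%:R == 0 :> F) = (n == 0)%N.
Hypothesis k0 : k != 0.
Variable W : smod (agl11 F).
Hypothesis Wk : level k W.
Variables (Y : Vk k -> int -> Vk k -> Vk k) (hY : affine_vsa Y).
Variables (YW : Vk k -> int -> W -> W).
Hypothesis hW : vertex_structure hY YW.
Implicit Types (r c d : int) (x w : W).
Local Notation D := (Dop YW 0).
Local Notation N r := (@act F (agl11 F) W (mode F gN r)).
Local Notation E r := (@act F (agl11 F) W (mode F gE r)).
Local Notation p r := (@act F (agl11 F) W (mode F gpsip r)).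
Local Notation m r := (@act F (agl11 F) W (mode F gpsim r)).
Local Notation list_span L := (lspan (fun x => exists h, (h, x) \in L)).

Lemma etype_act n e (a : agl11 F) x : etype n e x -> exists n', etype n' e (act a x).
Proof.
move=> ex; case: a => [[a r]|]; last first.
  by exists n; case: ex => hN hE; rewrite Wk; split; rewrite actZ ?hN ?hE scalerCA.
case: a; [exists n|exists n|exists (n + 1)|exists (n - 1)].
- exact: (proj1 (etype_NE _ _ ex)).
- exact: (proj2 (etype_NE _ _ ex)).
- exact: etype_p.
- exact: etype_m.
Qed.

(** A finite list whose span is stable under the positive modes of [N] and [E] and under the odd
    modes from [c] and [d] on. At [c = d = 0] it can serve as a list of generators for the grading
    by [L_0], for which [v] alone does not suffice in general, its own bounds being those of the
    twisted degree. *)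
Definition stable_list (e : F) c d (L : seq (F * W)) : Prop := forall h x, (h, x) \in L ->
  [/\ exists n, etype n e x, geigen D h x,
      forall r, 0 < r -> list_span L (N r x) /\ list_span L (E r x),
      forall r, c <= r -> list_span L (m r x) & forall r, d <= r -> list_span L (p r x)].

Let extend (a : agl11 F) (L : seq (F * W)) := L ++ [seq (q.1 - (deg 0 a)%:~R, act a q.2) | q <- L].

Lemma span_extend a L x : list_span L x -> list_span (extend a L) x.
Proof. by apply: lspan_sub => y [h hy]; exists h; rewrite mem_cat hy. Qed.

Lemma act_extend a L x : list_span L x -> list_span (extend a L) (act a x).
Proof.
apply: lspan_map; [exact: act_linear| |exact: lspan_subspace].
move=> y [h hy]; apply: lspan_in; exists (h - (deg 0 a)%:~R).
by rewrite mem_cat; apply/orP; right; apply/mapP; exists (h, y).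
Qed.

Lemma span_case (b : bool) (s : F) (P : W -> Prop) x : lspan P x ->
  lspan P ((if b then s else 0) *: x).
Proof. by move=> hx; apply: lspanZ. Qed.

(** The mode [psi^-_c] squares to zero, so its images need to be added only once. The condition on
    [c + d] keeps the modes of [E] in the anticommutators nonnegative. *)
Lemma extend_m e c d L : 0 <= c + d -> stable_list e (c + 1) d L ->
  stable_list e c d (extend (mode F gpsim c) L).
Proof.
move=> cd hL; have SD := fun P => subspaceD (lspan_subspace (V := W) P).
have ZN P y : lspan P y -> lspan P (- y) by move=> hy; rewrite -scaleN1r; apply: lspanZ.
have up := fun x => @span_extend (mode F gpsim c) L x.
have am := fun x => @act_extend (mode F gpsim c) L x.
move=> h x; rewrite mem_cat => /orP[hx|/mapP [[h' y] hy [-> ->]]].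
  have [ex gx hNE hm hp] := hL h x hx; have sx : list_span L x by apply: lspan_in; exists h.
  split=> // r hr; [by case: (hNE r hr) => /up ? /up| |exact/up/hp].
  by have [->|rc] := eqVneq r c; [exact: am|apply/up/hm; lia].
have [[n ey] gy hNE hm hp] := hL h' y hy; have sy : list_span L y by apply: lspan_in; exists h'.
have hE r : 0 <= r -> list_span L (E r y).
  have [->|r0 rr] := eqVneq r 0; first by rewrite (proj2 ey); move=> _; apply: lspanZ.
  by apply: (proj2 (hNE r _)); lia.
split=> [||r hr|r hr|r hr] /=.
- exact: etype_act ey.
- by have := geigen_act F0 k0 Wk hW (mode F gpsim c) gy; rewrite /=.
- split; last by rewrite brEm; apply: am; apply: (hE); lia.
  by rewrite brNm; apply: (SD); [apply: am; apply: (proj1 (hNE r hr))|apply/ZN/up/hm; lia].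
- have [->|rc] := eqVneq r c; first by rewrite (mm0 F0); apply: lspan0.
  by rewrite brmm; apply/ZN/am/hm; lia.
- rewrite (brpm Wk); apply: (SD); first apply: (SD).
  + exact/ZN/am/hp.
  + by apply/up/hE; lia.
  + exact/up/span_case.
Qed.

Lemma extend_p e c d L : 0 <= c + d -> stable_list e c (d + 1) L ->
  stable_list e c d (extend (mode F gpsip d) L).
Proof.
move=> cd hL; have SD := fun P => subspaceD (lspan_subspace (V := W) P).
have ZN P y : lspan P y -> lspan P (- y) by move=> hy; rewrite -scaleN1r; apply: lspanZ.
have up := fun x => @span_extend (mode F gpsip d) L x.
have am := fun x => @act_extend (mode F gpsip d) L x.
move=> h x; rewrite mem_cat => /orP[hx|/mapP [[h' y] hy [-> ->]]].
  have [ex gx hNE hm hp] := hL h x hx; have sx : list_span L x by apply: lspan_in; exists h.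
  split=> // r hr; [by case: (hNE r hr) => /up ? /up|exact/up/hm|].
  by have [->|rc] := eqVneq r d; [exact: am|apply/up/hp; lia].
have [[n ey] gy hNE hm hp] := hL h' y hy; have sy : list_span L y by apply: lspan_in; exists h'.
have hE r : 0 <= r -> list_span L (E r y).
  have [->|r0 rr] := eqVneq r 0; first by rewrite (proj2 ey); move=> _; apply: lspanZ.
  by apply: (proj2 (hNE r _)); lia.
split=> [||r hr|r hr|r hr] /=.
- exact: etype_act ey.
- by have := geigen_act F0 k0 Wk hW (mode F gpsip d) gy; rewrite /=.
- split; last by rewrite brEp; apply: am; apply: (hE); lia.
  by rewrite brNp; apply: (SD); [apply: am; apply: (proj1 (hNE r hr))|apply/up/hp; lia].
- rewrite (brmp Wk); apply: (SD); first apply: (SD).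
  + exact/ZN/am/hm.
  + by apply/up/hE; lia.
  + exact/ZN/up/span_case.
- have [->|rc] := eqVneq r d; first by rewrite (pp0 F0); apply: lspan0.
  by rewrite brpp; apply/ZN/am/hp; lia.
Qed.

Lemma stable_list_full e c d L : 0 <= c -> 0 <= d -> stable_list e c d L ->
  exists2 L', stable_list e 0 0 L' & {subset L <= L'}.
Proof.
have main (q : nat) c' d' L1 : (absz c' + absz d' <= q)%N -> 0 <= c' -> 0 <= d' ->
    stable_list e c' d' L1 -> exists2 L', stable_list e 0 0 L' & {subset L1 <= L'}.
  elim: q c' d' L1 => [|q IH] c' d' L1 cd hc hd hL.
    have c_0 : c' = 0 by lia.
    have d_0 : d' = 0 by lia.
    by exists L1 => //; rewrite -[X in stable_list _ X _]c_0 -[X in stable_list _ _ X]d_0.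
  have [c_0|c_0] := eqVneq c' 0; last first.
    have h1 : stable_list e (c' - 1) d' (extend (mode F gpsim (c' - 1)) L1).
      by apply: extend_m; [lia|rewrite subrK].
    have [|||L' hL' sub] := IH _ _ _ _ _ _ h1; try lia.
    by exists L' => // x hx; apply: sub; rewrite mem_cat hx.
  have [d_0|d_0] := eqVneq d' 0; last first.
    have h1 : stable_list e c' (d' - 1) (extend (mode F gpsip (d' - 1)) L1).
      by apply: extend_p; [lia|rewrite subrK].
    have [|||L' hL' sub] := IH _ _ _ _ _ _ h1; try lia.
    by exists L' => // x hx; apply: sub; rewrite mem_cat hx.
  by exists L1 => //; rewrite -[X in stable_list _ X _]c_0 -[X in stable_list _ _ X]d_0.
exact: (main _ _ _ _ (leqnn _)).
Qed.

Variables (n : F) (l : int) (b : bool) (v : W).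
Hypotheses (v_par : homog b v) (v_type : vtype k n l v) (v_gen : generated v).

Lemma generated_Ofin : Ofin hY (to_vmod hW).
Proof.
have [sv ev] := v_type.
have gv : geigen D (l%:~R * n) v.
  by rewrite -[_ * n]add0r; apply/(Dop_shift F0 k0 Wk hW l 0 (proj1 ev)); exact: (geigen_sing F0 k0 Wk hW sv (proj2 ev)).
(* The list starts with [v], of [L_0]-weight [l n] because its [D]-weight is [0]; it is killed by
   [psi^-_r] from [l + 1] on and by [psi^+_r] from [1 - l] on. *)
have h0 : stable_list (l%:~R * k) (Num.max 0 (l + 1)) (Num.max 0 (1 - l)) [:: (l%:~R * n, v)].
  move=> h x; rewrite inE => /eqP [-> ->]; case: sv => hN hE hm hp.
  split=> // [|r hr|r hr|r hr]; first by exists n.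
  - by rewrite hN // hE //; split; apply: lspan0.
  - by rewrite hm ?hp; [apply: lspan0|lia].
  - by rewrite hp; [apply: lspan0|lia].
have [||L hL sub] := stable_list_full _ _ h0; try lia.
have Lst h x (a : agl11 F) : (h, x) \in L -> 0 <= deg 0 a -> list_span L (act a x).
  move=> hx a0; have [[n' [en eE]] _ hNE hm hp] := hL h x hx.
  have sx : list_span L x by apply: lspan_in; exists h.
  case: a a0 => [[a r]|] a0; last by rewrite Wk; apply: lspanZ.
  case: a a0 => /=; rewrite ?addr0 ?subr0 => a0; [| |exact: hp|exact: hm].
    have [->|r0] := eqVneq r 0; first by rewrite en; apply: lspanZ.
    by apply: (proj1 (hNE r _)); lia.
  have [->|r0] := eqVneq r 0; first by rewrite eE; apply: lspanZ.
  by apply: (proj2 (hNE r _)); lia.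
have Lgen w : lspan (words 0 (fun h x => (h, x) \in L)) w.
  apply: v_gen; first exact: lspan_subspace.
    by move=> a y; apply: (words_stable k0) => h x a'; apply: Lst.
  by apply: lspan_in; exists (l%:~R * n), 0%N; apply: word0; apply: sub; rewrite inE.
have Wty h (d : nat) x : word 0 (fun h x => (h, x) \in L) h d x -> exists n', etype n' (l%:~R * k) x.
  elim=> {h d x} [h x /hL [] //|h d e a x _ [n' /(etype_act a)] //].
split.
- exact: (generated_finite_length F0 k0 Wk hW v_par v_type v_gen).
- by apply: (words_grading F0 k0 Wk hW _ Lgen) => h x /hL [].
- rewrite /= (_ : YW (gen k gN) 0 = N 0); last by apply/funext => w; rewrite (proj2 hW).
  apply: (words_semisimple Lgen) => [|h d x /Wty [n' [hN _]]]; first exact: act_linear.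
  by exists n'.
- rewrite /= (_ : YW (gen k gE) 0 = E 0); last by apply/funext => w; rewrite (proj2 hW).
  apply: (words_semisimple Lgen) => [|h d x /Wty [n' [_ hE]]]; first exact: act_linear.
  by exists (l%:~R * k).
Qed.
End Membership.

(** * Universality of P *)

Section Universal.
Variables (F : fieldType) (k : F).
Hypothesis F0 : forall n, (n%:R == 0 :> F) = (n == 0)%N.
Hypothesis k0 : k != 0.
Implicit Types (X W : smod (agl11 F)) (r l : int) (n : F).

Lemma mode_kill W a c r s (w : W) :
  act (mode F a r) w = 0 -> r + s != 0 -> (forall c, act (mode F c (r + s)) w = 0) ->
  act (mode F a r) (act (mode F c s) w) = 0.
Proof.
move=> ha /negPf rs hb; rewrite act_swap ha act0 scaler0 add0r /= rs cats0 big_map.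
by apply: big1 => q _; rewrite hb scaler0.
Qed.

(** The induction needs one bound common to all four currents, since commuting two modes produces
    other currents. *)
Lemma generated_smooth W n l (v : W) : level k W -> vtype k n l v -> generated v -> smooth W.
Proof.
move=> Wk [[hN hE hm hp] _] gv.
suff H (w : W) : exists N : int, forall a r, N <= r -> act (mode F a r) w = 0.
  by move=> a w; have [N hw] := H w; exists N => r; apply: hw.
move: w; apply: gv => [|[[b s]|] w [N hw]|].
- split=> [|c u w [N hu] [N' hw]]; first by exists 0 => *; rewrite act0.
  by exists (Num.max N N') => a r hr; rewrite act_linear hu ?hw ?scaler0 ?addr0 //; lia.
(* The bound [1 - s] keeps [r + s] positive, so that no central term arises. *)
- exists (Num.max (Num.max N (N - s)) (1 - s)) => a r hr.
  by apply: mode_kill => [||c]; rewrite ?hw //; lia.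
- by exists N => a r /hw; rewrite Wk actZ => ->; rewrite scaler0.
- by exists (Num.max (l + 1) (Num.max (1 - l) 1)) => -[] r hr; [apply: hN|apply: hE|apply: hp|apply: hm]; lia.
Qed.

(** The vector [x] may be inhomogeneous, so [g] is not asked to respect parities; when [x] is
    homogeneous, [super_hom] turns [g] into an even or odd morphism. *)
Definition universal W n l (v : W) : Prop := forall X, level k X -> forall x : X, vtype k n l x ->
  exists g : W -> X, [/\ linear g, forall a w, g (act a w) = act a (g w) & g v = x].

Section Hat.
Variable M : smod (gl11 F).

Lemma hat_in_act a r (u : M) : 0 <= r ->
  act (mode F a r) (hat_in k u) = if r == 0 then hat_in k (@act F (gl11 F) M a u) else 0.
Proof.
move=> r0; rewrite ind_in_act //=; case: eqP => // _; exact: (lin0 (ind_in_linear _)).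
Qed.

Lemma hat_in_par (u : M) : par (hat_in k u) = hat_in k (par u).
Proof. exact: ind_in_par. Qed.

Lemma hat_in_linear : linear (hat_in k (M := M)).
Proof. exact: ind_in_linear. Qed.

Lemma hat_in_sing (u : M) : @act F (gl11 F) M gpsip u = 0 -> sing 0 (-1) (hat_in k u).
Proof.
move=> hp; split=> r hr; last first.
  rewrite hat_in_act; last by lia.
  by rewrite hp (lin0 hat_in_linear) if_same.
all: by rewrite hat_in_act ?gt_eqF //; lia.
Qed.

Lemma hat_in_sing0 (u : M) : sing 0 0 (hat_in k u).
Proof. by split=> r hr; rewrite hat_in_act ?gt_eqF //; lia. Qed.

Lemma hat_in_etype n e (u : M) : @act F (gl11 F) M gN u = n *: u -> @act F (gl11 F) M gE u = e *: u ->
  etype n e (hat_in k u).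
Proof.
by move=> hN hE; split; rewrite hat_in_act // eqxx ?hN ?hE (linZ hat_in_linear).
Qed.

Lemma hat_in_generated (u : M) :
  (forall T : M -> Prop, subspace T -> (forall a w, T w -> T (@act F (gl11 F) M a w)) -> T u -> forall w, T w) ->
  generated (hat_in k u).
Proof.
move=> gu S [S0 SD] Sa Su; apply: (ind_generated (T := S)) => // w.
apply: (gu (fun w => S (hat_in k w))) => // [|a x Sx].
  split=> [|c x y]; first by rewrite (lin0 hat_in_linear).
  by rewrite hat_in_linear; apply: SD.
by have := Sa (mode F a 0) _ Sx; rewrite hat_in_act.
Qed.
End Hat.

Definition P_top n : P_mod n := ind_in (@cartan_par F n) (1 : F).

Lemma P_top_act n a : cartan a ->
  @act F (gl11 F) (P_mod n) a (P_top n) = (if a is gN then n else 0) *: P_top n.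
Proof.
move=> ca; rewrite ind_in_act // -(linZ (ind_in_linear (@cartan_par F n))).
by case: a ca => // _; rewrite /= scale0r.
Qed.

Lemma P_top_generated n (T : P_mod n -> Prop) : subspace T ->
  (forall a w, T w -> T (@act F (gl11 F) (P_mod n) a w)) -> T (P_top n) -> forall w, T w.
Proof.
move=> hT Ta Tu; apply: (ind_generated hT Ta) => c.
have -> : ind_in (@cartan_par F n) c = c *: P_top n.
  by rewrite -(linZ (ind_in_linear (@cartan_par F n))) -[c *: _]/(c * 1) mulr1.
exact: subspaceZ.
Qed.

(** Two inductions, two lifts: [P_n] is first mapped into the vectors of [X] killed by all positive
    modes, a gl(1|1)-module under the zero modes, and this map is then extended to the affine
    module. *)
Lemma hat_P_universal n : universal n 0 (hat_in k (P_top n)).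
Proof.
move=> X Xk x [[hN hE hm hp] [en ee]].
pose ok (y : X) := forall a r, 0 < r -> act (mode F a r) y = 0.
have okx : ok x by case=> r r0; [apply: hN|apply: hE|apply: hp; rewrite oppr0|apply: hm].
have ok_sub : subspace ok.
  by split=> [a r _|c u w hu hw a r r0]; rewrite ?act0 // act_linear hu ?hw // scaler0 addr0.
have [b y oky a r r0|b c y z _ _|a b y oky||c|b c|phi [phi_lin phi_ok phi_act phi_in]] :=
  @ind_lift F (gl11 F) (@cartan F) (even_line F) (gl11_char n) (@cartan_par F n)
  X ok (fun b y => act (mode F b 0) y) (fun c : F => c *: x) ok_sub.
- by apply: mode_kill => [||c]; rewrite ?oky // addr0 ?gt_eqF.
- by rewrite act_linear.
- rewrite (act_br (mode F a 0) (mode F b 0) y) /= big_cat big_map /=.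
  by rewrite -[RHS]addr0; congr (_ + _); case: ifP => _; rewrite ?big_cons big_nil //= mul0r scale0r addr0.
- by move=> c u w; rewrite scalerDl scalerA.
- by move=> a r r0; rewrite actZ okx // scaler0.
- case: b => // _ /=; rewrite actZ ?en ?ee; first by rewrite scalerCA scalerA.
  by rewrite mul0r !scale0r scaler0.
have [||||||b u|psi [psi_lin _ psi_act psi_in]] :=
  @ind_lift F (agl11 F) (@agl11_nonneg F) (P_mod n) (hat_char k (M := P_mod n)) (@hat_char_par F k (P_mod n))
  X (fun=> True) (fun b y => act b y) phi.
- by [].
- by [].
- by move=> b c y z _ _; exact: act_linear.
- by move=> a b y _; apply: act_br.
- exact: phi_lin.
- by [].
- case: b => [[b r]|] /= r0; last by rewrite Xk (linZ phi_lin).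
  case: eqP => [->|rn]; first by rewrite phi_act.
  by rewrite (lin0 phi_lin) phi_ok //; lia.
exists psi; split=> //.
by rewrite psi_in phi_in scale1r.
Qed.
End Universal.

(** * Spectral flow and Weyl twist *)

Section Twists.
Variables (F : fieldType) (k : F).
Hypothesis F0 : forall n, (n%:R == 0 :> F) = (n == 0)%N.
Hypothesis k0 : k != 0.
Implicit Types (X W : smod (agl11 F)) (r l : int) (n : F).
Local Notation "x @@ W" := (@act F (agl11 F) W x) (at level 9).

Lemma flow_N l W r (w : W) : (mode F gN r) @@ (spectral_flow l W) w = (mode F gN r) @@ W w.
Proof. by rewrite /= /lact !(big_cons, big_nil, addr0, scale1r, scaleN1r, opprK). Qed.
Lemma flow_E l W r (w : W) : level k W ->
  (mode F gE r) @@ (spectral_flow l W) w = (mode F gE r) @@ W w + (l%:~R * (r == 0)%:R * k) *: w.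
Proof. by move=> Wk; rewrite /= /lact !(big_cons, big_nil, addr0, scale1r, scaleN1r, opprK) /= Wk rmorphN opprK scalerA. Qed.
Lemma flow_p l W r (w : W) : (mode F gpsip r) @@ (spectral_flow l W) w = (mode F gpsip (r + l)) @@ W w.
Proof. by rewrite /= /lact !(big_cons, big_nil, addr0, scale1r, scaleN1r, opprK). Qed.
Lemma flow_m l W r (w : W) : (mode F gpsim r) @@ (spectral_flow l W) w = (mode F gpsim (r - l)) @@ W w.
Proof. by rewrite /= /lact !(big_cons, big_nil, addr0, scale1r, scaleN1r, opprK). Qed.

Lemma flow_level l W : level k W -> level k (spectral_flow l W).
Proof. by move=> Wk w; rewrite /= /lact !(big_cons, big_nil, addr0, scale1r, scaleN1r, opprK) Wk. Qed.

Lemma flow_vtype l n l0 W (w : W) : level k W -> vtype k n l0 w ->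
  vtype (W := spectral_flow l W) k n (l0 + l) w.
Proof.
move=> Wk [[hN hE hm hp] [en ee]]; split; split.
- by move=> r hr; rewrite flow_N hN.
- by move=> r hr; rewrite flow_E // hE // gt_eqF // mulr0 mul0r scale0r addr0.
- by move=> r hr; rewrite flow_m hm //; lia.
- by move=> r hr; rewrite flow_p hp //; lia.
- by rewrite flow_N.
- by rewrite flow_E // ee eqxx mulr1 -scalerDl -mulrDl -rmorphD.
Qed.

Lemma subspace_lact W (S : W -> Prop) s (w : W) : subspace S ->
  (forall a, S (act a w)) -> S (@lact F (agl11 F) W s w).
Proof.
move=> hS Sa; rewrite /lact; elim: s => [|q s IH]; first by rewrite big_nil; apply: (proj1 hS).
by rewrite big_cons; apply: (subspaceD hS) => //; apply: subspaceZ.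
Qed.

Lemma flow_generated l W (w : W) : generated w -> generated (W := spectral_flow l W) w.
Proof.
move=> gw S hS Sa Sw; apply: gw => // a y Sy.
rewrite -(spectral_flowE l a y); apply: subspace_lact => // c; exact: Sa.
Qed.

Lemma hom_lact W X (g : W -> X) s (w : W) : linear g -> (forall a w, g (act a w) = act a (g w)) ->
  g (@lact F (agl11 F) W s w) = @lact F (agl11 F) X s (g w).
Proof.
move=> lg ga; rewrite /lact (lin_sum lg); apply: eq_bigr => q _.
by rewrite (linZ lg) ga.
Qed.

(** The target is twisted back: a vector of type [(n, l0 + l)] in [X] has type [(n, l0)] in
    [spectral_flow (- l) X]. *)
Lemma flow_universal l n l0 W (w : W) : level k W -> universal k n l0 w ->
  universal (W := spectral_flow l W) k n (l0 + l) w.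
Proof.
move=> Wk uw X Xk x xt.
have := flow_vtype (- l) Xk xt; rewrite addrK => xt'.
have [g [lg ga gx]] := uw (spectral_flow (- l) X) (flow_level (l := - l) Xk) x xt'.
exists g; split=> // a y.
by rewrite [LHS](hom_lact (W := W) (X := spectral_flow (- l) X) _ _ lg ga) spectral_flowE.
Qed.

Lemma weyl_N W r (w : W) : (mode F gN r) @@ (weyl_twist W) w = - (mode F gN r) @@ W w.
Proof. by rewrite /= /lact !(big_cons, big_nil, addr0, scale1r, scaleN1r, opprK). Qed.
Lemma weyl_E W r (w : W) : (mode F gE r) @@ (weyl_twist W) w = - (mode F gE r) @@ W w.
Proof. by rewrite /= /lact !(big_cons, big_nil, addr0, scale1r, scaleN1r, opprK). Qed.
Lemma weyl_p W r (w : W) : (mode F gpsip r) @@ (weyl_twist W) w = - (mode F gpsim r) @@ W w.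
Proof. by rewrite /= /lact !(big_cons, big_nil, addr0, scale1r, scaleN1r, opprK). Qed.
Lemma weyl_m W r (w : W) : (mode F gpsim r) @@ (weyl_twist W) w = (mode F gpsip r) @@ W w.
Proof. by rewrite /= /lact !(big_cons, big_nil, addr0, scale1r, scaleN1r, opprK). Qed.

Lemma weyl_level W : level k W -> level k (weyl_twist W).
Proof. by move=> Wk w; rewrite /= /lact !(big_cons, big_nil, addr0, scale1r, scaleN1r, opprK) Wk. Qed.

Lemma weyl_vtype n l W (w : W) : vtype k n l w -> vtype (W := weyl_twist W) k (- n) (- l) w.
Proof.
move=> [[hN hE hm hp] [en ee]]; split; split.
- by move=> r hr; rewrite weyl_N hN ?oppr0.
- by move=> r hr; rewrite weyl_E hE ?oppr0.
- by move=> r hr; rewrite weyl_m hp.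
- by move=> r hr; rewrite weyl_p hm ?oppr0 //; lia.
- by rewrite weyl_N en scaleNr.
- by rewrite weyl_E ee rmorphN mulNr scaleNr.
Qed.

Lemma weyl_generated W (w : W) : generated w -> generated (W := weyl_twist W) w.
Proof.
move=> gw S hS Sa Sw; apply: gw => // a y Sy.
rewrite -(weyl_twistE a y); apply: subspace_lact => // c; exact: Sa.
Qed.

(* The Weyl automorphism has order four, so that its cube undoes it. *)
Lemma weyl_twist4 X a (x : X) :
  @lact F (agl11 F) (weyl_twist (weyl_twist (weyl_twist X))) (weyl_inv a) x = act a x.
Proof.
by case: a => [[[] r]|]; rewrite /lact /= ?big_cons ?big_nil /= /lact /=
  ?big_cons ?big_nil /= /lact /= ?big_cons ?big_nil /= ?addr0 ?scaleN1r ?scale1r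
  ?scaleN1r ?opprK /lact /= ?big_cons ?big_nil /= ?addr0 ?scaleN1r ?scale1r ?opprK.
Qed.

Lemma weyl_universal n l W (w : W) : universal k n l w ->
  universal (W := weyl_twist W) k (- n) (- l) w.
Proof.
move=> uw X Xk x /weyl_vtype/weyl_vtype/weyl_vtype; rewrite !opprK => xt.
have [g [lg ga gx]] := uw _ (weyl_level (weyl_level (weyl_level Xk))) x xt.
exists g; split=> // a y.
by rewrite [LHS](hom_lact (W := W) (X := weyl_twist (weyl_twist (weyl_twist X))) _ _ lg ga) weyl_twist4.
Qed.

Lemma P_hat_universal (n : F) l : exists v : P_hat k (n - l%:~R + epsilon l) l,
  [/\ level k (P_hat k (n - l%:~R + epsilon l) l), par v = v, vtype k n l v, generated v & universal k n l v].
Proof.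
have base nu : [/\ level k (hat k (P_mod nu)), par (hat_in k (P_top nu)) = hat_in k (P_top nu),
    vtype k nu 0 (hat_in k (P_top nu)), generated (hat_in k (P_top nu)) & universal k nu 0 (hat_in k (P_top nu))].
  split; [exact: level_hat|by rewrite hat_in_par [par _]ind_in_par| | |exact: hat_P_universal].
    split; first by rewrite oppr0; apply: hat_in_sing0.
    by apply: hat_in_etype; rewrite P_top_act // ?mul0r.
  by apply: hat_in_generated; apply: P_top_generated.
rewrite /P_hat /epsilon; case: eqVneq => [->|l0].
  rewrite subr0 addr0; have [h1 h2 h3 h4 h5] := base n.
  by exists (hat_in k (P_top n)).
have [l_gt|l_le] := ltrP 0 l.
  rewrite ltNge (ltW l_gt) /=.
  (* The label unwinds to [P_(-n)], because the Weyl twist negates the eigenvalue of [N_0]. *)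
  have -> : - (n - l%:~R + 2%:R^-1) - l%:~R + 2%:R^-1 = - n by ring.
  have [h1 h2 h3 h4 h5] := base (- n).
  have t1 := weyl_vtype h3; have t2 := flow_vtype l (weyl_level h1) t1.
  have u1 := weyl_universal h5; have u2 := flow_universal (l := l) (weyl_level h1) u1.
  exists (hat_in k (P_top (- n))); split.
  - exact/flow_level/weyl_level.
  - exact: h2.
  - by move: t2; rewrite opprK oppr0 add0r.
  - exact: (flow_generated (l := l) (weyl_generated h4)).
  - by move: u2; rewrite opprK oppr0 add0r.
rewrite lt_neqAle l0 l_le /=.
have -> : n - l%:~R - 2%:R^-1 + l%:~R + 2%:R^-1 = n by ring.
have [h1 h2 h3 h4 h5] := base n.
exists (hat_in k (P_top n)); split.
- exact/flow_level.
- exact: h2.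
- by have := flow_vtype l h1 h3; rewrite add0r.
- exact: (flow_generated (l := l) h4).
- by have := flow_universal (l := l) h1 h5; rewrite add0r.
Qed.
End Twists.

(** * The generator of A *)

Section NonzeroInduced.
Variables (F : fieldType) (g : liesuper F) (S : pred g) (chi : g -> F).
Implicit Types (a b c x : g) (u v w : seq g) (L : g -> F) (f : seq g -> F).
Local Notation s a b := (sgn F (lpar a && lpar b)).

(** The value of the linear form [L] on the bracket of [a] and [b]. *)
Definition brk a b L : F := \sum_(q <- lbr a b) q.1 * L q.2.

Hypothesis skew : forall a b L, brk a b L = - (s a b * brk b a L).
Hypothesis jacobi : forall a b c L,
  brk c a (fun q => brk q b L) + s c a * brk c b (fun q => brk a q L) = brk a b (fun q => brk c q L).
Hypothesis S_br : forall a b q, S a -> S b -> q \in lbr a b -> S q.2.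
Hypothesis notS_br : forall a b q, ~~ S a -> ~~ S b -> q \in lbr a b -> ~~ S q.2.
Hypothesis chi_odd : forall a, lpar a -> chi a = 0.
Hypothesis chi_br : forall a b, S a -> S b -> brk a b chi = 0.

Lemma eq_brk a b L L' : (forall q, q \in lbr a b -> L q.2 = L' q.2) -> brk a b L = brk a b L'.
Proof. by move=> e; rewrite /brk !big_seq; apply: eq_bigr => q /e ->. Qed.
Lemma brkD a b L L' : brk a b (fun q => L q + L' q) = brk a b L + brk a b L'.
Proof. by rewrite /brk -big_split; apply: eq_bigr => q _; rewrite mulrDr. Qed.
Lemma brkZ a b t L : brk a b (fun q => t * L q) = t * brk a b L.
Proof. by rewrite /brk mulr_sumr; apply: eq_bigr => q _; rewrite mulrCA. Qed.
Lemma brk0 a b : brk a b (fun=> 0) = 0.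
Proof. by rewrite /brk big1 // => q _; rewrite mulr0. Qed.
Lemma brkC a b a' b' (L : g -> g -> F) :
  brk a b (fun q => brk a' b' (L q)) = brk a' b' (fun q' => brk a b (fun q => L q q')).
Proof.
rewrite /brk; under eq_bigr do rewrite mulr_sumr; rewrite exchange_big.
by apply: eq_bigr => q _; rewrite mulr_sumr; apply: eq_bigr => q' _; rewrite mulrCA.
Qed.
Lemma sgn_br a b c q : q \in lbr a b -> s q.2 c = s a c * s b c.
Proof.
move=> /lbr_par ->; rewrite /sgn -signr_addb; congr (_ ^+ _).
by case: (lpar a) (lpar b) (lpar c) => [] [] [].
Qed.
Lemma sgnC a b : s a b = s b a. Proof. by rewrite andbC. Qed.

(* The action of [a] on a word, as a derivation of the bracket and with [chi]
   at the end of the word, transposed to functionals on words. *)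
Fixpoint der a f u : F :=
  if u is x :: u' then brk a x (fun q => f (q :: u')) + s a x * der a (fun v => f (x :: v)) u'
  else chi a * f [::].

Lemma eq_der a f f' u : (forall v, size v = size u -> f v = f' v) -> der a f u = der a f' u.
Proof.
elim: u f f' => [|x u IH] f f' e /=; first by rewrite e.
congr (_ + _ * _); last by apply: IH => v vu; apply: e; rewrite /= vu.
by apply: eq_brk => q _; apply: e.
Qed.

Lemma derD a f f' u : der a (fun v => f v + f' v) u = der a f u + der a f' u.
Proof. by elim: u f f' => [|x u IH] f f' /=; rewrite ?mulrDr // brkD IH; ring. Qed.
Lemma derZ a t f u : der a (fun v => t * f v) u = t * der a f u.
Proof. by elim: u f => [|x u IH] f /=; rewrite ?brkZ ?IH; ring. Qed.
Lemma der0 a u : der a (fun=> 0) u = 0.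
Proof. by elim: u => [|x u IH] /=; rewrite ?brk0 ?IH; ring. Qed.
Lemma der_brk a b c (h : g -> seq g -> F) u :
  der a (fun v => brk b c (fun q => h q v)) u = brk b c (fun q => der a (h q) u).
Proof.
rewrite /brk; elim: (lbr b c) => [|q t IH].
  rewrite big_nil -[RHS](der0 a u); apply: eq_der => v _; exact: big_nil.
rewrite big_cons -IH -derZ -derD; apply: eq_der => v _; exact: big_cons.
Qed.

(** The value of [f] on the defining relation of the enveloping algebra, placed between the words
    [w] and [u]. *)
Definition rel_defect f w a b u : F :=
  f (w ++ a :: b :: u) - s a b * f (w ++ b :: a :: u) - brk a b (fun q => f (w ++ q :: u)).

(** A derivation of the bracket preserves the relations: away from the letters [a] and [b] it gives
    further relations of the same length, and on these two letters the claim is the Jacobi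
    identity. *)
Lemma rel_der f c w a b u :
  (forall w' a' b' u', (size w' + size u' <= size w + size u)%N -> rel_defect f w' a' b' u' = 0) ->
  rel_defect (der c f) w a b u = 0.
Proof.
elim: w f => [|x w IH] f hf; last first.
  transitivity (brk c x (fun q => rel_defect f (q :: w) a b u)
    + s c x * rel_defect (der c (fun v => f (x :: v))) w a b u).
    have -> : brk c x (fun q => rel_defect f (q :: w) a b u) =
        brk c x (fun q => f (q :: w ++ a :: b :: u)) + - s a b * brk c x (fun q => f (q :: w ++ b :: a :: u))
        + -1 * brk a b (fun q => brk c x (fun q' => f (q' :: w ++ q :: u))).
      rewrite brkC -!brkZ -!brkD; apply: eq_brk => q _; rewrite /rel_defect /=; ring.
    by rewrite /rel_defect /= brkD brkZ; ring.
  rewrite IH ?mulr0 ?addr0 => [|w' a' b' u' hs]; last by apply: (hf (x :: w')); rewrite /=; lia.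
  by rewrite -[RHS](brk0 c x); apply: eq_brk => q _; apply: hf; rewrite /=; lia.
have R a' b' : f (a' :: b' :: u) = s a' b' * f (b' :: a' :: u) + brk a' b' (fun q => f (q :: u)).
  by apply/eqP; rewrite -subr_eq0 opprD addrA; apply/eqP; apply: (hf [::]).
rewrite /rel_defect /=.
have E1 : brk c a (fun q => f (q :: b :: u)) =
    s a b * s c b * brk c a (fun q => f (b :: q :: u)) + brk c a (fun q => brk q b (fun p => f (p :: u))).
  by rewrite -brkZ -brkD; apply: eq_brk => q /(sgn_br b) qs; rewrite R qs [s c b * _]mulrC.
have E2 : brk c b (fun q => f (a :: q :: u)) =
    s c a * s a b * brk c b (fun q => f (q :: a :: u)) + brk c b (fun q => brk a q (fun p => f (p :: u))).
  rewrite -brkZ -brkD; apply: eq_brk => q /(sgn_br a) qs.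
  by rewrite R [s a q.2]sgnC qs [s b a]sgnC.
have E3 : brk a b (fun q => brk c q (fun p => f (p :: u)) + s c q * der c (fun v => f (q :: v)) u) =
    brk a b (fun q => brk c q (fun p => f (p :: u))) + s c a * s c b * brk a b (fun q => der c (fun v => f (q :: v)) u).
  rewrite -brkZ -brkD; apply: eq_brk => q /(sgn_br c) qs.
  by rewrite [s c q.2]sgnC qs [s a c]sgnC [s b c]sgnC.
have E4 : der c (fun v => f (a :: b :: v)) u =
    s a b * der c (fun v => f (b :: a :: v)) u + brk a b (fun q => der c (fun v => f (q :: v)) u).
  rewrite -der_brk -derZ -derD; apply: eq_der => v uv; apply/eqP.
  by rewrite -subr_eq0 opprD addrA; apply/eqP; apply: (hf [::]); rewrite uv.
rewrite E1 E2 E3 E4 -(jacobi a b c).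
have ss a' b' : s a' b' * s a' b' = 1 by rewrite /sgn -signr_addb addbb.
have := ss c a; have := ss c b; have := ss a b.
move: (s a b) (s c a) (s c b) => s1 s2 s3 h1 h2 h3.
ring: h1 h2 h3.
Qed.

(** The action is transposed, hence the reversed bracket on the right. At the end of a word the
    claim is that [chi] is a character of the subalgebra. *)
Lemma der_comm f a b u : S a -> S b ->
  der a (der b f) u - s a b * der b (der a f) u = brk b a (fun q => der q f u).
Proof.
move=> Sa Sb; elim: u f => [|x v IH] f /=.
  rewrite (@eq_brk b a _ (fun q => f [::] * chi q)) => [|q _]; last by rewrite mulrC.
  rewrite brkZ chi_br // mulr0; case: (boolP (lpar a && lpar b)) => [/andP[/chi_odd -> _]|_].
    by rewrite /sgn; ring.
  by rewrite /sgn expr0; ring.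
have E (a' b' : g) : der a' (fun w => brk b' x (fun q => f (q :: w)) + s b' x * der b' (fun w' => f (x :: w')) w) v =
    brk b' x (fun q => der a' (fun w => f (q :: w)) v) + s b' x * der a' (der b' (fun w' => f (x :: w'))) v.
  by rewrite derD derZ der_brk.
have E' (a' b' : g) : brk a' x (fun q => brk b' q (fun p => f (p :: v)) + s b' q * der b' (fun w => f (q :: w)) v) =
    brk a' x (fun q => brk b' q (fun p => f (p :: v))) + s b' a' * s b' x * brk a' x (fun q => der b' (fun w => f (q :: w)) v).
  rewrite -brkZ -brkD; apply: eq_brk => q /(sgn_br b') qs.
  by rewrite [s b' q.2]sgnC qs [s a' b']sgnC [s x b']sgnC.
have E2 : brk b a (fun q => brk q x (fun p => f (p :: v)) + s q x * der q (fun w => f (x :: w)) v) =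
    brk b a (fun q => brk q x (fun p => f (p :: v))) + s b x * s a x * brk b a (fun q => der q (fun w => f (x :: w)) v).
  by rewrite -brkZ -brkD; apply: eq_brk => q /(sgn_br x) ->.
rewrite !E !E' E2 -IH -(jacobi a x b) [s b a]sgnC.
have ss : s a b * s a b = 1 by rewrite /sgn -signr_addb addbb.
by move: (s a b) (s a x) (s b x) ss => s1 s2 s3 h1; ring: h1.
Qed.

(** A leading letter in [S] acts on the rest of the word by [der]; any other leading letter yields a
    vector in the complement of the inducing line, of value [0]. The recursion is on the length,
    since [der] evaluates the functional at other words of the same length. *)
Fixpoint wval_rec n u : F :=
  match n, u with
  | n'.+1, a :: u' => if S a then der a (wval_rec n') u' else 0
  | _, _ => 1
  end.
(* The coefficient of the inducing vector in the value of a word on it. *)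
Definition wval u : F := wval_rec (size u) u.

Lemma wval_cons a u : wval (a :: u) = if S a then der a wval u else 0.
Proof.
by rewrite /wval /=; case: ifP => // _; apply: eq_der => v /= <-.
Qed.

(** A leading letter of [w] is removed by [rel_der], or gives zero. Then [a] and [b] are in front:
    if both lie in [S] the relation is [der_comm], if neither does all terms vanish since the
    letters outside [S] are closed under the bracket, and the mixed cases are the definition of
    [wval] up to skew symmetry. *)
Lemma rel_wval w a b u : rel_defect wval w a b u = 0.
Proof.
have [n] := ubnP (size w + size u); elim: n w a b u => // n IH w a b u.
case: w => [|c w] wu; rewrite /rel_defect; last first.
  rewrite !cat_cons !wval_cons (@eq_brk a b _ (fun q => if S c then der c wval (w ++ q :: u) else 0)); last first.
    by move=> q _; rewrite -wval_cons.
  case: (S c); last by rewrite brk0; ring.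
  by apply: rel_der => w' a' b' u' hs; apply: IH; move: wu hs; rewrite /=; lia.
rewrite !cat0s !wval_cons (@eq_brk a b _ (fun q => if S q then der q wval u else 0)); last first.
  by move=> q _; rewrite -wval_cons.
have neg (x y : g) : ~~ S x -> der y (fun v => wval (x :: v)) u = 0.
  by move=> /negPf Sx; rewrite -[RHS](der0 y u); apply: eq_der => v _; rewrite wval_cons Sx.
have pos (x y : g) : S x -> der y (fun v => wval (x :: v)) u = der y (der x wval) u.
  by move=> Sx; apply: eq_der => v _; rewrite wval_cons Sx.
have br (x y : g) : brk x y (fun q => wval (q :: u)) = brk x y (fun q => if S q then der q wval u else 0).
  by apply: eq_brk => q _; rewrite wval_cons.
have ss : s a b * s a b = 1 by rewrite /sgn -signr_addb addbb.
case: (boolP (S a)) => Sa; case: (boolP (S b)) => Sb /=.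
- rewrite pos // pos // !br [s b a]sgnC (skew b a) [s b a]sgnC.
  have := der_comm wval u Sb Sa; rewrite [s b a]sgnC => h.
  have -> : der a (der b wval) u = s a b * (der b (der a wval) u - brk a b (fun q => der q wval u)).
    by rewrite -h opprB addrC subrK mulrA ss mul1r.
  rewrite (@eq_brk a b (fun q => if S q then der q wval u else 0) (fun q => der q wval u)) => [|q /(S_br Sa Sb) -> //].
  by move: (s a b) ss => s1 h1; ring: h1.
- by rewrite neg // br; ring.
- by rewrite neg // br (skew b a) [s b a]sgnC; move: (s a b) ss => s1 h1; ring: h1.
- rewrite (@eq_brk a b _ (fun=> 0)) => [|q /(notS_br Sa Sb) /negPf -> //].
  by rewrite brk0; ring.
Qed.

Lemma der_last f c w : S c ->
  (forall b v, S b -> (size v <= size w)%N -> f (v ++ [:: b]) = chi b * f v) ->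
  forall b, S b -> der c f (w ++ [:: b]) = chi b * der c f w.
Proof.
move=> Sc; elim: w f => [|x w IH] f hf b Sb /=.
  rewrite (@eq_brk c b _ (fun q => f [::] * chi q)) => [|q /(S_br Sc Sb) Sq]; last first.
    by rewrite (hf q.2 [::]) // mulrC.
  rewrite brkZ chi_br // (hf b [::]) //; case: (boolP (lpar c && lpar b)) => [/andP[/chi_odd -> _]|_].
    by rewrite /sgn; ring.
  by rewrite /sgn expr0; ring.
rewrite IH // => [|b' v Sb' vw]; last by apply: (hf b' (x :: v)).
rewrite (@eq_brk c x _ (fun q => chi b * f (q :: w))) => [|q _]; last exact: (hf b (q.2 :: w)).
by rewrite brkZ; ring.
Qed.

Lemma wval_last w b : S b -> wval (w ++ [:: b]) = chi b * wval w.
Proof.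
have [n] := ubnP (size w); elim: n w b => // n IH [|c w] b wn Sb.
  by rewrite wval_cons Sb.
rewrite cat_cons !wval_cons; case: ifP => [Sc|]; last by rewrite mulr0.
by apply: der_last => // b' v Sb' vw; apply: IH => //; move: wn vw; rewrite /=; lia.
Qed.

Lemma ind_in_neq0 (rho : g -> even_line F -> even_line F)
    (rho_par : forall b m, S b -> par (rho b m) = sgn F (lpar b) *: rho b (par m)) :
  (forall b m, S b -> rho b m = chi b *: m) -> ind_in rho_par (1 : F) <> 0.
Proof.
(* The prefix [w] absorbs left multiplication, under which the relations are closed: [lmul b]
   amounts to appending [b] to the prefix. *)
move=> hrho h0; pose val (w : seq g) := @fglift F F^o _ (fun p : seq g * even_line F => wval (w ++ p.1) * (p.2 : F) : F^o).
have valL w : linear (val w) by apply: fglift_linear.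
have valm w u (m : F) : val w (mon u (m : even_line F)) = wval (w ++ u) * m.
  by rewrite /val /mon liftU [LHS]mul1r.
have vall w b y : val w (lmul b y) = val (rcons w b) y.
  elim/mon_ind: y => [|c u m y IH]; first by rewrite (lin0 (@lmul_linear F g _ b)) !(lin0 (valL _)).
  by rewrite lmul_linear !valL IH lmul_mon !valm cat_rcons.
have kill y : ind_rel S rho y -> forall w, val w y = 0.
  elim=> {y} [|c x y _ Lx _ Ly|b x _ Lx|c m m'|a b u m|b m Sb] w.
  - exact: lin0 (valL w).
  - by rewrite valL Lx Ly scaler0 addr0.
  - by rewrite vall Lx.
  - by rewrite (linB (valL w)) valL !valm [X in X - _](_ : _ = c *: (wval (w ++ [::]) * m : F^o) + wval (w ++ [::]) * m') ?subrr // -[c *: (_ : F^o)]/(c * _) -[c *: (m : F^o)]/(c * m) mulrDr mulrCA.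
  - rewrite !(linB (valL w)) (linZ (valL w)) (lin_sum (valL w)) !valm.
    transitivity (rel_defect wval w a b u * m : F^o); last by rewrite rel_wval mul0r.
    rewrite /rel_defect !mulrBl; congr (_ - _ - _); first exact: mulrA.
    by rewrite /brk mulr_suml; apply: eq_bigr => q _; rewrite (linZ (valL w)) valm; apply: mulrA.
  - by rewrite (linB (valL w)) !valm hrho // wval_last // cats0 -[chi b *: (m : F^o)]/(chi b * m) mulrCA mulrA subrr.
have /lpi_eq : lpi (ind_rel_subspace S rho) (@mon F g (even_line F) [::] (1 : F)) = lpi (ind_rel_subspace S rho) 0.
  by rewrite (lin0 (lpi_linear _)).
rewrite subr0 => /kill /(_ [::]); rewrite valm mulr1 => /eqP; by rewrite oner_eq0.
Qed.
End NonzeroInduced.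

(** * Skew symmetry and Jacobi identity for the affine bracket *)

Section AffineStructureConstants.
Variable F : fieldType.
Implicit Types (x y z : gl11_basis) (r t u : int) (L : agl11 F -> F).

Lemma brk_modes x r y t L : @brk F (agl11 F) (mode F x r) (mode F y t) L =
  \sum_(q <- gl11_br F x y) q.1 * L (mode F q.2 (r + t))
  + (if r + t == 0 then r%:~R else 0) * (kappa F x y * L None).
Proof.
rewrite /brk /= big_cat big_map /=; congr (_ + _).
case: eqP => _ /=; last by rewrite big_nil mul0r.
case: eqP => [->|_]; first by rewrite big_nil mul0r mulr0.
by rewrite big_seq1 mulrA.
Qed.

Lemma brk_Nonel b L : @brk F (agl11 F) None b L = 0. Proof. by rewrite /brk big_nil. Qed.
Lemma brk_Noner a L : @brk F (agl11 F) a None L = 0.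
Proof. by case: a => [[x r]|]; rewrite /brk big_nil. Qed.

Lemma agl11_skew (a b : agl11 F) L :
  brk a b L = - (sgn F (lpar a && lpar b) * brk b a L).
Proof.
case: a => [[x r]|]; last by rewrite brk_Nonel brk_Noner mulr0 oppr0.
case: b => [[y t]|]; last by rewrite brk_Nonel brk_Noner mulr0 oppr0.
rewrite -[Some (x, r)]/(mode F x r) -[Some (y, t)]/(mode F y t) !brk_modes [t + r]addrC.
have -> : (if r + t == 0 then t%:~R else 0) = - (if r + t == 0 then r%:~R else 0) :> F.
  case: eqP => [rt|_]; last by rewrite oppr0.
  by rewrite -rmorphN; congr (_%:~R); lia.
by case: x; case: y; rewrite /= ?big_cons ?big_nil /=; rewrite /sgn ?expr0 ?expr1; ring.
Qed.

Lemma agl11_jacobi (a b c : agl11 F) L :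
  brk c a (fun q => brk q b L) + sgn F (lpar c && lpar a) * brk c b (fun q => brk a q L)
  = brk a b (fun q => brk c q L).
Proof.
case: a => [[x r]|]; last first.
  rewrite brk_Nonel brk_Noner add0r [brk c b _](_ : _ = 0) ?mulr0 // /brk.
  by apply: big1 => q _; rewrite [X in _ * X](brk_Nonel q.2 L) mulr0.
case: b => [[y t]|]; last first.
  rewrite !brk_Noner mulr0 addr0 /brk.
  by apply: big1 => q _; rewrite [X in _ * X](brk_Noner q.2 L) mulr0.
case: c => [[z u]|]; last first.
  rewrite !brk_Nonel mulr0 addr0 [RHS]/brk big1 // => q _.
  by rewrite [X in _ * X](brk_Nonel q.2 L) mulr0.
rewrite -[Some (x, r)]/(mode F x r) -[Some (y, t)]/(mode F y t) -[Some (z, u)]/(mode F z u).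
have e1 : r + (u + t) = u + r + t by ring.
have e2 : u + (r + t) = u + r + t by ring.
rewrite !brk_modes !brk_Nonel !brk_Noner.
case: x; case: y; case: z; rewrite /= ?big_cons ?big_nil /= ?brk_modes /= ?big_cons ?big_nil /= ?e1 ?e2 /sgn ?expr0 ?expr1.
all: try ring.
all: case: eqP => [s0|_]; last by ring.
all: have et : t = - u - r by lia.
all: rewrite ?et ?(rmorphB, rmorphD, rmorphN) /=; ring.
Qed.
End AffineStructureConstants.

(** * A vector of type (n, l) in A *)

Section AtypicalIrreducible.
Variables (F : fieldType) (k : F).
Hypothesis F0 : forall n, (n%:R == 0 :> F) = (n == 0)%N.
Hypothesis k0 : k != 0.
Implicit Types (l i j r : int) (n : F).

Lemma natz0 l : (l%:~R == 0 :> F) = (l == 0).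
Proof.
have H (d : nat) : (d%:Z%:~R == 0 :> F) = (d%:Z == 0) by rewrite -pmulrn F0.
have [l_0|l_0] := lerP 0 l; first by rewrite -(gez0_abs l_0) H.
by rewrite -oppr_eq0 -rmorphN -[LHS]/((- l)%:~R == 0) -(ltz0_abs l_0) H ltz0_abs // oppr_eq0.
Qed.

Section Chain.
Variable W : smod (agl11 F).
Hypothesis Wk : level k W.
Local Notation m r := (@act F (agl11 F) W (mode F gpsim r)).
Local Notation p r := (@act F (agl11 F) W (mode F gpsip r)).

Lemma homog_act b (a : agl11 F) (y : W) : homog b y -> homog (lpar a (+) b) (act a y).
Proof. by rewrite /homog => hy; rewrite act_par hy actZ scalerA sgn_add. Qed.

(** Applying [psi^+_(-i)] to [psi^-_i y] returns [(l - i) k y], which is nonzero for [i <> l]. *)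
Lemma chain_m n l i (y : W) : sing i (- i - 1) y -> etype n (l%:~R * k) y -> y <> 0 -> i != l ->
  [/\ sing (i - 1) (- i) (m i y), etype (n - 1) (l%:~R * k) (m i y) & m i y <> 0].
Proof.
move=> [hN hE hm hp] ey y0 il; split; [|exact: etype_m|].
  split=> r hr.
  - by rewrite brNm hN // hm ?act0 ?subr0 //; lia.
  - by rewrite brEm hE ?act0.
  - by have [->|ri] := eqVneq r i; [exact: (mm0 F0)|rewrite brmm hm ?act0 ?oppr0 //; lia].
  - rewrite (brpm Wk) hp ?act0 ?oppr0 ?add0r; last by lia.
    by rewrite hE ?add0r ?gt_eqF ?scale0r //; lia.
move=> my; have := brpm Wk (- i) i y; rewrite my act0 hp; last by lia.
rewrite act0 oppr0 add0r addNr eqxx (proj2 ey) -scalerDl -mulrDl => /esym/eqP.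
rewrite scaler_eq0 mulf_eq0 (negPf k0) orbF -rmorphD natz0 => /orP[|/eqP //].
by rewrite subr_eq0 eq_sym (negPf il).
Qed.

Lemma chain_p n l i (y : W) : sing i (- i - 1) y -> etype n (l%:~R * k) y -> y <> 0 -> i + 1 != l ->
  [/\ sing (i + 1) (- i - 2) (p (- i - 1) y), etype (n + 1) (l%:~R * k) (p (- i - 1) y) & p (- i - 1) y <> 0].
Proof.
move=> [hN hE hm hp] ey y0 il; split; [|exact: etype_p|].
  split=> r hr.
  - by rewrite brNp hN // hp ?act0 ?addr0 //; lia.
  - by rewrite brEp hE ?act0.
  - rewrite (brmp Wk) hm ?act0 ?oppr0 ?add0r; last by lia.
    by rewrite hE ?sub0r ?gt_eqF ?scale0r ?oppr0 //; lia.
  - by have [->|ri] := eqVneq r (- i - 1); [exact: (pp0 F0)|rewrite brpp hp ?act0 ?oppr0 //; lia].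
move=> py; have := brmp Wk (i + 1) (- i - 1) y; rewrite py act0 hm; last by lia.
have -> : i + 1 + (- i - 1) = 0 by ring.
rewrite act0 oppr0 add0r eqxx (proj2 ey) -scalerBl -mulrBl => /esym/eqP.
rewrite scaler_eq0 mulf_eq0 (negPf k0) orbF -rmorphB natz0 => /orP[|/eqP //].
by rewrite subr_eq0 eq_sym (negPf il).
Qed.

(** The highest weight vector is moved by [psi^+_(-1)], ..., [psi^+_(1-l)] for [l > 0] and by
    [psi^-_0], ..., [psi^-_(l+1)] for [l < 0]. With the shift by one half in the label of the Verma
    module, [epsilon] makes its [N_0]-eigenvalue [n - l + 1] or [n - l]; after [l - 1] steps up or
    [|l|] steps down this becomes [n]. *)
Lemma chain_vtype n l (y : W) : l != 0 -> homog false y -> y <> 0 -> sing 0 (-1) y ->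
  etype (n - l%:~R + epsilon l + 2%:R^-1) (l%:~R * k) y ->
  exists (x : W) b, [/\ homog b x, x <> 0 & vtype k n l x].
Proof.
have half : 2%:R^-1 + 2%:R^-1 = 1 :> F.
  by rewrite -[RHS](@divff _ (2%:R : F)) ?F0 // mulr_natl mulr2n.
move=> l0 hy y0 sy; rewrite /epsilon (negPf l0); case: ltrP => l_0 ey.
  have H (d : nat) : d%:Z < l -> exists (x : W) b, [/\ homog b x, x <> 0, sing d%:Z (- d%:Z - 1) x &
      etype (n - l%:~R + 1 + d%:R) (l%:~R * k) x].
    elim: d => [|d IH] dl.
      by exists y, false; split=> //; move: ey; rewrite addr0 -addrA half.
    have [|x [b [hx x0 sx ex]]] := IH; first by lia.
    have [|h1 h2 h3] := chain_p sx ex x0; first by lia.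
    exists (p (- d%:Z - 1) x), (~~ b); split=> //; first exact: homog_act hx.
      by move: h1; congr (sing _ _ _); lia.
    by move: h2; rewrite -[d.+1]addn1 natrD -!addrA.
  have [|x [b [hx x0 sx ex]]] := H (absz l).-1; first by lia.
  exists x, b; split=> //; split; first by apply: sing_le sx; lia.
  have -> : n = n - l%:~R + 1 + (absz l).-1%:R; last exact: ex.
  have -> : l%:~R = (absz l).-1%:R + 1 :> F by rewrite -(natrD _ _ 1) pmulrn; congr (_%:~R); lia.
  by ring.
have H (d : nat) : d%:Z <= - l -> exists (x : W) b, [/\ homog b x, x <> 0, sing (- d%:Z) (d%:Z - 1) x &
    etype (n - l%:~R - d%:R) (l%:~R * k) x].
  elim: d => [|d IH] dl.
    by exists y, false; split=> //; move: ey; rewrite subr0 subrK.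
  have [|x [b [hx x0 sx ex]]] := IH; first by lia.
  have [| |h1 h2 h3] := @chain_m (n - l%:~R - d%:R) l (- d%:Z) x _ ex x0; rewrite ?opprK //; first by lia.
  exists (m (- d%:Z) x), (~~ b); split=> //; first exact: homog_act hx.
    by move: h1; rewrite opprK; congr (sing _ _ _); lia.
  by move: h2; rewrite -[d.+1]addn1 natrD opprD !addrA.
have [|x [b [hx x0 sx ex]]] := H (absz l); first by lia.
exists x, b; split=> //; split; first by apply: sing_le sx; lia.
have -> : n = n - l%:~R - (absz l)%:R; last exact: ex.
have -> : l%:~R = - (absz l)%:R :> F; last by ring.
by rewrite pmulrn -rmorphN; congr (_%:~R); lia.
Qed.
End Chain.

(** Irreducibility concerns subspaces stable under the parity; a subspace stable only under the
    modes is replaced by its intersection with its image under the parity, which still contains the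
    homogeneous vector [x]. *)
Lemma irreducible_generated (A : smod (agl11 F)) b (x : A) :
  smod_irreducible A -> homog b x -> x <> 0 -> generated x.
Proof.
move=> [_ irr] hx x0 S hS Sa Sx y.
have [|/(_ x) h|/(_ y) []//] := irr (fun w => S w /\ S (par w)).
  split=> [|w [h1 h2]|a w [h1 h2]]; last 2 first.
  - by rewrite parK.
  - by split; [exact: Sa|rewrite act_par; apply: subspaceZ => //; apply: Sa].
  split; first by rewrite (lin0 (@par_linear _ A)); split; apply: (proj1 hS).
  move=> c u w [u1 u2] [w1 w2]; rewrite par_linear.
  by split; apply: (proj2 hS).
by case: x0; apply: h; split=> //; rewrite hx; apply: subspaceZ.
Qed.

Lemma hat_A_neq0 n : hat_in k (1 : A_mod n) <> 0.
Proof.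
pose chi (x : agl11 F) : F := match x with Some (gN, r) => if r == 0 then n else 0 | None => k | _ => 0 end.
apply: (@ind_in_neq0 F (agl11 F) (@agl11_nonneg F) chi (@agl11_skew F) (@agl11_jacobi F)).
- move=> [[x r]|] [[y t]|] q //= r0 t0; rewrite mem_cat => /orP[/mapP [q' _ ->] /=|]; first by lia.
  by case: ifP => // _; rewrite inE => /eqP ->.
- move=> [[x r]|] [[y t]|] q //= r0 t0; rewrite mem_cat => /orP[/mapP [q' _ ->] /=|]; first by lia.
  by case: ifP => // /andP[/eqP rt]; lia.
- by move=> [[[] r]|].
- move=> [[x r]|] [[y t]|] // r0 t0; rewrite ?brk_Nonel ?brk_Noner //.
  rewrite -[Some (x, r)]/(mode F x r) -[Some (y, t)]/(mode F y t) brk_modes.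
  rewrite [X in _ + X](_ : _ = 0) ?addr0; last first.
    case: eqP => [rt|_]; last by rewrite mul0r.
    have -> : r = 0 by move: r0 t0 rt; rewrite /=; lia.
    by rewrite mul0r.
  by case: x {r0}; case: y {t0}; rewrite /= ?big_cons ?big_nil /= ?mulr0 ?addr0.
- move=> [[[] r]|] c Sb //=; case: eqP => // _; rewrite ?scale0r //.
Qed.

Lemma A_hat_vector m l (A : smod (agl11 F)) : is_A_hat k m l A ->
  forall n, m = n - l%:~R + epsilon l ->
  exists (x : A) b, [/\ level k A, homog b x, x <> 0, vtype k n l x & generated x].
Proof.
case=> [|{}l {}A q l0 irr [q_lin q_par q_act] q_surj] n mE.
  exists (hat_in k (1 : A_mod m)), false; split; [exact: level_hat| |exact: hat_A_neq0| |].
  - by rewrite /homog scale1r hat_in_par.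
  - have -> : n = m by rewrite mE /epsilon eqxx subr0 addr0.
    split; first by rewrite oppr0; apply: hat_in_sing0.
    by apply: hat_in_etype; rewrite //= mul0r scale0r.
  - apply: hat_in_generated => T hT _ T1 w.
    by rewrite -[w]mulr1; apply: (subspaceZ (w : F) hT T1).
pose u := ind_in (@verma_char_par F m (l%:~R * k)) (1 : F).
have u_act (a : gl11 F) : borel a -> @act F (gl11 F) (verma m (l%:~R * k)) a u =
    (match a with gN => m + 2%:R^-1 | gE => l%:~R * k | _ => 0 end) *: u.
  move=> ba; rewrite ind_in_act // -(linZ (ind_in_linear (@verma_char_par F m (l%:~R * k)))).
  by case: a ba => // _; rewrite /= scale0r.
have u_gen : generated (hat_in k (M := verma m (l%:~R * k)) u).
  apply: hat_in_generated => T hT Ta Tu; apply: (ind_generated hT Ta) => c.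
  have -> : ind_in (@verma_char_par F m (l%:~R * k)) c = c *: u.
    by rewrite -(linZ (ind_in_linear (@verma_char_par F m (l%:~R * k)))) -[c *: _]/(c * 1) mulr1.
  exact: subspaceZ.
have Ak : level k A.
  by move=> w; have [x <-] := q_surj w; rewrite -q_act level_hat (linZ q_lin).
set v := hat_in k (M := verma m (l%:~R * k)) u in u_gen.
have hp := u_act gpsip isT; rewrite scale0r in hp.
have v_sing : sing 0 (-1) v := hat_in_sing k0 hp.
have [vN vE] : etype (m + 2%:R^-1) (l%:~R * k) v := hat_in_etype k (u_act gN isT) (u_act gE isT).
have qv0 : q v <> 0.
  move=> qv; have [[w w0] _] := irr; apply: w0; have [x <-] := q_surj w.
  apply: (u_gen (fun x => q x = 0)) => // [|a y hy]; last by rewrite q_act hy act0.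
  by split=> [|c y z hy hz]; rewrite ?(lin0 q_lin) // q_lin hy hz scaler0 addr0.
have hqv : homog false (q v) by rewrite /homog scale1r q_par hat_in_par [par u]ind_in_par.
have sqv : sing 0 (-1) (q v).
  by case: v_sing => hN hE hm hp'; split=> r hr; rewrite -q_act ?hN ?hE ?hm ?hp' // (lin0 q_lin).
have eqv : etype (n - l%:~R + epsilon l + 2%:R^-1) (l%:~R * k) (q v).
  by rewrite -mE; split; rewrite -q_act ?vN ?vE (linZ q_lin).
have [x [b [hx x0 tx]]] := chain_vtype Ak l0 hqv qv0 sqv eqv.
exists x, b; split=> //; exact: (irreducible_generated irr hx x0).
Qed.
End AtypicalIrreducible.

Lemma lift_eigen (F : fieldType) (X Z : lmodType F) (f : X -> X) (g : Z -> Z) (p : X -> Z)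
    (c0 : F) (r : nat) (x : X) (d : nat) (c : 'I_d -> F) (y : 'I_d -> X) :
  linear f -> linear g -> linear p -> (forall w, p (f w) = g (p w)) ->
  iter r (fun z => g z - c0 *: z) (p x) = 0 -> x = \sum_i y i -> (forall i, geigen f (c i) (y i)) ->
  exists q, pact f q x = \sum_(i | c i == c0) y i /\ p (pact f q x) = p x.
Proof.
move=> lf lg lp pf zr xE hy; have [q [qy qz]] := geigen_projection c0 r lf hy.
exists q; split; last by rewrite (pact_morph q x lf lg lp pf) qz.
by rewrite xE (lin_sum (pact_linear lf q)) [RHS]big_mkcond; apply: eq_bigr => i _; rewrite qy.
Qed.

(** * Projectivity and the cover *)

Section Lifting.
Variables (F : fieldType) (k : F).
Hypothesis F0 : forall n, (n%:R == 0 :> F) = (n == 0)%N.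
Hypothesis k0 : k != 0.
Variables (Y : Vk k -> int -> Vk k -> Vk k) (hY : affine_vsa Y).
Local Notation VA := (Vk_vsalg hY).
Local Notation sm X := (smod_of F0 k0 X).
Local Notation Dv X := (@Dop F k (sm X) (@vm_Y F VA X : Vk k -> int -> X -> X)).
Implicit Types (X Z : vmod VA) (n : F) (l : int).

Lemma vhom_act b X Z (f : X -> Z) (a : agl11 F) (x : sm X) : vhom b f ->
  f (act a x) = sgn F (b && lpar a) *: @act F (agl11 F) (sm Z) a (f x).
Proof.
move=> [lf _ hf]; case: a => [[a r]|]; first exact: (hf _ _ _ _ (gen_homog k a)).
by rewrite andbF scale1r [LHS](linZ lf).
Qed.

Lemma sgn_unit b : sgn F b != 0. Proof. by rewrite expf_neq0 // oppr_eq0 oner_eq0. Qed.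

Lemma vhom_vtype b X Z (f : X -> Z) n l (x : sm X) : vhom b f -> vtype k n l x ->
  @vtype F k (sm Z) n l (f x).
Proof.
move=> hf [[hN hE hm hp] [en ee]]; have [lf _ _] := hf.
have ev (a : agl11 F) : act a x = 0 -> @act F (agl11 F) (sm Z) a (f x) = 0.
  move=> ax; have := vhom_act a x hf; rewrite ax (lin0 lf) => /esym/eqP.
  by rewrite scaler_eq0 (negPf (sgn_unit _)) => /eqP.
split; split.
- by move=> r /hN; apply: ev.
- by move=> r /hE; apply: ev.
- by move=> r /hm; apply: ev.
- by move=> r /hp; apply: ev.
- by have := vhom_act (mode F gN 0) x hf; rewrite andbF scale1r en (linZ lf).
- by have := vhom_act (mode F gE 0) x hf; rewrite andbF scale1r ee (linZ lf).
Qed.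

(** The vector [x] has [D]-weight [0], so its nonzero image under a mode of positive twisted degree
    would have a negative integer as weight, against [weight_nat]. *)
Lemma positive_kill X n l (x : sm X) : grading_restricted X -> etype n (l%:~R * k) x ->
  geigen (Dv X 0) (l%:~R * n) x -> sing l (- l) x.
Proof.
move=> [_ _ hbd] ex gx; pose hX := smod_of_vertex F0 k0 X; have Xk : level k (sm X) by [].
have kill (a : agl11 F) : 0 < deg l a -> act a x = 0.
  move=> al; apply: contrapT => ax; have [n' ea] := etype_act Xk a ex.
  have gl : geigen (Dv X l) 0 x.
    by apply/(Dop_shift F0 k0 Xk hX l 0 (proj1 ex)); rewrite add0r.
  have := geigen_act F0 k0 Xk hX a gl; move/(Dop_shift F0 k0 Xk hX l _ (proj1 ea)) => ga.
  have [|d] := weight_nat F0 k0 Xk hX ax ea ga.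
    have [N hN] := hbd (0 - (deg l a)%:~R + l%:~R * n'); exists N => M NM z hz.
    by apply: (hN M NM z); move: hz; rewrite Dop0.
  rewrite addrK sub0r => e; have : ((deg l a) + d%:Z)%:~R = 0 :> F by rewrite rmorphD /= -pmulrn -e subrr.
  by move/eqP; rewrite (natz0 F0); lia.
by split=> r hr; apply: kill; rewrite /=; lia.
Qed.

(** The preimage [x0] is projected by polynomials in [E_0], [N_0] and [L_0] in turn. These operators
    commute, so the eigenvalues already obtained persist, and the image stays the same because it
    has these eigenvalues itself. Then [positive_kill] applies, and averaging with the parity makes
    the lift homogeneous; its parity is shifted by that of [p]. *)
Lemma lift_vector bp b X Z (p : X -> Z) n l (x0 : X) : Ofin hY X -> vhom bp p ->
  par (p x0) = sgn F b *: p x0 -> @vtype F k (sm Z) n l (p x0) ->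
  exists x : sm X, [/\ p x = p x0, par x = sgn F (bp (+) b) *: x & vtype k n l x].
Proof.
move=> [_ gX ssN ssE] hp pz tz; have [lp pp _] := hp; have [sz [zn ze]] := tz.
pose hX := smod_of_vertex F0 k0 X; pose hZ := smod_of_vertex F0 k0 Z.
have Xk : level k (sm X) by []. have Zk : level k (sm Z) by [].
pose NX : X -> X := @act F (agl11 F) (sm X) (mode F gN 0); pose NZ : Z -> Z := @act F (agl11 F) (sm Z) (mode F gN 0).
pose EX : X -> X := @act F (agl11 F) (sm X) (mode F gE 0); pose EZ : Z -> Z := @act F (agl11 F) (sm Z) (mode F gE 0).
pose LX : X -> X := Dv X 0; pose LZ : Z -> Z := Dv Z 0.
have lNX : linear NX by apply: (@act_linear _ _ (sm X)). have lNZ : linear NZ by apply: (@act_linear _ _ (sm Z)).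
have lEX : linear EX by apply: (@act_linear _ _ (sm X)). have lEZ : linear EZ by apply: (@act_linear _ _ (sm Z)).
have lLX : linear LX := Dop_linear hX 0. have lLZ : linear LZ := Dop_linear hZ 0.
have pN w : p (NX w) = NZ (p w) by rewrite [LHS](vhom_act (mode F gN 0) (w : sm X) hp) andbF scale1r.
have pE w : p (EX w) = EZ (p w) by rewrite [LHS](vhom_act (mode F gE 0) (w : sm X) hp) andbF scale1r.
have pL w : p (LX w) = LZ (p w).
  rewrite /LX /LZ !Dop0; have [_ _ /(_ false _ 1 w (omega_even k))] := hp.
  by rewrite andbF scale1r.
have EN w : EX (NX w) = NX (EX w) by exact: (brEN0 Xk).
have EL w : LX (EX w) = EX (LX w).
  by have := Dop_act F0 k0 Xk hX 0 (mode F gE 0) w; rewrite /= mulr0z scale0r subr0.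
have NL w : LX (NX w) = NX (LX w).
  by have := Dop_act F0 k0 Xk hX 0 (mode F gN 0) w; rewrite /= mulr0z scale0r subr0.
have eig1 (V : lmodType F) (f : V -> V) c (y : V) : f y = c *: y -> geigen f c y.
  by move=> fy; exists 1%N; rewrite /= fy subrr.
have eig2 (V : lmodType F) (f : V -> V) d (c : 'I_d -> F) (y : 'I_d -> V) c0 : linear f ->
    (forall i, f (y i) = c i *: y i) -> f (\sum_(i | c i == c0) y i) = c0 *: \sum_(i | c i == c0) y i.
  move=> lf fy; elim/big_ind: _ => [|u w hu hw|i /eqP <- //]; first by rewrite (lin0 lf) scaler0.
  by rewrite (linD lf) hu hw scalerDr.
have [dE [cE [yE [xE hE]]]] := ssE x0.
have hE' : forall i, EX (yE i) = cE i *: yE i by exact: hE.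
have zE : iter 1 (fun z => EZ z - (l%:~R * k) *: z) (p x0) = 0 by rewrite /= /EZ ze subrr.
have [q1 [x1E px1]] := lift_eigen lEX lEZ lp pE zE xE (fun i => eig1 _ _ _ _ (hE' i)).
set x1 := pact EX q1 x0 in x1E px1.
have Ex1 : EX x1 = (l%:~R * k) *: x1 by rewrite x1E eig2.
have [dN [cN [yN [x1N hN]]]] := ssN x1.
have hN' : forall i, NX (yN i) = cN i *: yN i by exact: hN.
have zN : iter 1 (fun z => NZ z - n *: z) (p x1) = 0 by rewrite px1 /= /NZ zn subrr.
have [q2 [x2E px2]] := lift_eigen lNX lNZ lp pN zN x1N (fun i => eig1 _ _ _ _ (hN' i)).
set x2 := pact NX q2 x1 in x2E px2.
have Nx2 : NX x2 = n *: x2 by rewrite x2E eig2.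
have Ex2 : EX x2 = (l%:~R * k) *: x2.
  by rewrite /x2 (pact_morph q2 x1 lNX lNX lEX EN) Ex1 (linZ (pact_linear lNX q2)).
have [hG _ _] := gX; have [dL [cL [yL [x2L hL]]]] := hG x2.
have hL' : forall i, geigen LX (cL i) (yL i) by move=> i; rewrite /LX Dop0; exact: hL.
have [r zL] : geigen LZ (l%:~R * n) (p x2).
  rewrite px2 px1 -[_ * n]add0r; apply/(Dop_shift F0 k0 Zk hZ l 0 zn).
  exact: (geigen_sing F0 k0 Zk hZ sz ze).
have [q3 [x3E px3]] := lift_eigen lLX lLZ lp pL zL x2L hL'.
set x3 := pact LX q3 x2 in x3E px3.
have Lx3 : geigen LX (l%:~R * n) x3.
  rewrite x3E; elim/big_ind: _ => [|u w|i /eqP <- //]; [exact: geigen0|exact: (geigenD lLX)].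
have Nx3 : NX x3 = n *: x3.
  by rewrite /x3 (pact_morph q3 x2 lLX lLX lNX) ?Nx2 ?(linZ (pact_linear lLX q3)).
have Ex3 : EX x3 = (l%:~R * k) *: x3.
  by rewrite /x3 (pact_morph q3 x2 lLX lLX lEX) ?Ex2 ?(linZ (pact_linear lLX q3)).
have sx3 : sing l (- l) (x3 : sm X) by apply: (positive_kill gX) Lx3.
pose s := sgn F (bp (+) b); pose x : sm X := 2%:R^-1 *: (x3 + s *: par x3 : X).
have ss : s * s = 1 by rewrite /s /sgn -signr_addb addbb.
have t0 : 2%:R != 0 :> F by rewrite F0.
have par_act0 (a : agl11 F) : @act F (agl11 F) (sm X) a x3 = 0 -> act a x = 0.
  move=> ax; rewrite /x actZ (linD (@act_linear _ _ (sm X) a)) ax add0r actZ.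
  have /eqP := @act_par F (agl11 F) (sm X) a x3.
  rewrite ax (lin0 (@par_linear _ (sm X))) eq_sym scaler_eq0 (negPf (sgn_unit _)) => /eqP ->.
  by rewrite !scaler0.
have par_act1 (a : agl11 F) c : lpar a = false -> @act F (agl11 F) (sm X) a x3 = c *: x3 -> act a x = c *: x.
  move=> a0 ax; have := @act_par F (agl11 F) (sm X) a x3; rewrite a0 scale1r ax.
  rewrite (linZ (@par_linear _ (sm X))) => pa.
  rewrite /x actZ (linD (@act_linear _ _ (sm X) a)) ax actZ -pa.
  by rewrite [RHS]scalerCA; congr (_ *: _); rewrite scalerDr [s *: (c *: _)]scalerCA.
exists x; split.
- rewrite /x (linZ lp) (linD lp) (linZ lp).
  have -> : p (par x3) = s *: p x3.
    have := pp x3; rewrite px3 px2 px1 pz => e.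
    transitivity (sgn F bp *: (sgn F bp *: p (par x3))).
      by rewrite scalerA /sgn -signr_addb addbb scale1r.
    by rewrite -e scalerA /s sgn_add.
  rewrite scalerA ss scale1r -[p x3 + p x3]/(p x3 *+ 2) -scaler_nat scalerA mulVf // scale1r.
  by rewrite px3 px2.
- rewrite /x (linZ (@par_linear _ X)) (linD (@par_linear _ X)) (linZ (@par_linear _ X)) parK.
by rewrite [RHS]scalerCA [s *: (_ + _)]scalerDr scalerA ss scale1r addrC.
- case: sx3 => h1 h2 h3 h4; split; split; try by move=> r' hr; apply: par_act0; auto.
    by apply: par_act1.
  by apply: par_act1.
Qed.

End Lifting.

Section Cover.
Variables (F : fieldType) (k : F).
Hypothesis F0 : forall n, (n%:R == 0 :> F) = (n == 0)%N.
Hypothesis k0 : k != 0.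
Variables (Y : Vk k -> int -> Vk k -> Vk k) (hY : affine_vsa Y).
Local Notation VA := (Vk_vsalg hY).
Local Notation sm X := (smod_of F0 k0 X).
Implicit Types (X Z P A : vmod VA) (n : F) (l : int).

Section Transfer.
Variables (W : smod (agl11 F)) (YW : Vk k -> int -> W -> W) (hW : vertex_structure hY YW).
Hypothesis Wk : level k W.
Local Notation W' := (sm (to_vmod hW)).

Lemma to_vmod_act (a : agl11 F) (w : W) : @act F (agl11 F) W' a w = act a w.
Proof. by case: a => [[a r]|]; [exact: (proj2 hW)|rewrite Wk]. Qed.

Lemma to_vmod_vtype n l (w : W) : vtype k n l w -> @vtype F k W' n l w.
Proof.
move=> [[hN hE hm hp] [en ee]]; split; split; try by move=> r hr; rewrite to_vmod_act; auto.
  by rewrite to_vmod_act.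
by rewrite to_vmod_act.
Qed.

Lemma to_vmod_generated (w : W) : generated w -> @generated F W' w.
Proof.
move=> gw S hS Sa Sw; apply: gw => // a y Sy; rewrite -to_vmod_act; exact: Sa.
Qed.

Lemma to_vmod_universal n l (w : W) : universal k n l w -> @universal F k W' n l w.
Proof.
move=> uw X Xk x tx; have [g [lg ga gx]] := uw X Xk x tx.
by exists g; split=> // a y; rewrite to_vmod_act ga.
Qed.
End Transfer.

(* Maps commuting with all modes correspond to even and odd morphisms after
   composition with the parity. *)
Definition super_hom (b : bool) X Z (g : X -> Z) (x : X) : Z := if b then g (par x) else g x.

Lemma super_homP b X Z (g : sm X -> sm Z) (v : sm X) : linear g ->
  (forall a w, g (act a w) = act a (g w)) -> generated v -> par v = v ->
  par (g v) = sgn F b *: g v -> vhom b (super_hom b (g : X -> Z)).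
Proof.
move=> lg ga gv pv pgv.
have gp w : par (g w) = sgn F b *: g (par w).
  apply: (gv (fun w => par (g w) = sgn F b *: g (par w))) => [|a y hy|]; last by rewrite pgv pv.
    split=> [|c u w' hu hw].
      by rewrite (lin0 lg) !(lin0 (@par_linear _ _)) (lin0 lg) scaler0.
    by rewrite lg !par_linear hu hw lg scalerDr scalerCA.
  by rewrite ga !act_par hy (linZ lg) ga (linZ (@act_linear _ _ (sm Z) a)) scalerCA.
have gY := vs_hom F0 (smod_of_vertex F0 k0 X) (smod_of_vertex F0 k0 Z) lg gp (fun a r => ga (mode F a r)).
case: b gp {pgv} => gp; split; rewrite /super_hom.
- by move=> c u w; rewrite par_linear lg.
- by move=> w; rewrite gp.
- move=> p u r w hu; have fX := proj1 (vm_axioms X).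
  rewrite (Y_par fX) hu (linZ (Y_linear_l fX _ _)) (linZ lg); congr (_ *: _); exact: gY.
- exact: lg.
- exact: gp.
- by move=> p u r w hu; rewrite scale1r; exact: gY.
Qed.

Lemma projective_universal P (v : sm P) n l : Ofin hY P -> par v = v -> vtype k n l v ->
  generated v -> universal k n l v -> projective (Ofin hY) P.
Proof.
move=> OP pv tv gv uv; split=> // X Z p f OX _ [bp hp] psurj [bf hf].
have [x0 px0] := psurj (f v); have [lf fp _] := hf; have [lp _ _] := hp.
have [||x [px xp tx]] := @lift_vector F k F0 k0 Y hY bp bf X Z p n l x0 OX hp.
- by rewrite px0 fp pv.
- by rewrite px0; apply: (vhom_vtype hf tv).
have [g [lg ga gx]] := uv (sm X) (fun=> erefl) x tx.
have hG : vhom (bp (+) bf) (super_hom (bp (+) bf) (g : P -> X)).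
  by apply: (super_homP lg ga gv pv); rewrite gx.
exists (super_hom (bp (+) bf) (g : P -> X)); split; first by exists (bp (+) bf).
have [lG _ _] := hG.
apply: (gv (fun w => p (super_hom (bp (+) bf) (g : P -> X) w) = f w)) => [|a y hy|].
- split=> [|c u w hu hw]; first by rewrite (lin0 lG) (lin0 lp) (lin0 lf).
  by rewrite lG lp hu hw lf.
- rewrite (vhom_act (F0 := F0) (k0 := k0) a y hG) (linZ lp) (vhom_act (F0 := F0) (k0 := k0) a _ hp) hy.
  rewrite (vhom_act (F0 := F0) (k0 := k0) a y hf) scalerA; congr (_ *: _).
  by rewrite /sgn -signr_addb; congr (_ ^+ _); case: (bp) (bf) (lpar a) => [] [] [].
- by rewrite /super_hom; case: (bp (+) bf); rewrite ?pv gx px px0.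
Qed.

(** The vector [u] has [D]-weight [0], so only words without letters occur in its expansion. *)
Lemma zero_span P (v u : sm P) n l : par v = v -> vtype k n l v -> generated v -> vtype k n l u ->
  exists c : 'I_4 -> F, u = \sum_i c i *: zero_vec l v i.
Proof.
move=> pv tv gv tu; pose hP := smod_of_vertex F0 k0 P; have Pk : level k (sm P) by [].
have hv : homog false v by rewrite /homog scale1r.
have [sv4 _ _] := layer_sub F0 k0 Pk hv tv gv 4.
have hu : layer l v 4 u.
  apply: (gv (layer l v 4)) => [||]; first exact: sv4.
    by have [_ _] := layer_sub F0 k0 Pk hv tv gv 4.
  by apply: lspan_in; exists 0, 0%N; apply: word0; split=> //; exists 3.
have gu := geigen_sing F0 k0 Pk hP (proj1 tu) (proj2 (proj2 tu)).
have := words_weight F0 k0 Pk hP (@zero_gens_eigen F k F0 k0 (sm P) Pk Y hY _ hP n l false v hv tv gv 4) hu gu.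
elim=> [|c x y [h [d [hx e]]] _ [c' ->]].
  by exists (fun=> 0); rewrite big1 // => i _; rewrite scale0r.
have d0 : d = 0%N.
  by have [x0 [h0 _]] := word_base hx; move: e; rewrite h0 add0r => /eqP; rewrite F0 => /eqP.
rewrite {}d0 in hx e.
have [j j4 ->] : zero_base l v 4 x.
  inversion hx; last by lia.
  by case: H.
exists (fun i => (if i == Ordinal j4 then c else 0) + c' i).
under [RHS]eq_bigr do rewrite scalerDl; rewrite [RHS]big_split; congr (_ + _).
by rewrite (bigD1 (Ordinal j4)) //= eqxx big1 ?addr0 // => i /negPf ->; rewrite scale0r.
Qed.

(** The product [psi^-_l psi^+_(-l)] sends the combination to the bottom vector; modulo that vector,
    each zero mode alone sends it to one of the middle vectors, and [v] is what is left. *)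
Lemma zero_submodule P (v : sm P) l (c : 'I_4 -> F) (T : sm P -> Prop) : act (mode F gE 0) v = (l%:~R * k) *: v ->
  subspace T -> (forall (a : agl11 F) w, T w -> T (act a w)) -> c ord_max = 1 ->
  T (\sum_i c i *: zero_vec l v i) -> T v.
Proof.
move=> ev hT Ta c3; rewrite !big_ord_recl big_ord0 addr0 /zero_vec /=.
have -> : fintype.lift ord0 (fintype.lift ord0 (fintype.lift ord0 ord0)) = ord_max :> 'I_4 by apply: val_inj.
rewrite c3 scale1r; have Pk : level k (sm P) by [].
set c0 := c _; set c1 := c _; set c2 := c _.
pose p w := @act F (agl11 F) (sm P) (mode F gpsip (- l)) w.
pose m w := @act F (agl11 F) (sm P) (mode F gpsim l) w.
pose u := c0 *: m (p v) + (c1 *: p v + (c2 *: m v + v)); move=> Tu0; have Tu : T u by exact: Tu0.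
have lp : linear p by apply: act_linear. have lm : linear m by apply: act_linear.
have ppv w : p (p w) = 0 by apply: (pp0 F0). have mmv w : m (m w) = 0 by apply: (mm0 F0).
have pmv w : act (mode F gE 0) w = (l%:~R * k) *: w -> p (m w) = - m (p w) by apply: (zero_pm Pk).
have pmp : p (m (p v)) = 0.
  by rewrite pmv ?ppv ?(lin0 lm) ?oppr0 // /p brEp ev actZ.
have Tp w : T w -> T (p w) by apply: (Ta).
have Tm w : T w -> T (m w) by apply: (Ta).
have pmv' := pmv v ev.
clear pmv; move: @u Tu; clearbody p m => u Tu.
have pu : p u = p v - c2 *: m (p v).
  by rewrite /u !(linD lp) !(linZ lp) pmp ppv pmv'; lmod F.
have mu : m u = c1 *: m (p v) + m v by rewrite /u !(linD lm) !(linZ lm) !mmv; lmod F.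
have mpu : m (p u) = m (p v) by rewrite pu (linB lm) (linZ lm) mmv scaler0 subr0.
have Tmpv : T (m (p v)) by rewrite -mpu; apply: Tm; apply: Tp.
have Tpv : T (p v).
  have -> : p v = p u + c2 *: m (p v) by rewrite pu subrK.
  by apply: (subspaceD hT); [apply: Tp|apply: (subspaceZ)].
have Tmv : T (m v).
  have -> : m v = m u - c1 *: m (p v) by rewrite mu addrC addKr.
  by apply: (subspaceB hT); [apply: Tm|apply: (subspaceZ)].
have -> : v = u - (c0 *: m (p v) + c1 *: p v + c2 *: m v) by rewrite /u; lmod F.
apply: (subspaceB hT) => //; apply: (subspaceD hT); last exact: (subspaceZ).
by apply: (subspaceD hT); apply: (subspaceZ).
Qed.

(** Otherwise the difference of the two sides, rescaled to have coefficient [1] at [a0], would lie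
    in the zero subspace, and [zero_submodule] would force [a0 = 0]. *)
Lemma zero_coeff A (a0 : sm A) l (c : 'I_4 -> F) : act (mode F gE 0) a0 = (l%:~R * k) *: a0 -> a0 <> 0 ->
  \sum_i c i *: zero_vec l a0 i = a0 -> c ord_max = 1.
Proof.
move=> ea a00 e; apply/eqP; rewrite -subr_eq0; apply/eqP; apply: contrapT => /eqP c3; apply: a00.
pose c' := fun i => c i - (i == ord_max)%:R.
apply: (@zero_submodule A a0 l (fun i => c' i / c' ord_max) (fun w => w = 0)) => //.
- by split=> [//|t u w -> ->]; rewrite scaler0 addr0.
- by move=> a w ->; rewrite act0.
- by apply: divff; rewrite /c' eqxx.
transitivity ((c' ord_max)^-1 *: \sum_i c' i *: zero_vec l a0 i).
  by rewrite scaler_sumr; apply: eq_bigr => i _; rewrite scalerA mulrC.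
rewrite (_ : \sum_i _ = 0) ?scaler0 //.
under eq_bigr do rewrite scalerBl; rewrite sumrB e.
rewrite (bigD1 ord_max) // eqxx scale1r big1; first by apply/eqP; rewrite subr_eq0 eq_sym; apply/eqP; apply: addr0.
by move=> i /negPf ->; rewrite scale0r.
Qed.

Lemma vhom_image b X Z (f : X -> Z) : vhom b f ->
  subspace (fun z : sm Z => exists x, f x = z) /\
  forall (a : agl11 F) (z : sm Z), (exists x, f x = z) -> exists x, f x = act a z.
Proof.
move=> hf; have [lf _ _] := hf; split=> [|a z [x <-]].
  split=> [|c u w [x <-] [x' <-]]; first by exists 0; apply: (lin0 lf).
  by exists (c *: x + x'); apply: lf.
exists ((sgn F (b && lpar a))^-1 *: @act F (agl11 F) (sm X) a x).
rewrite (linZ lf) (vhom_act (F0 := F0) (k0 := k0) a x hf) scalerA mulVf ?scale1r //.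
exact: sgn_unit.
Qed.

Lemma atypical_cover P A (v : sm P) (a0 : sm A) b n l : Ofin hY P -> Ofin hY A ->
  par v = v -> vtype k n l v -> generated v -> universal k n l v ->
  homog b a0 -> a0 <> 0 -> vtype k n l a0 -> generated a0 ->
  projective_cover (Ofin hY) P A.
Proof.
move=> OP OA pv tv gv uv ha a00 ta ga; have [_ [_ ev]] := tv; have [_ [_ ea]] := ta.
have [g [lg gact gx]] := uv (sm A) (fun=> erefl) a0 ta.
pose pi := super_hom b (g : P -> A).
have hpi : vhom b pi by apply: (super_homP lg gact gv pv); rewrite gx.
have piv : pi v = a0 by rewrite /pi /super_hom; case: (b); rewrite ?pv gx.
have [lpi ppi _] := hpi.
have act_pi (a : agl11 F) (w : sm P) : pi (act a w) = sgn F (b && lpar a) *: @act F (agl11 F) (sm A) a (pi w).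
  exact: vhom_act.
have [im_sub im_act] := vhom_image hpi.
have pi_surj : surj pi by apply: (ga _ im_sub im_act); exists v.
split=> //; first exact: (projective_universal OP pv tv gv uv).
exists pi; split; first by exists b.
  exact: pi_surj.
move=> Q q [OQ Qproj] [bq hq] qsurj.
have [qt [[bt ht] qtE]] : exists qt : Q -> P, morphism qt /\ forall w, pi (qt w) = q w.
  by apply: Qproj => //; [exists b|exists bq].
exists qt; split; [by exists bt| |by move=> w; rewrite qtE].
have [lqt _ _] := ht; have [x0 qx0] := qsurj a0.
have [||x [qx _ tx]] := @lift_vector F k F0 k0 Y hY bq b Q A q n l x0 OQ hq; rewrite ?qx0 //.
have tu := vhom_vtype ht tx; set u := qt x in tu.
have piu : pi u = a0 by rewrite qtE qx.
have [c uE] := zero_span pv tv gv tu.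
have [imq_sub imq_act] := vhom_image ht.
apply: (gv _ imq_sub imq_act); apply: (zero_submodule ev imq_sub imq_act (c := c)); last first.
  by rewrite -uE; exists x.
(* The map [pi] may be odd, so it preserves the zero vectors only up to signs; at the top vector the
   sign is [1], and the coefficient of [v] in [u] can be read off in [A]. *)
have [e ez] : exists e : 'I_4 -> F, e ord_max = 1 /\ forall i : 'I_4, pi (zero_vec l v i) = e i *: zero_vec l a0 i.
  exists (fun i : 'I_4 => sgn F (b && ((i == 1%N :> nat) || (i == 2%N :> nat)))).
  have aP a (w : sm P) : lpar a -> pi (act (a : agl11 F) w) = sgn F b *: @act F (agl11 F) (sm A) a (pi w).
    by move=> odd_a; rewrite act_pi odd_a andbT.
  split=> [|[[|[|[|[|i]]]] lti] //]; first by rewrite andbF.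
  - rewrite [LHS](aP (mode F gpsim l)) // [pi _](aP (mode F gpsip (- l))) // piv.
    by rewrite (linZ (@act_linear _ _ (sm A) _)) scalerA /sgn -signr_addb addbb andbF.
  - by rewrite [LHS](aP (mode F gpsip (- l))) // piv andbT.
  - by rewrite [LHS](aP (mode F gpsim l)) // piv andbT.
  - by rewrite andbF scale1r.
have [em em'] := ez.
have : \sum_i (c i * e i) *: zero_vec l a0 i = a0.
  rewrite -[RHS]piu uE (lin_sum lpi); apply: eq_bigr => i _.
  by rewrite (linZ lpi) em' scalerA.
by move/(zero_coeff ea a00); rewrite em mulr1.
Qed.
End Cover.
Local Open Scope complex_scope.

Theorem theorem2p4p3 (R : realType) (k : R[i]) (hk : k != 0)
  (Y : Vk k -> int -> Vk k -> Vk k) (hY : affine_vsa Y)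
  (n : R[i]) (l : int) (A : smod (agl11 R[i]))
  (hA : is_A_hat k (n - l%:~R + epsilon l) l A) :
  exists (YP : Vk k -> int ->
               P_hat k (n - l%:~R + epsilon l) l ->
               P_hat k (n - l%:~R + epsilon l) l)
         (hP : vertex_structure hY YP)
         (YA : Vk k -> int -> A -> A) (hYA : vertex_structure hY YA),
    projective_cover (Ofin hY) (to_vmod hP) (to_vmod hYA).
Proof.
have F0 (m : nat) : (m%:R == 0 :> R[i]) = (m == 0)%N := pnatr_eq0 _ m.
have [v [Pk pv tv gv uv]] := P_hat_universal hk n l.
have [a0 [b [Ak ha a00 ta ga]]] := A_hat_vector F0 hk hA erefl.
have [YP hP] := vertex_structure_exists F0 hk hY Pk (generated_smooth hk Pk tv gv).
have [YA hYA] := vertex_structure_exists F0 hk hY Ak (generated_smooth hk Ak ta ga).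
exists YP, hP, YA, hYA.
have hv : homog false v by rewrite /homog scale1r.
have OP := generated_Ofin F0 hk Pk hP hv tv gv; have OA := generated_Ofin F0 hk Ak hYA ha ta ga.
exact: (atypical_cover OP OA pv (to_vmod_vtype F0 hk hP Pk tv) (to_vmod_generated (F0 := F0) (k0 := hk) (hW := hP) Pk gv)
  (to_vmod_universal F0 hk hP Pk uv) ha a00 (to_vmod_vtype F0 hk hYA Ak ta) (to_vmod_generated (F0 := F0) (k0 := hk) (hW := hYA) Ak ga)).
Qed.
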